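(* Let $\mathcal A$ be an infinite radially symmetric antitree with sphere numbers $\{s_n\}_{n\ge0}$ and edge lengths $\{\ell_n\}_{n\ge0}$, and let $\mathbf H$ be its minimal Kirchhoff Laplacian. Then: (i) The operator $\mathbf H$ is self-adjoint if and only if the total volume of $\mathcal A$ is infinite, $$\mathrm{vol}(\mathcal A):=\sum_{e\in\mathcal E}|e|=\sum_{n\ge0}s_ns_{n+1}\ell_n=\infty .$$ (ii) If $\mathrm{vol}(\mathcal A)<\infty$, then the deficiency indices of $\mathbf H$ equal $1$ and the self-adjoint extensions of $\mathbf H$ form a one-parameter family $\mathbf H_\theta:=\mathbf H^*\upharpoonright\mathrm{dom}(\mathbf H_\theta)$, $\theta\in[0,\pi)$, where $$\mathrm{dom}(\mathbf H_\theta)=\{f\in\mathrm{dom}(\mathbf H^* ):\ \cos(\theta)\,(U_sP_{\rm sym}f)(\mathcal L)+\sin(\theta)\,(U_sP_{\rm sym}f)'_\mu(\mathcal L)=0\},$$ with $$(U_sP_{\rm sym}f)(\mathcal L):=\lim_{t\to\mathcal L}(U_sP_{\rm sym}f)(t),\qquad (U_sP_{\rm sym}f)_\mu'(\mathcal L):=\lim_{t\to\mathcal L}\mu(t)\,(U_sP_{\rm sym}f)'(t).$$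
   Context: Radially symmetric antitree: let $s_0=1$, $s_n\in\mathbb Z_{\ge1}$ ($n\ge1$) and $\ell_n>0$ ($n\ge0$). The infinite radially symmetric (metric) antitree $\mathcal A$ with sphere numbers $\{s_n\}$ and edge lengths $\{\ell_n\}$ is the rooted metric graph whose vertex set $\mathcal V$ is the disjoint union of finite sets $S_n$, $\#S_n=s_n$ ($S_0=\{o\}$, $o$ the root), in which every vertex of $S_n$ is joined by exactly one edge to every vertex of $S_{n+1}$ for all $n\ge 0$, there are no other edges, and each edge joining $S_n$ with $S_{n+1}$ is identified with an interval of length $\ell_n$. $\mathcal E$ is the edge set and $|e|$ the length of $e$. Kirchhoff Laplacian: $L^2(\mathcal A)=\bigoplus_{e\in\mathcal E}L^2(e)$. The operator $\mathbf H_0$ acts edgewise as $f_e\mapsto -f_e''$ on the set of all $f\in L^2(\mathcal A)$ vanishing outside finitely many edges, with $f_e\in H^2(e)$ for every $e\in\mathcal E$, and such that at every vertex $v$: $f$ is continuous at $v$, and $\sum_e f_e'(v)=0$, the sum running over the edges incident to $v$ and $f_e'(v)$ being the derivative at $v$ directed from $v$ into $e$. It is symmetric; the minimal Kirchhoff Laplacian is its closure $\mathbf H=\overline{\mathbf H_0}$. Notation: $t_0=0$, $t_n=\sum_{j=0}^{n-1}\ell_j$, $I_n=[t_n,t_{n+1})$, $\mathcal L=\sum_{n\ge0}\ell_n$, and $\mu(t)=s_ns_{n+1}$ for $t\in I_n$, $n\ge0$. For $x$ on an edge joining $S_n$ and $S_{n+1}$, $|x|$ is $t_n$ plus the distance along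 the edge from its endpoint in $S_n$. $P_{\rm sym}$ is the orthogonal projection in $L^2(\mathcal A)$ onto $\mathcal F_{\rm sym}=\{f\in L^2(\mathcal A): f(x)=f(y)\text{ if }|x|=|y|\}$, and $U_s:\mathcal F_{\rm sym}\to L^2([0,\mathcal L);\mu)$ is the unitary map sending $f$ to its radial profile $\tilde f$, $f(x)=\tilde f(|x|)$. Thus, for $t\in I_n$, $(U_sP_{\rm sym}f)(t)=\frac1{s_ns_{n+1}}\sum_e f(x_e(t))$, the sum running over all edges $e$ joining $S_n$ and $S_{n+1}$, where $x_e(t)$ is the point of $e$ with $|x_e(t)|=t$. *)

(* Defs.v *)
From mathcomp Require Import all_boot all_order all_algebra.
From mathcomp Require Import complex.
From mathcomp Require Import all_classical all_reals all_analysis.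

Set Implicit Arguments.
Unset Strict Implicit.
Unset Printing Implicit Defensive.

Import Order.TTheory GRing.Theory Num.Theory.
Import numFieldNormedType.Exports.

Local Open Scope classical_set_scope.
Local Open Scope ring_scope.
Local Open Scope complex_scope.

Section ComplexValued.
Context {R : realType}.
Implicit Types (f : R -> R[i]).

Definition cmeasurable (D : set R) f : Prop :=
  measurable_fun D (fun x => complex.Re (f x)) /\
  measurable_fun D (fun x => complex.Im (f x)).

Definition cint (D : set R) f : R[i] :=
  (\int[lebesgue_measure]_(x in D) complex.Re (f x)) +i*
  (\int[lebesgue_measure]_(x in D) complex.Im (f x)).

Definition cderive f (t : R) : R[i] :=
  derive1 (fun x => complex.Re (f x)) t +i* derive1 (fun x => complex.Im (f x)) t.

Definition ccvg (F : set_system R) f (a : R[i]) : Prop :=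
  (fun t => ComplexField.Normc.normc (f t - a)) @ F --> (0 : R).

Definition sqint (D : set R) f : \bar R :=
  (\int[lebesgue_measure]_(x in D) ((ComplexField.Normc.normc (f x)) ^+ 2)%:E)%E.

(* [W1 len f f1]: f is absolutely continuous on [0, len], with derivative f1
   almost everywhere, and f1 is square integrable.  Absolute continuity is
   expressed by f being the primitive of an integrable function.  Thus
   [W2 len f f1 f2] says that f belongs to the Sobolev space H^2(0, len), that
   f1 is its (continuous up to the endpoints) first derivative and that f2
   represents its second derivative. *)
Definition W1 (len : R) f f1 : Prop :=
  [/\ cmeasurable `[0, len] f1, (sqint `[0%R, len] f1 < +oo)%E &
      forall x : R, 0 <= x <= len -> f x = f 0 + cint `[0, x] f1].

Definition W2 (len : R) f f1 f2 : Prop := W1 len f f1 /\ W1 len f1 f2.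

End ComplexValued.

(** The antitree.  The vertices of S_n are the elements of 'I_(s n); the edge
    [Tagged _ (i, j)] with tag n joins i in S_n to j in S_(n+1). *)

Definition edge (s : nat -> nat) : Type := {n : nat & ('I_(s n) * 'I_(s n.+1))%type}.

Definition mkedge (s : nat -> nat) (n : nat) (i : 'I_(s n)) (j : 'I_(s n.+1)) :
  edge s := existT _ n (i, j).

(* [f e x] is the value of f at the point of the edge e at distance x from the
   endpoint of e lying in S_n, where n = tag e; only 0 <= x <= |e| matters. *)
Definition efun (R : realType) (s : nat -> nat) : Type := edge s -> R -> R[i].

Section Antitree.
Context {R : realType}.
Variables (s : nat -> nat) (l : nat -> R).
Local Notation efun := (efun R s).
Implicit Types (e : edge s) (f g u v : efun) (A B : set (efun * efun)).

Definition elen e : R := l (tag e).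

Definition vol : \bar R := \esum_(e in [set: edge s]) (elen e)%:E.

(** The Hilbert space L^2 of the antitree.  Its elements are represented by
    functions, equality in L^2 being [aeq]. *)

Definition aeq f g : Prop := forall e,
  {ae lebesgue_measure, forall x : R, 0 <= x <= elen e -> f e x = g e x}.

Definition sqnorm f : \bar R := \esum_(e in [set: edge s]) sqint `[0, elen e] (f e).

Definition fsub f g : efun := fun e x => f e x - g e x.

Definition L2 f : Prop :=
  (forall e, cmeasurable `[0, elen e] (f e)) /\ (sqnorm f < +oo)%E.

(* linear in the first argument; for f, g in L^2 the sum over the edges
   converges absolutely, so that its order is immaterial *)
Definition inner_upto f g (N : nat) : R[i] :=
  \sum_(n < N) \sum_(i < s n) \sum_(j < s n.+1)
    cint `[0, l n] (fun x => f (mkedge i j) x * conjc (g (mkedge i j) x)).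

Definition inner f g : R[i] :=
  limn (fun N => complex.Re (inner_upto f g N)) +i*
  limn (fun N => complex.Im (inner_upto f g N)).

(** Unbounded operators in L^2, identified with their graphs. *)

Definition closure_op A : set (efun * efun) :=
  [set p | [/\ L2 p.1, L2 p.2 & forall eps : R, 0 < eps ->
    exists q, [/\ A q,
      (sqnorm (fsub p.1 q.1) < eps%:E)%E &
      (sqnorm (fsub p.2 q.2) < eps%:E)%E]]].

Definition densely_defined A : Prop := forall f, L2 f -> forall eps : R, 0 < eps ->
  exists q, A q /\ (sqnorm (fsub f q.1) < eps%:E)%E.

Definition adjoint A : set (efun * efun) :=
  [set p | [/\ L2 p.1, L2 p.2 &
    forall q, A q -> inner q.2 p.1 = inner q.1 p.2]].

(* The graph of an adjoint consists of pairs of elements of L^2, is a linear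
   subspace stable under [aeq], and is single-valued modulo [aeq] when A is
   densely defined; so these properties need not be required separately. *)
Definition self_adjoint A : Prop := densely_defined A /\ adjoint A = A.

Definition ker_shift A (z : R[i]) : set efun :=
  [set f | A (f, fun e x => z * f e x)].

(* V, a subspace of L^2 described by representatives, has dimension d *)
Definition has_dim (V : set efun) (d : nat) : Prop :=
  exists b : 'I_d -> efun,
    [/\ forall k, V (b k),
        forall c : 'I_d -> R[i],
          aeq (fun e x => \sum_(k < d) c k * b k e x) (fun _ _ => 0) ->
          forall k, c k = 0 &
        forall f, V f -> exists c : 'I_d -> R[i],
          aeq f (fun e x => \sum_(k < d) c k * b k e x)].

(* n_+ = dim ker (A^* - i) = np and n_- = dim ker (A^* + i) = nm *)
Definition deficiency_indices A (np nm : nat) : Prop :=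
  has_dim (ker_shift (adjoint A) (0 +i* 1)) np /\
  has_dim (ker_shift (adjoint A) (0 -i* 1)) nm.

Definition continuous_at_vertices f : Prop :=
  exists c : forall n, 'I_(s n) -> R[i],
    forall n (i : 'I_(s n)) (j : 'I_(s n.+1)),
      f (mkedge i j) 0 = c n i /\ f (mkedge i j) (l n) = c n.+1 j.

(* sum at a vertex of S_n of the derivatives directed into the edges coming
   from S_(n-1), given the derivative f1 in the direction of increasing |x| *)
Definition flux_down (f1 : efun) (n : nat) : 'I_(s n) -> R[i] :=
  match n with
  | 0 => fun _ => 0
  | m.+1 => fun j => \sum_(i < s m) - f1 (mkedge i j) (l m)
  end.

Definition flux_up (f1 : efun) (n : nat) (i : 'I_(s n)) : R[i] :=
  \sum_(j < s n.+1) f1 (mkedge i j) 0.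

Definition kirchhoff f (f1 : efun) : Prop :=
  continuous_at_vertices f /\
  forall n (i : 'I_(s n)), flux_down f1 i + flux_up f1 i = 0.

(* each S_n being finite, vanishing outside finitely many edges amounts to
   vanishing on all edges beyond some sphere *)
Definition finitely_supported f : Prop :=
  exists N : nat, forall e, (N <= tag e)%N -> forall x : R, 0 <= x <= elen e -> f e x = 0.

Definition edgewise_W2 f (f1 f2 : efun) : Prop :=
  forall e, W2 (elen e) (f e) (f1 e) (f2 e).

Definition H0 : set (efun * efun) :=
  [set p | L2 p.1 /\ exists f f1 f2 : efun,
    [/\ aeq p.1 f, edgewise_W2 f f1 f2, finitely_supported f, kirchhoff f f1 &
        L2 p.2 /\ aeq p.2 (fun e x => - f2 e x)]].

Definition Hmin : set (efun * efun) := closure_op H0.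

Definition t_ (n : nat) : R := \sum_(0 <= k < n) l k.

Definition height : R := limn t_.

Definition level (t : R) : nat := get [set n : nat | t_ n <= t < t_ n.+1].

Definition mu (t : R) : R := (s (level t) * s (level t).+1)%:R.

(* The radial profile U_s P_sym f: orthogonally projecting onto the functions of
   |x| amounts to averaging over the s_n s_(n+1) edges between S_n and S_(n+1). *)
Definition radial f (t : R) : R[i] :=
  let n := level t in
  ((mu t)^-1)%:C * \sum_(i < s n) \sum_(j < s n.+1) f (mkedge i j) (t - t_ n).

(* The boundary values at [height] of the element of L^2 represented by f.
   They are computed on the representative belonging to H^2 on every edge; the
   limit of the derivative ranges over t different from all t_ n, since the
   profile has a derivative jump at t_ n in general. *)
Definition boundary_values f (a b : R[i]) : Prop :=
  exists f0 f1 f2 : efun,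
    [/\ aeq f f0, edgewise_W2 f0 f1 f2,
        ccvg height^'- (radial f0) a &
        ccvg (within (~` range t_) height^'-)
          (fun t => (mu t)%:C * cderive (radial f0) t) b].

Definition Htheta (theta : R) : set (efun * efun) :=
  [set p | adjoint Hmin p /\ exists a b, boundary_values p.1 a b /\
    (cos theta)%:C * a + (sin theta)%:C * b = 0].

End Antitree.

Arguments Hmin {R} s l _.
Arguments Htheta {R} s l theta _.

(* Main.v *)
(** A test function argument on every edge and at every vertex identifies the adjoint of [H0] with the
    maximal Kirchhoff Laplacian. An element of the latter whose radial averages vanish lies in the
    closure of [H0]: it can be cut off at a sphere after averaging over the outer ends of one layer of
    edges, since both the averages and their derivatives vanish there. What remains is the
    Sturm-Liouville problem of the radial profiles with weight [mu].

    In infinite volume the growing solution [u >= 1] of [u'' = u] is not square integrable. Subtracting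
    from a profile [a] suitable multiples of [u] and of a solution of [y'' = y - u], so that the
    difference can be cut off at S_N, changes (1 + H) a by a term tending to zero in norm, and 1 + H is
    coercive on square integrable profiles; hence [a] belongs to the closure.

    In finite volume every profile in the maximal domain has boundary values [(al, be)]. The closure
    consists of the elements with vanishing boundary values, and the boundary form of the maximal
    operator is the standard symplectic form of these values, so that self-adjoint extensions correspond
    to its Lagrangian lines. The deficiency spaces are spanned by the radial solution of [u'' = - z u],
    which is bounded by a Gronwall estimate over the layers. *)
Require Import Defs.
From mathcomp Require Import all_boot all_order all_algebra.
From mathcomp Require Import complex ring lra.
From mathcomp Require Import all_classical all_reals all_analysis.
From mathcomp Require Import measurable_realfun.
Set Implicit Arguments.
Unset Strict Implicit.
Unset Printing Implicit Defensive.
Import Order.TTheory GRing.Theory Num.Theory.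
Import numFieldNormedType.Exports.

Local Open Scope classical_set_scope.
Local Open Scope ring_scope.
Local Open Scope complex_scope.

(** * Integration on an edge *)

(** In infinite volume 1 + H is used instead of the deficiency spaces at i and -i because its
    solutions are real and positive: this gives [u >= 1], and the same sign structure makes |a|^2
    monotone once energy flows outwards. Cutting a profile at S_N means removing a value and a
    slope, hence the two corrections. A multiple of [u] is invisible to 1 + H, and [c y] contributes
    only [c u]; Green's formula forces c = (k, u) / (u, u) over the first N layers, with k = (1 + H)
    a. The error there is the projection of k onto u, and it fades because (u, u) is at least the
    volume and diverges. In finite volume the same device runs with the constant 1 and a solution of
    y'' = -1: its flux through S_N is minus the enclosed volume, thus bounded away from zero, so
    vanishing boundary values of a make both coefficients small. Boundary values are introduced
    through some representative; that they do not depend on it follows from nondegeneracy of the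
    boundary form. Operators are sets of pairs of representatives, so equality of operators includes
    stability under [aeq]. *)

Section IntervalIntegral.
Context {R : realType}.
Notation mu := (@lebesgue_measure R).
Implicit Types (f g : R -> R) (l x a : R).

Definition intg l f : Prop := mu.-integrable `[0, l] (EFin \o f).

Lemma intgD l f g : intg l f -> intg l g -> intg l (fun x => f x + g x).
Proof. by move=> hf hg; apply: eq_integrable (integrableD _ hf hg) => //; exact: measurable_itv. Qed.

Lemma intgZ l a f : intg l f -> intg l (fun x => a * f x).
Proof. by move=> hf; apply: eq_integrable (integrableZl _ a hf) => //; exact: measurable_itv. Qed.

Lemma intgN l f : intg l f -> intg l (fun x => - f x).
Proof. by move=> hf; have := integrableN hf; apply: eq_integrable => //; exact: measurable_itv. Qed.

Lemma intg_le l f g : measurable_fun `[0, l] f ->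
  (forall x, 0 <= x <= l -> `|f x| <= g x) -> intg l g -> intg l f.
Proof.
move=> mf h; apply: le_integrable => //; first exact/measurable_EFinP.
move=> x /=; rewrite in_itv /= => Dx; rewrite lee_fin; apply: (le_trans (h _ Dx)); exact: ler_norm.
Qed.

Lemma intg_meas l f : intg l f -> measurable_fun `[0, l] f.
Proof. by move=> /measurable_int /measurable_EFinP. Qed.

Lemma intg_cst l a : intg l (fun=> a).
Proof.
apply: (measurable_bounded_integrable (mu := mu)) => //=.
- rewrite lebesgue_measure_itv/=; case: ifP => _; by rewrite ltry.
- exact: bounded_cst.
Qed.

Lemma intgS x l f : x <= l -> intg l f -> intg x f.
Proof.
move=> xl; apply: integrableS => //; apply: subset_itvl.
by rewrite bnd_simp.
Qed.

Lemma eq_intg l f g : (forall x, 0 <= x <= l -> f x = g x) -> intg l f -> intg l g.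
Proof. by move=> h; apply: eq_integrable => // x; rewrite inE /= in_itv /= => xD /=; rewrite h. Qed.

Definition rL2 l f := measurable_fun `[0, l] f /\ intg l (fun x => f x ^+ 2).

Lemma rL2_mul l f g : rL2 l f -> rL2 l g -> intg l (fun x => f x * g x).
Proof.
move=> [mf hf] [mg hg]; apply: (@intg_le _ _ (fun x => f x ^+ 2 + g x ^+ 2)) => //.
- exact: measurable_funM.
- move=> x _; rewrite ler_norml; apply/andP; split; nra.
- exact: intgD.
Qed.

Lemma rL2_intg l f : rL2 l f -> intg l f.
Proof.
move=> [mf hf]; apply: (@intg_le _ _ (fun x => f x ^+ 2 + 1)) => //.
- move=> x _; rewrite ler_norml; apply/andP; split; nra.
- by apply: intgD => //; exact: intg_cst.
Qed.

Lemma rL2_lin l a b f g : rL2 l f -> rL2 l g -> rL2 l (fun x => a * f x + b * g x).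
Proof.
move=> hf hg; have [mf _] := hf; have [mg _] := hg; split.
  by apply: measurable_funD; apply: measurable_funM => //; exact: measurable_cst.
apply: (@eq_intg _ (fun x => a ^+ 2 * f x ^+ 2 + ((2 * a * b) * (f x * g x) + b ^+ 2 * g x ^+ 2))) => //.
  by move=> x _; ring.
apply: intgD => //; first by apply: intgZ => //; case: hf.
by apply: intgD => //; apply: intgZ => //; [exact: rL2_mul|case: hg].
Qed.

Lemma rL2S x l f : x <= l -> rL2 l f -> rL2 x f.
Proof.
move=> xl [mf hf]; split; last exact: intgS hf.
apply: measurable_funS mf => //; apply: subset_itvl; by rewrite bnd_simp.
Qed.

Lemma rL2_bounded l f M : measurable_fun `[0, l] f ->
  (forall x, 0 <= x <= l -> `|f x| <= M) -> rL2 l f.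
Proof.
move=> mf hM; split => //; apply: (@intg_le _ _ (fun=> M ^+ 2)) => //.
- by apply: measurable_funX.
- move=> x /hM h; rewrite normrX ler_sqr ?nnegrE //.
  exact: le_trans h.
- exact: intg_cst.
Qed.

Lemma EFin_Rint l f : intg l f ->
  (\int[mu]_(x in `[0%R, l]) f x)%:E = (\int[mu]_(x in `[0%R, l]) (f x)%:E)%E.
Proof. by move=> hf; rewrite /Rintegral fineK //; exact: integrable_fin_num. Qed.

Lemma eq_Rint l f g : (forall x, 0 <= x <= l -> f x = g x) ->
  \int[mu]_(x in `[0, l]) f x = \int[mu]_(x in `[0, l]) g x.
Proof. by move=> h; apply: eq_Rintegral => x; rewrite inE /= in_itv; exact: h. Qed.


Lemma patch_itv (T : pointedType) (h : R -> T) (a b y : R) :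
  (h \_ `[a, b]) y = if a <= y <= b then h y else point.
Proof. by rewrite patchE; congr (if _ then _ else _); apply/idP/idP; rewrite inE /= in_itv. Qed.

(** Derivatives are only integrable functions here, so integration by parts rests on exchanging the
    order of integration over the triangle y <= x. The factors are extended by zero to the line and
    the triangle enters as an indicator. *)
Lemma fubini_triangle l f g : intg l f -> intg l g ->
  \int[mu]_(x in `[0, l]) (f x * \int[mu]_(y in `[0, x]) g y) =
  \int[mu]_(y in `[0, l]) (g y * (\int[mu]_(x in `[0, l]) f x - \int[mu]_(x in `[0, y]) f x)).
Proof.
move=> hf hg.
pose D := [set` `[0, l]] : set (measurableTypeR R).
pose phi := f \_ D; pose psi := g \_ D.
have mD : measurable D by exact: measurable_itv.
have iphi : mu.-integrable setT (EFin \o phi).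
  by rewrite /phi -restrict_EFin; apply/(integrable_mkcond _ mD).
have ipsi : mu.-integrable setT (EFin \o psi).
  by rewrite /psi -restrict_EFin; apply/(integrable_mkcond _ mD).
pose T : set (measurableTypeR R * measurableTypeR R) := [set z | z.2 <= z.1].
have mphi : measurable_fun setT phi by move/measurable_int : iphi => /measurable_EFinP.
have mpsi : measurable_fun setT psi by move/measurable_int : ipsi => /measurable_EFinP.
have mT : measurable T.
  rewrite -[T]setTI; exact: measurable_fun_le.
pose K (z : measurableTypeR R * measurableTypeR R) : \bar R := (phi z.1 * psi z.2 * \1_T z)%:E.
have mK : measurable_fun setT K.
  apply/measurable_EFinP; apply: measurable_funM; last exact: measurable_indic.
  apply: measurable_funM; exact: measurableT_comp.
have iK : (mu \x mu)%E.-integrable setT K.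
  apply/(integrable12ltyP mu mu mK).
  (* The kernel is dominated by |phi x| |psi y|, whose iterated integral is a product of two finite
     integrals. *)
  apply: (@le_lt_trans _ _ (\int[mu]_x ((\int[mu]_y `|psi y|%:E) * `|phi x|%:E))%E).
    apply: ge0_le_integral => //.
    - by move=> x _; apply: integral_ge0.
    - apply: (measurable_fun_fubini_tonelli_F (abse \o K)) => //=; exact: measurableT_comp.
    - apply: emeasurable_funM => //; apply/measurable_EFinP; exact: measurableT_comp.
    - move=> x _; rewrite muleC -ge0_integralZl//; last by apply/measurable_EFinP; exact: measurableT_comp.
      apply: ge0_le_integral => //.
      + by do 2 apply: measurableT_comp => //; exact: measurable_pair1.
      + apply: emeasurable_funM => //; apply/measurable_EFinP; exact: measurableT_comp.
      + move=> y _; rewrite /K /= lee_fin !normrM; apply: ler_piMr; first exact: mulr_ge0.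
        by rewrite indicE; case: (_ \in _); rewrite ?normr1 ?normr0.
  move: iphi ipsi => /integrableP[_ h1] /integrableP[_ h2].
  rewrite ge0_integralZl//; first by apply: lte_mul_pinfty => //; [exact: integral_ge0|rewrite ge0_fin_numE //; exact: integral_ge0].
  + by apply/measurable_EFinP; exact: measurableT_comp.
  + exact: integral_ge0.
have E : (\int[mu]_x fubini_F mu K x)%E = (\int[mu]_y fubini_G mu K y)%E.
  by rewrite (integral12_prod_meas2 iK) (integral21_prod_meas2 iK).
rewrite /Rintegral; congr fine.
have KE x y : K (x, y) = ((if 0 <= x <= l then f x else 0) *
    (if 0 <= y <= l then g y else 0) * (y <= x)%R%:R)%:E.
  have Te : ((x, y) \in T) = (y <= x) by apply/idP/idP; rewrite inE.
  by rewrite /K /phi /psi /= !patch_itv indicE Te.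
clear iphi ipsi mphi mpsi mT mK iK; clearbody K.
transitivity (\int[mu]_x fubini_F mu K x)%E; last rewrite E.
- rewrite [LHS]integral_mkcond; apply: eq_integral => x _.
  rewrite patch_itv /fubini_F; case: ifPn => [/andP[x0 xl]|xD]; last first.
    by rewrite integral0_eq // => y _; rewrite KE (negbTE xD) !mul0r.
  rewrite EFinM (_ : (fine _)%:E = \int[mu]_(y in `[0%R, x]) (g y)%:E)%E; last first.
    by rewrite -EFin_Rint //; exact: intgS hg.
  rewrite -integralZl //; last exact: intgS hg.
  rewrite integral_mkcond; apply: eq_integral => y _.
  rewrite patch_itv KE x0 xl /=; have [yx|xy] := leP y x; last by rewrite andbF mulr0.
  by rewrite andbT mulr1 (le_trans yx xl) andbT; case: ifP => _; rewrite ?mulr0.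
- rewrite [RHS]integral_mkcond; apply: eq_integral => y _.
  rewrite patch_itv /fubini_G; case: ifPn => [/andP[y0 yl]|yD]; last first.
    by rewrite integral0_eq // => x _; rewrite KE (negbTE yD) mulr0 mul0r.
  have hfy : mu.-integrable `[y, l] (EFin \o f).
    apply: integrableS hf => //; apply: subset_itvr; by rewrite bnd_simp.
  have -> : fine (\int[mu]_(x in `[0, l]) (f x)%:E) - fine (\int[mu]_(x in `[0, y]) (f x)%:E) =
     \int[mu]_(x in `[y, l]) f x.
    rewrite -Rintegral_itv_obnd_cbnd; last first.
      apply: integrableS hf => //; apply: subset_itvr; by rewrite bnd_simp.
    by rewrite -(@Rintegral_itvB _ f (BLeft 0) (BRight l) y).
  rewrite EFinM /Rintegral fineK; last exact: integrable_fin_num.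
  rewrite -integralZl // [RHS]integral_mkcond; apply: eq_integral => x _.
  rewrite patch_itv KE y0 yl /=; have [yx|xy] := leP y x; last by rewrite mulr0.
  by rewrite mulr1 (le_trans y0 yx) /=; case: ifP => _; rewrite ?mul0r // mulrC EFinM.
Qed.

Lemma le_prim l f x : intg l f -> 0 <= x <= l ->
  `|\int[mu]_(y in `[0, x]) f y| <= \int[mu]_(y in `[0, l]) `|f y|.
Proof.
move=> hf /andP[x0 xl].
have hx : intg x f by exact: intgS hf.
apply: (le_trans (le_normr_Rintegral _ hx)) => //.
have ha : intg l (fun y => `|f y|) by exact: integrable_norm.
rewrite -lee_fin !EFin_Rint //; last exact: intgS ha.
apply: ge0_subset_integral => //=.
- by apply/measurable_EFinP; exact: intg_meas.
- by apply: subset_itvl; rewrite bnd_simp.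
Qed.

Lemma prim_meas l f : 0 <= l -> intg l f ->
  measurable_fun `[0, l] (fun x => \int[mu]_(y in `[0, x]) f y).
Proof.
move=> l0 hf; apply: subspace_continuous_measurable_fun => //.
exact: (parameterized_integral_continuous l0 hf).
Qed.

Lemma intg_mul_bounded l f g M : measurable_fun `[0, l] g ->
  (forall x, 0 <= x <= l -> `|g x| <= M) -> intg l f -> intg l (fun x => f x * g x).
Proof.
move=> mg hM hf; apply: (@intg_le _ _ (fun x => M * `|f x|)).
- apply: measurable_funM => //; exact: intg_meas.
- by move=> x /hM h; rewrite normrM mulrC; apply: ler_wpM2r.
- by apply: intgZ; exact: integrable_norm.
Qed.

(** The two triangles y <= x and x <= y fill the square. *)
Lemma int_parts0 l f g : 0 <= l -> intg l f -> intg l g ->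
  \int[mu]_(x in `[0, l]) (f x * (\int[mu]_(y in `[0, x]) g y) +
    (\int[mu]_(y in `[0, x]) f y) * g x) =
  (\int[mu]_(x in `[0, l]) f x) * (\int[mu]_(x in `[0, l]) g x).
Proof.
move=> l0 hf hg.
have P h1 h2 : intg l h1 -> intg l h2 -> intg l (fun x => h1 x * (\int[mu]_(y in `[0, x]) h2 y)).
  move=> i1 i2; apply: (@intg_mul_bounded _ _ _ (\int[mu]_(y in `[0, l]) `|h2 y|)) => //.
  - exact: prim_meas.
  - by move=> x hx; exact: le_prim.
rewrite RintegralD //; last first.
  by apply: (@eq_intg _ (fun x => g x * (\int[mu]_(y in `[0, x]) f y))); [move=> x _; rewrite mulrC|exact: P].
- exact: P.
rewrite (fubini_triangle hf hg).
rewrite (@eq_Rint l _ (fun y => (\int[mu]_(x in `[0, l]) f x) * g y - g y * (\int[mu]_(x in `[0, y]) f x))); last first.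
  by move=> y _; rewrite mulrBr mulrC.
rewrite RintegralB //; last exact: P.
  rewrite RintegralZl // [X in _ - X + _](@eq_Rint _ _ (fun y => (\int[mu]_(x in `[0, y]) f x) * g y)) ?subrK //.
  by move=> y _; rewrite mulrC.
exact: intgZ.
Qed.

Definition rW1 l f f1 : Prop := rL2 l f1 /\
  forall x, 0 <= x <= l -> f x = f 0 + \int[mu]_(y in `[0, x]) f1 y.

Lemma rW1_meas l f f1 : 0 <= l -> rW1 l f f1 -> measurable_fun `[0, l] f.
Proof.
move=> l0 [/rL2_intg h1 h2].
apply: (eq_measurable_fun (fun x => f 0 + \int[mu]_(y in `[0, x]) f1 y)).
  by move=> x; rewrite inE /= in_itv /= => /h2.
by apply: measurable_funD; [exact: measurable_cst|exact: prim_meas].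
Qed.

Lemma rW1_bounded l f f1 : rW1 l f f1 -> exists M, forall x, 0 <= x <= l -> `|f x| <= M.
Proof.
move=> [/rL2_intg h1 h2]; exists (`|f 0| + \int[mu]_(y in `[0, l]) `|f1 y|) => x hx.
rewrite h2 //; apply: (le_trans (ler_normD _ _)); rewrite lerD2l; exact: le_prim.
Qed.

Lemma rW1_rL2 l f f1 : 0 <= l -> rW1 l f f1 -> rL2 l f.
Proof.
move=> l0 h; have [M hM] := rW1_bounded h.
by apply: rL2_bounded hM; exact: rW1_meas h.
Qed.

Lemma rW1S x l f f1 : x <= l -> rW1 l f f1 -> rW1 x f f1.
Proof.
move=> xl [h1 h2]; split; first exact: rL2S h1.
by move=> y /andP[y0 yx]; apply: h2; rewrite y0 (le_trans yx).
Qed.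

Lemma rW1_lin l a b f g f1 g1 : rW1 l f f1 -> rW1 l g g1 ->
  rW1 l (fun x => a * f x + b * g x) (fun x => a * f1 x + b * g1 x).
Proof.
move=> [hf hf'] [hg hg']; split; first exact: rL2_lin.
move=> x /andP[x0 xl].
have if1 : intg x f1 by apply: rL2_intg; exact: rL2S hf.
have ig1 : intg x g1 by apply: rL2_intg; exact: rL2S hg.
rewrite RintegralD ?RintegralZl //; try exact: intgZ.
have hx : 0 <= x <= l by rewrite x0.
by rewrite (hf' x hx) (hg' x hx) !mulrDr addrACA.
Qed.

Lemma rW1_cont l f f1 : 0 <= l -> rW1 l f f1 -> {within `[0, l], continuous f}.
Proof.
move=> l0 [/rL2_intg h1 h2].
have c := parameterized_integral_continuous l0 h1.
have c' : {within `[0, l], continuous (fun x => f 0 + \int[mu]_(y in `[0, x]) f1 y)}.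
  by move=> x; apply: cvgD; [exact: cvg_cst|exact: c].
apply: subspace_eq_continuous c' => x; rewrite inE /= in_itv /= => hx.
by rewrite /from_subspace -(h2 x hx).
Qed.

Lemma int_parts l f g f1 g1 : 0 <= l -> rW1 l f f1 -> rW1 l g g1 ->
  \int[mu]_(x in `[0, l]) (f1 x * g x + f x * g1 x) = f l * g l - f 0 * g 0.
Proof.
move=> l0 hf hg.
have [/rL2_intg if1 hf'] := hf; have [/rL2_intg ig1 hg'] := hg.
rewrite (@eq_Rint l _ (fun x =>
   (f1 x * (\int[mu]_(y in `[0, x]) g1 y) + (\int[mu]_(y in `[0, x]) f1 y) * g1 x)
   + (g 0 * f1 x + f 0 * g1 x))); last first.
  move=> x hx; rewrite (hf' x) // (hg' x) //.
  by rewrite mulrDr mulrDl (mulrC (f1 x) (g 0)) addrACA addrC.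
have P h1 h2 : intg l h1 -> intg l h2 -> intg l (fun x => h1 x * (\int[mu]_(y in `[0, x]) h2 y)).
  move=> i1 i2; apply: (@intg_mul_bounded _ _ _ (\int[mu]_(y in `[0, l]) `|h2 y|)) => //.
  - exact: prim_meas.
  - by move=> x hx; exact: le_prim.
have e : 0 <= l <= l by rewrite l0 lexx.
rewrite RintegralD //; first last.
- by apply: intgD; exact: intgZ.
- apply: intgD; first exact: P.
  by apply: (@eq_intg _ (fun x => g1 x * (\int[mu]_(y in `[0, x]) f1 y))); [move=> x _; rewrite mulrC|exact: P].
rewrite int_parts0 // RintegralD // ?RintegralZl //; try exact: intgZ.
rewrite (hf' l e) (hg' l e).
move: (Rintegral _ _ _) (Rintegral _ _ _) => A B; ring.
Qed.

Lemma rW1_C1 l f f1 : 0 <= l -> (forall x, 0 <= x <= l -> is_derive x 1 f (f1 x)) ->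
  (forall x, 0 <= x <= l -> {for x, continuous f1}) -> rW1 l f f1.
Proof.
move=> l0 df cf1.
have cw (x : R) : x <= l -> {within `[0, x], continuous f1}.
  move=> xl; apply: continuous_in_subspaceT => y; rewrite inE /= in_itv /= => /andP[y0 yx].
  by apply: cf1; rewrite y0 (le_trans yx).
split.
- have int : intg l f1.
    by apply: continuous_compact_integrable; [exact: segment_compact|exact: cw].
  split; first exact: intg_meas.
  apply: continuous_compact_integrable; first exact: segment_compact.
  apply: continuous_in_subspaceT => y; rewrite inE /= in_itv /= => hy.
  by apply: (@continuous_comp _ _ _ f1 (fun y => y ^+ 2)); [exact: cf1|exact: exprn_continuous].
- move=> x /andP[x0 xl].
  have [->|xn0] := eqVneq x 0.
    by rewrite set_itv1 Rintegral_set1 addr0.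
  have xp : 0 < x by rewrite lt_neqAle eq_sym xn0.
  apply/eqP; rewrite addrC -subr_eq; apply/eqP/esym.
  have c y : 0 <= y <= x -> {for y, continuous f}.
    move=> /andP[y0 yx]; apply: differentiable_continuous; apply/derivable1_diffP.
    by have [] : is_derive y 1 f (f1 y) by apply: df; rewrite y0 (le_trans yx).
  rewrite /Rintegral (continuous_FTC2 xp (cw x xl) (F := f)) //.
  + split=> [y||].
    * rewrite in_itv /= => /andP[y0 yx].
      by have [] : is_derive y 1 f (f1 y) by apply: df; rewrite ltW // (le_trans (ltW yx)).
    * by apply: cvg_at_right_filter; apply: c; rewrite lexx.
    * by apply: cvg_at_left_filter; apply: c; rewrite lexx andbT.
  + move=> y; rewrite in_itv /= => /andP[y0 yx]; rewrite derive1E.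
    by have [] : is_derive y 1 f (f1 y) by apply: df; rewrite ltW // (le_trans (ltW yx)).
Qed.

(** A nonzero value would persist on a nondegenerate interval around x, which a null set cannot
    contain. *)
Lemma cont_ae0 l f : 0 < l -> {within `[0, l], continuous f} ->
  {ae mu, forall x, 0 <= x <= l -> f x = 0} -> forall x, 0 <= x <= l -> f x = 0.
Proof.
move=> l0 /subspace_continuousP cf [N [mN N0 hN]] x hx.
apply/eqP/negPn/negP => fx0.
have Dx : `[0, l]%classic x by rewrite /= in_itv.
have : nbhs (f x) [set z | z != 0].
  by apply: open_nbhs_nbhs; split => //; exact: open_neq.
move=> /(cf x Dx); rewrite /= nbhs_simpl /= => /nbhs_ballP[d /= d0 hd].
(* Clipping to [0, l] keeps the interval nondegenerate even if x is an endpoint, because 0 < l;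
   halving d keeps the closed interval inside the ball. *)
pose a := Num.max 0 (x - d / 2); pose b := Num.min l (x + d / 2).
have ab : a < b.
  rewrite /a /b lt_min !gt_max l0 /=; move/andP: hx => [h1 h2].
  by apply/and3P; split; lra.
have sub : `[a, b]%classic `<=` N.
  move=> y /=; rewrite in_itv /= /a /b ge_max le_min => /andP[/andP[y1 y2] /andP[y3 y4]].
  apply: hN => /= h.
  have Dy : 0 <= y <= l by rewrite y1.
  have : f y != 0.
    apply: hd; last by rewrite /= in_itv.
    by rewrite /ball /= ltr_norml; apply/andP; split; lra.
  by rewrite h // eqxx.
have : (mu `[a, b]%classic <= mu N)%E by apply: le_measure => //; rewrite inE.
rewrite N0 lebesgue_measure_itv /= lte_fin ab -EFinB lee_fin; lra.
Qed.

Lemma ae0_Rintegral l f : measurable_fun `[0, l] f -> (forall x, 0 <= x <= l -> 0 <= f x) -> intg l f ->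
  \int[mu]_(x in `[0, l]) f x = 0 -> {ae mu, forall x, 0 <= x <= l -> f x = 0}.
Proof.
move=> mf f0 hf h.
have mE : measurable_fun `[0, l] (EFin \o f) by apply/measurable_EFinP.
have : (\int[mu]_(x in `[0%R, l]) `|(f x)%:E|)%E = 0%E.
  rewrite -[RHS](_ : (\int[mu]_(x in `[0%R, l]) f x)%:E = 0%E); last by rewrite h.
  rewrite EFin_Rint //; apply: eq_integral => x; rewrite inE /= in_itv /= => hx.
  by rewrite ger0_norm // f0.
move/(ae_eq_integral_abs mu (measurable_itv _) mE); apply: filterS => x /= hx h'.
by have := hx; rewrite in_itv /= => /(_ h') [].
Qed.

Lemma Rintegral_ae0 l f : measurable_fun `[0, l] f ->
  {ae mu, forall x, 0 <= x <= l -> f x = 0} -> \int[mu]_(x in `[0, l]) f x = 0.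
Proof.
move=> mf h; rewrite /Rintegral.
rewrite (ae_eq_integral (cst 0%E)) ?integral0 //; first by apply/measurable_EFinP.
move: h; apply: filterS; first exact: (ae_filter_ringOfSetsType mu).
by move=> x hx; rewrite /= in_itv /= => /hx ->.
Qed.

End IntervalIntegral.

(** * Complex-valued functions on an edge *)

Section ComplexInterval.
Context {R : realType}.
Notation mu := (@lebesgue_measure R).
Notation C := R[i].
Notation Re := complex.Re.
Notation Im := complex.Im.
Notation normc := ComplexField.Normc.normc.
Implicit Types (f g h : R -> C) (a b c z w : C) (l x t : R).

Lemma complexP z w : Re z = Re w -> Im z = Im w -> z = w.
Proof. by case: z w => [a b] [c d] /= -> ->. Qed.

Lemma ReM z w : Re (z * w) = Re z * Re w - Im z * Im w. Proof. by case: z w => [a b] [c d]. Qed.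
Lemma ImM z w : Im (z * w) = Re z * Im w + Im z * Re w. Proof. by case: z w => [a b] [c d]. Qed.
Lemma ReD z w : Re (z + w) = Re z + Re w. Proof. by case: z w => [a b] [c d]. Qed.
Lemma ImD z w : Im (z + w) = Im z + Im w. Proof. by case: z w => [a b] [c d]. Qed.
Lemma ReN z : Re (- z) = - Re z. Proof. by case: z. Qed.
Lemma ImN z : Im (- z) = - Im z. Proof. by case: z. Qed.
Lemma ReJ z : Re (conjc z) = Re z. Proof. by case: z. Qed.
Lemma ImJ z : Im (conjc z) = - Im z. Proof. by case: z. Qed.
Lemma ReC (r : R) : Re r%:C = r. Proof. by []. Qed.
Lemma ImC (r : R) : Im r%:C = 0. Proof. by []. Qed.
Definition cE := (ReM, ImM, ReD, ImD, ReN, ImN, ReJ, ImJ).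

Lemma normc2 z : normc z ^+ 2 = Re z ^+ 2 + Im z ^+ 2.
Proof. by case: z => [a b] /=; rewrite sqr_sqrtr // addr_ge0 // sqr_ge0. Qed.

Lemma conjcM z w : conjc (z * w) = conjc z * conjc w.
Proof. by apply: complexP; rewrite !cE; ring. Qed.
Lemma conjcD z w : conjc (z + w) = conjc z + conjc w.
Proof. by apply: complexP; rewrite !cE; ring. Qed.
Lemma conjcN z : conjc (- z) = - conjc z.
Proof. by apply: complexP; rewrite !cE. Qed.
Lemma conjccK z : conjc (conjc z) = z.
Proof. by apply: complexP; rewrite !cE // opprK. Qed.
Lemma mul_conjc z : z * conjc z = (normc z ^+ 2)%:C.
Proof. by apply: complexP; rewrite normc2 !cE /=; ring. Qed.
Lemma normcM2 z w : normc (z * w) ^+ 2 = normc z ^+ 2 * normc w ^+ 2.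
Proof. by rewrite !normc2 !cE; ring. Qed.
Lemma normcN2 z : normc (- z) ^+ 2 = normc z ^+ 2.
Proof. by rewrite !normc2 !cE; ring. Qed.
Lemma normc2_eq0 z : normc z ^+ 2 = 0 -> z = 0.
Proof.
rewrite normc2 => h; apply: complexP => /=; nra.
Qed.

Lemma normcD2 z w : normc (z + w) ^+ 2 <= 2 * normc z ^+ 2 + 2 * normc w ^+ 2.
Proof.
rewrite !normc2 !cE; case: z w => [p q] [r s] /=.
have := sqr_ge0 (p - r); have := sqr_ge0 (q - s); nra.
Qed.

Definition cL2 l f := rL2 l (fun x => Re (f x)) /\ rL2 l (fun x => Im (f x)).
Definition cintg l f := intg l (fun x => Re (f x)) /\ intg l (fun x => Im (f x)).
Definition nrm l f : R := \int[mu]_(x in `[0, l]) (normc (f x) ^+ 2).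
Definition ip l f g : C := cint `[0, l] (fun x => f x * conjc (g x)).

Lemma eq_cint l f g : (forall x, 0 <= x <= l -> f x = g x) -> cint `[0, l] f = cint `[0, l] g.
Proof. by move=> h; rewrite /cint; congr (_ +i* _); apply: eq_Rint => x /h ->. Qed.

Lemma RintD l (f g : R -> R) : intg l f -> intg l g ->
  \int[mu]_(x in `[0, l]) (f x + g x) = \int[mu]_(x in `[0, l]) f x + \int[mu]_(x in `[0, l]) g x.
Proof. by move=> *; exact: RintegralD. Qed.
Lemma RintB l (f g : R -> R) : intg l f -> intg l g ->
  \int[mu]_(x in `[0, l]) (f x - g x) = \int[mu]_(x in `[0, l]) f x - \int[mu]_(x in `[0, l]) g x.
Proof. by move=> *; exact: RintegralB. Qed.
Lemma RintZ l r (f : R -> R) : intg l f ->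
  \int[mu]_(x in `[0, l]) (r * f x) = r * \int[mu]_(x in `[0, l]) f x.
Proof. by move=> *; exact: RintegralZl. Qed.
Lemma intgB l (f g : R -> R) : intg l f -> intg l g -> intg l (fun x => f x - g x).
Proof. by move=> hf hg; apply: intgD => //; exact: intgN. Qed.

Lemma cintgZ l a f : cintg l f -> cintg l (fun x => a * f x).
Proof.
move=> [h1 h2]; split.
- apply: (@eq_intg _ _ (fun x => Re a * Re (f x) - Im a * Im (f x))).
    by move=> x _; rewrite !cE.
  by apply: intgB; exact: intgZ.
- apply: (@eq_intg _ _ (fun x => Re a * Im (f x) + Im a * Re (f x))).
    by move=> x _; rewrite !cE.
  by apply: intgD; exact: intgZ.
Qed.

Lemma cintgD l f g : cintg l f -> cintg l g -> cintg l (fun x => f x + g x).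
Proof.
move=> [h1 h2] [h3 h4]; split.
- apply: (@eq_intg _ _ (fun x => Re (f x) + Re (g x))); last exact: intgD.
  by move=> x _; rewrite !cE.
- apply: (@eq_intg _ _ (fun x => Im (f x) + Im (g x))); last exact: intgD.
  by move=> x _; rewrite !cE.
Qed.

Lemma cintZ l a f : cintg l f -> cint `[0, l] (fun x => a * f x) = a * cint `[0, l] f.
Proof.
move=> [h1 h2]; apply: complexP; rewrite !cE /=.
- rewrite (@eq_Rint _ _ _ (fun x => Re a * Re (f x) - Im a * Im (f x))); last by move=> x _; rewrite !cE.
  by rewrite RintB ?RintZ //; exact: intgZ.
- rewrite (@eq_Rint _ _ _ (fun x => Re a * Im (f x) + Im a * Re (f x))); last by move=> x _; rewrite !cE.
  by rewrite RintD ?RintZ //; exact: intgZ.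
Qed.

Lemma cintD l f g : cintg l f -> cintg l g ->
  cint `[0, l] (fun x => f x + g x) = cint `[0, l] f + cint `[0, l] g.
Proof.
move=> [h1 h2] [h3 h4]; apply: complexP; rewrite !cE /=.
- rewrite (@eq_Rint _ _ _ (fun x => Re (f x) + Re (g x))); last by move=> x _; rewrite !cE.
  by rewrite RintD.
- rewrite (@eq_Rint _ _ _ (fun x => Im (f x) + Im (g x))); last by move=> x _; rewrite !cE.
  by rewrite RintD.
Qed.

Lemma cintJ l f : cintg l f -> cint `[0, l] (fun x => conjc (f x)) = conjc (cint `[0, l] f).
Proof.
move=> [h1 h2]; apply: complexP; rewrite !cE /=.
- by apply: eq_Rint => x _; rewrite cE.
- rewrite (@eq_Rint _ _ _ (fun x => -1 * Im (f x))); last by move=> x _; rewrite !cE mulN1r.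
  by rewrite RintZ // mulN1r.
Qed.

Lemma cint_lin l a b f g : cintg l f -> cintg l g ->
  cint `[0, l] (fun x => a * f x + b * g x) = a * cint `[0, l] f + b * cint `[0, l] g.
Proof. by move=> hf hg; rewrite cintD ?cintZ //; exact: cintgZ. Qed.

Lemma cintN l f : cintg l f -> cint `[0, l] (fun x => - f x) = - cint `[0, l] f.
Proof.
move=> h; rewrite -mulN1r -cintZ //; apply: eq_cint => x _; by rewrite mulN1r.
Qed.

Lemma eq_rL2 l (f g : R -> R) : (forall x, 0 <= x <= l -> f x = g x) -> rL2 l f -> rL2 l g.
Proof.
move=> h [h1 h2]; split; last by apply: eq_intg h2 => x /h ->.
by apply: eq_measurable_fun h1 => x; rewrite inE /= in_itv => /h.
Qed.

Lemma eq_cL2 l f g : (forall x, 0 <= x <= l -> f x = g x) -> cL2 l f -> cL2 l g.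
Proof. by move=> h [h1 h2]; split; [apply: eq_rL2 h1|apply: eq_rL2 h2] => x /h ->. Qed.

Lemma cL2_lin l a b f g : cL2 l f -> cL2 l g -> cL2 l (fun x => a * f x + b * g x).
Proof.
move=> [f1 f2] [g1 g2]; split.
- apply: (@eq_rL2 _ (fun x => 1 * (Re a * Re (f x) + - Im a * Im (f x)) + 1 * (Re b * Re (g x) + - Im b * Im (g x)))).
    by move=> x _; rewrite !cE; ring.
  by apply: rL2_lin; exact: rL2_lin.
- apply: (@eq_rL2 _ (fun x => 1 * (Re a * Im (f x) + Im a * Re (f x)) + 1 * (Re b * Im (g x) + Im b * Re (g x)))).
    by move=> x _; rewrite !cE; ring.
  by apply: rL2_lin; exact: rL2_lin.
Qed.

Lemma cL2_conj l f : cL2 l f -> cL2 l (fun x => conjc (f x)).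
Proof.
move=> [f1 f2]; split.
- by apply: eq_rL2 f1 => x _; rewrite cE.
- apply: (@eq_rL2 _ (fun x => -1 * Im (f x) + 0 * Im (f x))); last exact: rL2_lin.
  by move=> x _; rewrite cE; ring.
Qed.

Lemma cL2_mul l f g : cL2 l f -> cL2 l g -> cintg l (fun x => f x * g x).
Proof.
move=> [f1 f2] [g1 g2]; split.
- apply: (@eq_intg _ _ (fun x => Re (f x) * Re (g x) - Im (f x) * Im (g x))).
    by move=> x _; rewrite !cE.
  by apply: intgB; exact: rL2_mul.
- apply: (@eq_intg _ _ (fun x => Re (f x) * Im (g x) + Im (f x) * Re (g x))).
    by move=> x _; rewrite !cE.
  by apply: intgD; exact: rL2_mul.
Qed.

Lemma cL2_cintg l f : cL2 l f -> cintg l f.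
Proof. by move=> [h1 h2]; split; exact: rL2_intg. Qed.

Lemma cL2S x l f : x <= l -> cL2 l f -> cL2 x f.
Proof. by move=> xl [h1 h2]; split; apply: rL2S; eassumption. Qed.

Lemma cL2_normc2 l f : cL2 l f -> intg l (fun x => normc (f x) ^+ 2).
Proof.
move=> [[_ h1] [_ h2]]; apply: (eq_intg _ (intgD h1 h2)) => x _; by rewrite normc2.
Qed.

Lemma nrm_ge0 l f : 0 <= nrm l f.
Proof. by apply: Rintegral_ge0 => x _; exact: sqr_ge0. Qed.

Lemma cL2P l f : cL2 l f <-> cmeasurable `[0, l] f /\ (sqint `[0%R, l] f < +oo)%E.
Proof.
split.
- move=> h; split; first by case: h => [[? _] [? _]].
  have i := cL2_normc2 h; exact: (integrable_lty _ i).
- move=> [[m1 m2] h].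
  have mn : measurable_fun `[0, l] (fun x => normc (f x) ^+ 2).
    apply: (eq_measurable_fun (fun x => Re (f x) ^+ 2 + Im (f x) ^+ 2)).
      by move=> x _; rewrite normc2.
    by apply: measurable_funD; exact: measurable_funX.
  have i : intg l (fun x => normc (f x) ^+ 2).
    apply/integrableP; split; first exact/measurable_EFinP.
    apply: le_lt_trans h; rewrite /sqint; apply: ge0_le_integral => //=.
    + by apply/measurable_EFinP; apply: measurableT_comp.
    + by apply/measurable_EFinP.
    + by move=> x _; rewrite lee_fin ger0_norm ?sqr_ge0.
  split; split => //; apply: intg_le i => //; try exact: measurable_funX.
  + by move=> x _; rewrite normc2 ger0_norm ?sqr_ge0 // lerDl sqr_ge0.
  + by move=> x _; rewrite normc2 ger0_norm ?sqr_ge0 // lerDr sqr_ge0.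
Qed.

Lemma sqintE l f : cL2 l f -> sqint `[0%R, l] f = (nrm l f)%:E.
Proof. by move=> /cL2_normc2 h; rewrite /sqint /nrm EFin_Rint. Qed.

Lemma ip_lin l a b f g h : cL2 l f -> cL2 l g -> cL2 l h ->
  ip l (fun x => a * f x + b * g x) h = a * ip l f h + b * ip l g h.
Proof.
move=> hf hg hh; have hj := cL2_conj hh.
rewrite /ip -!cintZ -?cintD; try exact: cL2_mul; try by apply: cintgZ; exact: cL2_mul.
by apply: eq_cint => x _; ring.
Qed.

Lemma ipC l f g : cL2 l f -> cL2 l g -> ip l g f = conjc (ip l f g).
Proof.
move=> hf hg; rewrite /ip -cintJ; last by apply: cL2_mul => //; exact: cL2_conj.
by apply: eq_cint => x _; rewrite conjcM conjccK mulrC.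
Qed.

Lemma ipff l f : cL2 l f -> ip l f f = (nrm l f)%:C.
Proof.
move=> hf; apply: complexP; rewrite /= /nrm.
- by apply: eq_Rint => x _; rewrite mul_conjc.
- rewrite (@eq_Rint _ _ _ (fun x => 0 * Re (f x))); last by move=> x _; rewrite mul_conjc mul0r.
  by rewrite RintZ ?mul0r //; apply: rL2_intg; case: hf.
Qed.

Lemma nrm_lin l a b f g : cL2 l f -> cL2 l g ->
  nrm l (fun x => a * f x + b * g x) <= 2 * normc a ^+ 2 * nrm l f + 2 * normc b ^+ 2 * nrm l g.
Proof.
move=> hf hg.
have n1 := cL2_normc2 hf; have n2 := cL2_normc2 hg.
rewrite /nrm -!RintZ // -RintD; try exact: intgZ.
apply: le_Rintegral => //; first exact: (cL2_normc2 (cL2_lin a b hf hg)).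
  by apply: intgD; exact: intgZ.
move=> x _; apply: (@le_trans _ _ (2 * normc (a * f x) ^+ 2 + 2 * normc (b * g x) ^+ 2)).
  exact: normcD2.
by rewrite !normcM2 !mulrA.
Qed.

Lemma nrmZ l a f : cL2 l f -> nrm l (fun x => a * f x) = normc a ^+ 2 * nrm l f.
Proof.
move=> hf; rewrite /nrm -RintZ; last exact: cL2_normc2.
by apply: eq_Rint => x _; rewrite normcM2.
Qed.

Lemma eq_nrm l f g : (forall x, 0 <= x <= l -> f x = g x) -> nrm l f = nrm l g.
Proof. by move=> h; apply: eq_Rint => x /h ->. Qed.

(** Young's inequality with a free weight takes the place of the Cauchy-Schwarz inequality: its
    right-hand side is linear in the two squared norms and can be summed over edges and layers. *)
Lemma ip_young l f g t : 0 < t -> cL2 l f -> cL2 l g ->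
  `|Re (ip l f g)| <= (t * nrm l f + t^-1 * nrm l g) / 2.
Proof.
move=> t0 hf hg.
have n1 := cL2_normc2 hf; have n2 := cL2_normc2 hg.
have [i1 _] := cL2_mul hf (cL2_conj hg).
apply: (le_trans (le_normr_Rintegral _ i1)) => //.
rewrite /nrm -!RintZ // -RintD; try exact: intgZ.
rewrite mulrC -RintZ; last by apply: intgD; exact: intgZ.
apply: le_Rintegral => //; first exact: integrable_norm.
  by apply: intgZ; apply: intgD; exact: intgZ.
move=> x _; rewrite !normc2 !cE.
move: (Re _) (Im _) (Re _) (Im _) => p q r s.
have ti : t * t^-1 = 1 by rewrite divff // gt_eqF.
have ti0 : 0 < t^-1 by rewrite invr_gt0.
have e (u v : R) : `|u * v| <= 2^-1 * (t * u ^+ 2 + t^-1 * v ^+ 2).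
  have E (w : R) : t^-1 * (t * u + w) ^+ 2 = t * u ^+ 2 + 2 * (u * w) + t^-1 * w ^+ 2.
    by field; rewrite gt_eqF.
  have P (w : R) : 0 <= t^-1 * (t * u + w) ^+ 2 by rewrite mulr_ge0 ?sqr_ge0 // ltW.
  rewrite ler_norml; apply/andP; split.
  - by have := P v; rewrite E; lra.
  - by have := P (- v); rewrite E sqrrN mulrN; lra.
rewrite mulrN opprK; apply: (le_trans (ler_normD _ _)).
have := e r p; have := e s q; lra.
Qed.

Lemma nrm_eq0 l f : cL2 l f -> nrm l f = 0 -> {ae mu, forall x, 0 <= x <= l -> f x = 0}.
Proof.
move=> hf h0; have hn := cL2_normc2 hf.
have : {ae mu, forall x, 0 <= x <= l -> normc (f x) ^+ 2 = 0}.
  by apply: ae0_Rintegral => //; [exact: intg_meas|move=> x _; exact: sqr_ge0].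
apply: filterS; first exact: (ae_filter_ringOfSetsType mu).
by move=> x h /h /normc2_eq0.
Qed.

Lemma nrm_ae0 l f : cL2 l f -> {ae mu, forall x, 0 <= x <= l -> f x = 0} -> nrm l f = 0.
Proof.
move=> hf h; apply: Rintegral_ae0; first by apply: intg_meas; exact: cL2_normc2.
move: h; apply: filterS; first exact: (ae_filter_ringOfSetsType mu).
by move=> x h /h ->; rewrite normc2 /=; ring.
Qed.

Lemma nrm_le_bounded l f M : 0 <= l -> cL2 l f -> (forall x, 0 <= x <= l -> normc (f x) ^+ 2 <= M) ->
  nrm l f <= M * l.
Proof.
move=> l0 hf hM; have -> : M * l = \int[mu]_(x in `[0, l]) M.
  rewrite Rintegral_cst // [X in fine X]lebesgue_measure_itv /= lte_fin.
  by case: ltP => h; rewrite /= ?subr0 // (_ : l = 0) ?mulr0 //; apply/eqP; rewrite eq_le h.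
have i1 := cL2_normc2 hf; have i2 : intg l (fun=> M) := intg_cst l M.
by apply: (le_Rintegral _ i1 i2) => // x; rewrite /= in_itv /=; exact: hM.
Qed.

Lemma W1P l f f1 : W1 l f f1 <-> rW1 l (fun x => Re (f x)) (fun x => Re (f1 x)) /\
  rW1 l (fun x => Im (f x)) (fun x => Im (f1 x)).
Proof.
split.
- move=> [m q h]; have [h1 h2] : cL2 l f1 by apply/cL2P.
  by split; split => // x /h ->; rewrite cE.
- move=> [[h1 e1] [h2 e2]]; have /cL2P [m q] : cL2 l f1 by [].
  split => // x hx; apply: complexP; rewrite cE /=; [exact: e1|exact: e2].
Qed.

Lemma W1_cL2 l f f1 : 0 <= l -> W1 l f f1 -> cL2 l f.
Proof. by move=> l0 /W1P[h1 h2]; split; apply: rW1_rL2; eassumption. Qed.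

Lemma W1_cL2' l f f1 : W1 l f f1 -> cL2 l f1.
Proof. by move=> /W1P[[h1 _] [h2 _]]. Qed.

Lemma eq_rW1 l (f f1 g g1 : R -> R) : 0 <= l -> (forall x, 0 <= x <= l -> f x = g x) ->
  (forall x, 0 <= x <= l -> f1 x = g1 x) -> rW1 l f f1 -> rW1 l g g1.
Proof.
move=> l0 h h1 [k1 k2]; split; first exact: eq_rL2 k1.
have h0 : 0 <= (0 : R) <= l by rewrite lexx.
move=> x hx; rewrite -(h x hx) -(h 0 h0) (k2 x hx); congr (_ + _).
apply: eq_Rint => y /andP[y0 yx]; apply: h1; rewrite y0; case/andP: hx => _; exact: le_trans.
Qed.

Lemma eq_W1 l f f1 g g1 : 0 <= l -> (forall x, 0 <= x <= l -> f x = g x) ->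
  (forall x, 0 <= x <= l -> f1 x = g1 x) -> W1 l f f1 -> W1 l g g1.
Proof.
move=> l0 h h1 /W1P[k1 k2]; apply/W1P; split.
- by apply: eq_rW1 k1 => // x hx; rewrite ?h ?h1.
- by apply: eq_rW1 k2 => // x hx; rewrite ?h ?h1.
Qed.

Lemma W1_lin l a b f g f1 g1 : 0 <= l -> W1 l f f1 -> W1 l g g1 ->
  W1 l (fun x => a * f x + b * g x) (fun x => a * f1 x + b * g1 x).
Proof.
move=> l0 /W1P[f2 f3] /W1P[g2 g3]; apply/W1P; split.
- apply: (@eq_rW1 _ (fun x => 1 * (Re a * Re (f x) + - Im a * Im (f x)) + 1 * (Re b * Re (g x) + - Im b * Im (g x)))
   (fun x => 1 * (Re a * Re (f1 x) + - Im a * Im (f1 x)) + 1 * (Re b * Re (g1 x) + - Im b * Im (g1 x)))) => //.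
  + by move=> x _; rewrite !cE; ring.
  + by move=> x _; rewrite !cE; ring.
  + by apply: rW1_lin; exact: rW1_lin.
- apply: (@eq_rW1 _ (fun x => 1 * (Re a * Im (f x) + Im a * Re (f x)) + 1 * (Re b * Im (g x) + Im b * Re (g x)))
   (fun x => 1 * (Re a * Im (f1 x) + Im a * Re (f1 x)) + 1 * (Re b * Im (g1 x) + Im b * Re (g1 x)))) => //.
  + by move=> x _; rewrite !cE; ring.
  + by move=> x _; rewrite !cE; ring.
  + by apply: rW1_lin; exact: rW1_lin.
Qed.

Lemma W1_conj l f f1 : 0 <= l -> W1 l f f1 -> W1 l (fun x => conjc (f x)) (fun x => conjc (f1 x)).
Proof.
move=> l0 /W1P[h1 h2]; apply/W1P; split.
- by apply: eq_rW1 h1 => // x _; rewrite cE.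
- apply: (@eq_rW1 _ (fun x => -1 * Im (f x) + 0 * Im (f x)) (fun x => -1 * Im (f1 x) + 0 * Im (f1 x))) => //.
  + by move=> x _; rewrite cE; ring.
  + by move=> x _; rewrite cE; ring.
  + exact: rW1_lin.
Qed.

Lemma W2_lin l a b f g f1 g1 f2 g2 : 0 <= l -> W2 l f f1 f2 -> W2 l g g1 g2 ->
  W2 l (fun x => a * f x + b * g x) (fun x => a * f1 x + b * g1 x) (fun x => a * f2 x + b * g2 x).
Proof. by move=> l0 [? ?] [? ?]; split; exact: W1_lin. Qed.

Lemma W2_conj l f f1 f2 : 0 <= l -> W2 l f f1 f2 ->
  W2 l (fun x => conjc (f x)) (fun x => conjc (f1 x)) (fun x => conjc (f2 x)).
Proof. by move=> l0 [? ?]; split; exact: W1_conj. Qed.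

Lemma eq_W2 l f f1 f2 g g1 g2 : 0 <= l -> (forall x, 0 <= x <= l -> f x = g x) ->
  (forall x, 0 <= x <= l -> f1 x = g1 x) -> (forall x, 0 <= x <= l -> f2 x = g2 x) ->
  W2 l f f1 f2 -> W2 l g g1 g2.
Proof.
by move=> l0 h h1 h2 [k1 k2]; split; [apply: eq_W1 k1|apply: eq_W1 k2].
Qed.

Lemma cint_parts l f g f1 g1 : 0 <= l -> W1 l f f1 -> W1 l g g1 ->
  cint `[0, l] (fun x => f1 x * g x + f x * g1 x) = f l * g l - f 0 * g 0.
Proof.
move=> l0 /W1P[f2 f3] /W1P[g2 g3].
have i (p p1 q q1 : R -> R) : rW1 l p p1 -> rW1 l q q1 -> intg l (fun x => p1 x * q x + p x * q1 x).
  move=> hp hq; apply: intgD.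
    by apply: rL2_mul; [case: hp|exact: rW1_rL2 hq].
  by apply: rL2_mul; [exact: rW1_rL2 hp|case: hq].
apply: complexP; rewrite !cE /=.
- rewrite (@eq_Rint _ _ _ (fun x => (Re (f1 x) * Re (g x) + Re (f x) * Re (g1 x)) -
     (Im (f1 x) * Im (g x) + Im (f x) * Im (g1 x)))); last by move=> x _; rewrite !cE; ring.
  rewrite RintB; [|exact: i|exact: i].
  rewrite (int_parts l0 f2 g2) (int_parts l0 f3 g3); ring.
- rewrite (@eq_Rint _ _ _ (fun x => (Re (f1 x) * Im (g x) + Re (f x) * Im (g1 x)) +
     (Im (f1 x) * Re (g x) + Im (f x) * Re (g1 x)))); last by move=> x _; rewrite !cE; ring.
  rewrite RintD; [|exact: i|exact: i].
  rewrite (int_parts l0 f2 g3) (int_parts l0 f3 g2); ring.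
Qed.

Lemma green l f f1 f2 g g1 g2 : 0 <= l -> W2 l f f1 f2 -> W2 l g g1 g2 ->
  cint `[0, l] (fun x => f2 x * g x) - cint `[0, l] (fun x => f x * g2 x) =
  (f1 l * g l - f l * g1 l) - (f1 0 * g 0 - f 0 * g1 0).
Proof.
move=> l0 [hf hf1] [hg hg1].
have cf := W1_cL2 l0 hf; have cf1 := W1_cL2 l0 hf1; have cf2 := W1_cL2' hf1.
have cg := W1_cL2 l0 hg; have cg1 := W1_cL2 l0 hg1; have cg2 := W1_cL2' hg1.
have A := cint_parts l0 hf1 hg; have B := cint_parts l0 hf hg1.
rewrite cintD in A; [|exact: cL2_mul|exact: cL2_mul].
rewrite cintD in B; [|exact: cL2_mul|exact: cL2_mul].
transitivity (f1 l * g l - f1 0 * g 0 - (f l * g1 l - f 0 * g1 0)); last by ring.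
rewrite -A -B; ring.
Qed.

Lemma green_ip l f f1 f2 g g1 g2 : 0 <= l -> W2 l f f1 f2 -> W2 l g g1 g2 ->
  ip l f2 g - ip l f g2 =
  (f1 l * conjc (g l) - f l * conjc (g1 l)) - (f1 0 * conjc (g 0) - f 0 * conjc (g1 0)).
Proof. by move=> l0 hf hg; rewrite -(green l0 hf (W2_conj l0 hg)). Qed.

Lemma W1_C1 l f f1 : 0 <= l ->
  (forall x, is_derive x 1 (fun x => Re (f x)) (Re (f1 x))) ->
  (forall x, is_derive x 1 (fun x => Im (f x)) (Im (f1 x))) ->
  continuous (fun x => Re (f1 x)) -> continuous (fun x => Im (f1 x)) -> W1 l f f1.
Proof.
move=> l0 d1 d2 c1 c2; apply/W1P; split; apply: rW1_C1 => // x _; [exact: c1|exact: c2].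
Qed.

Lemma W1_ae_eq0 l f f1 : 0 < l -> W1 l f f1 ->
  {ae mu, forall x, 0 <= x <= l -> f x = 0} -> forall x, 0 <= x <= l -> f x = 0.
Proof.
move=> l0 /W1P[h1 h2] h x hx; apply: complexP.
- apply: (cont_ae0 l0 (rW1_cont (ltW l0) h1)) => //.
  move: h; apply: filterS; first exact: (ae_filter_ringOfSetsType mu).
  by move=> y h /h ->.
- apply: (cont_ae0 l0 (rW1_cont (ltW l0) h2)) => //.
  move: h; apply: filterS; first exact: (ae_filter_ringOfSetsType mu).
  by move=> y h /h ->.
Qed.

(** Integrating the derivative of f conj f1 gives the squared norm of f1, since every term
    containing f drops out. So f1 is zero almost everywhere and, being continuous, everywhere. *)
Lemma W2_eq0 l f f1 f2 : 0 < l -> W2 l f f1 f2 ->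
  (forall x, 0 <= x <= l -> f x = 0) -> forall x, 0 <= x <= l -> f1 x = 0.
Proof.
move=> l0 [h h1] f0; have le0 := ltW l0.
have ex : 0 <= (0 : R) <= l by rewrite lexx.
have el : 0 <= l <= l by rewrite le0 lexx.
apply: (W1_ae_eq0 l0 h1); apply: nrm_eq0; first exact: W1_cL2' h.
have := cint_parts le0 h (W1_conj le0 h1).
rewrite (f0 l el) (f0 0 ex) !mul0r subr0 (@eq_cint _ _ (fun x => f1 x * conjc (f1 x))); last first.
  by move=> x hx; rewrite (f0 x hx) mul0r addr0.
by rewrite -/(ip l f1 f1) ipff; [move=> [] | exact: W1_cL2' h].
Qed.

Lemma W1_eq_fst l f f1 x : W1 l f f1 -> 0 <= x <= l -> f x = f 0 + cint `[0, x] f1.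
Proof. by move=> [_ _]; exact. Qed.

Lemma prim_W1 l c f1 : cL2 l f1 -> W1 l (fun x => c + cint `[0, x] f1) f1.
Proof.
move=> /cL2P[m q]; split => // x hx; congr (_ + _).
by rewrite set_itv1 /cint !Rintegral_set1 addr0.
Qed.

End ComplexInterval.

(** * Density of H^2 functions with zero data at both ends *)

Section Density.
Context {R : realType}.
Notation mu := (@lebesgue_measure R).
Implicit Types (f g h : R -> R) (l x t M eps : R).

(** Convergence is required in the open interval only: the truncations it serves vanish near both
    ends, whatever f does there. *)
Lemma L2_dct l (h_ : nat -> R -> R) h H : (forall n, measurable_fun `[0, l] (h_ n)) ->
  measurable_fun `[0, l] h -> (forall x, 0 < x < l -> h_ n x @[n --> \oo] --> h x) ->
  (forall n x, 0 <= x <= l -> `|h_ n x| <= H x) -> (forall x, 0 <= x <= l -> `|h x| <= H x) ->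
  rL2 l H -> forall eps, 0 < eps ->
  exists n, \int[mu]_(x in `[0, l]) ((h_ n x - h x) ^+ 2) < eps.
Proof.
move=> mh_ mh cv dom dom' [mH iH] eps eps0.
have mD : forall n, measurable_fun `[0, l] (fun x => (h_ n x - h x) ^+ 2).
  by move=> n; apply: measurable_funX; exact: measurable_funB.
have ig : intg l (fun x => 4 * H x ^+ 2) by exact: intgZ.
have bd n x : 0 <= x <= l -> (h_ n x - h x) ^+ 2 <= 4 * H x ^+ 2.
  move=> hx; have := dom n x hx; have := dom' x hx; rewrite !ler_norml => /andP[a b] /andP[c d].
  nra.
have [||||_ _ C] := @dominated_convergence _ _ R mu `[0, l]%classic (measurable_itv _)
   (fun n x => ((h_ n x - h x) ^+ 2)%:E) (cst 0%E) (fun x => (4 * H x ^+ 2)%:E) _ _ _ ig _.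
- by move=> n; apply/measurable_EFinP; exact: mD.
- exact: measurable_cst.
- exists ([set 0] `|` [set l]); split.
  + by apply: measurableU; exact: measurable_set1.
  + by rewrite measureU0 //; try exact: lebesgue_measure_set1; exact: measurable_set1.
  + move=> x /= /not_implyP[]; rewrite in_itv /= => /andP[x0 xl] nc.
    apply: contrapT => /not_orP[n1 n2]; apply: nc.
    apply: cvg_EFin; first by apply: nearW.
    rewrite (_ : 0 = (h x - h x) * (h x - h x)); last by rewrite subrr mul0r.
    have c : h_ n x - h x @[n --> \oo] --> h x - h x.
      apply: cvgB; last exact: cvg_cst.
      apply: cv; rewrite !lt_neqAle x0 xl !andbT; apply/andP; split; apply/eqP => e; [apply: n1|apply: n2] => //.
    exact: cvgM.
- apply: nearW => x n; rewrite /= in_itv /= => hx.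
  by rewrite lee_fin ger0_norm ?sqr_ge0 // bd.
rewrite integral0 /= in C.
have C' := fine_cvg C.
have {}C : \int[mu]_(x in `[0, l]) ((h_ n x - h x) ^+ 2) @[n --> \oo] --> 0 by exact: C'.
move/cvgrPdist_lt : C => /(_ eps eps0) [N _ hN]; exists N.
have := hN N (leqnn N); rewrite /= sub0r normrN ger0_norm //.
by apply: Rintegral_ge0 => x _; exact: sqr_ge0.
Qed.

Lemma trunc_meas l f (k : nat) : measurable_fun `[0, l] f -> measurable_fun `[0, l]
  (fun x => f x * ((`|f x| <= k%:R) && (k.+1%:R^-1 <= x <= l - k.+1%:R^-1))%:R : R).
Proof.
move=> mf; apply: measurable_funM => //.
have E (b : bool) : b%:R = (if b then 1 else 0) :> R by case: b.
rewrite (_ : (fun x => _) = (fun x => if (`|f x| <= k%:R) && ((k.+1%:R^-1 <= x) && (x <= l - k.+1%:R^-1)) then 1 else 0)); last by apply/funext => x; rewrite E.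
apply: measurable_fun_if => //.
apply: measurable_and; first by apply: measurable_fun_ler => //; exact: measurableT_comp.
by apply: measurable_and; apply: measurable_fun_ler.
Qed.

Lemma trunc_approx l f : rL2 l f -> forall eps, 0 < eps -> exists k : nat,
  \int[mu]_(x in `[0, l]) ((f x * ((`|f x| <= k%:R) && (k.+1%:R^-1 <= x <= l - k.+1%:R^-1))%:R - f x) ^+ 2) < eps.
Proof.
move=> hf eps eps0; have [mf _] := hf.
apply: (@L2_dct l (fun k x => f x * ((`|f x| <= k%:R) && (k.+1%:R^-1 <= x <= l - k.+1%:R^-1))%:R) f (fun x => `|f x|)) => //.
- by move=> k; exact: trunc_meas.
- move=> x /andP[x0 xl].
  have d0 : 0 < Num.min x (l - x) by rewrite lt_min x0 subr_gt0.
  apply: cvg_near_cst.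
  near=> k.
  have -> : (`|f x| <= k%:R).
    near: k; exact: nbhs_infty_ger.
  have : k.+1%:R^-1 < Num.min x (l - x).
    near: k; exact: near_infty_natSinv_lt (PosNum d0).
  rewrite lt_min => /andP[h1 h2]; rewrite /= (ltW h1) /= lerBrDr -lerBrDl (ltW h2) /=; exact: mulr1.
- move=> k x hx; rewrite normrM; apply: ler_piMr => //; case: (_ && _) => /=; rewrite ?normr1 ?normr0 //.
- split; first exact: measurableT_comp.
  by case: hf => _; apply: eq_intg => x _; rewrite real_normK ?num_real.
Unshelve. all: by end_near. Qed.

(** Clipping an L^1 approximant to [-M, M] does not increase its distance to f, and between
    functions bounded by M the squared difference is at most 2M times the modulus of the
    difference. *)
Lemma continuous_approx l f M : 0 < l -> measurable_fun `[0, l] f -> 0 <= M ->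
  (forall x, 0 <= x <= l -> `|f x| <= M) -> forall eps, 0 < eps ->
  exists g, [/\ continuous g, forall x, `|g x| <= M & \int[mu]_(x in `[0, l]) ((g x - f x) ^+ 2) < eps].
Proof.
move=> l0 mf M0 hM eps eps0.
have if1 : intg l f by apply: rL2_intg; exact: rL2_bounded hM.
have mufin : (mu `[0%R, l]%classic < +oo)%E by rewrite /= lebesgue_measure_itv /= lte_fin l0 ltry.
have [g_ [cg ig C]] := approximation_continuous_integrable (measurable_itv _) mufin if1.
have C' : \int[mu]_(z in `[0, l]) `|f z - g_ n z| @[n --> \oo] --> 0 by exact: (fine_cvg C).
(* The added 1 keeps the denominator positive when M = 0. *)
have e0 : 0 < eps / (2 * M + 1) by apply: divr_gt0 => //; lra.
move/cvgrPdist_lt : C' => /(_ _ e0) [N _ /(_ N (leqnn N))] /=; rewrite sub0r normrN => hN.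
have ifg : intg l (fun x => `|f x - g_ N x|).
  by apply: integrable_norm; apply: intgB => //; exact: ig.
have {}hN : \int[mu]_(x in `[0, l]) `|f x - g_ N x| < eps / (2 * M + 1).
  move: hN; rewrite ger0_norm //.
  by apply: Rintegral_ge0.
pose g x := Num.max (- M) (Num.min M (g_ N x)).
have gM x : `|g x| <= M.
  by rewrite ler_norml /g le_max lexx /= ge_max ge_min lexx /= andbT; lra.
have cg' : continuous g.
  move=> x; apply: (@continuous_max _ _ (cst (- M)) (fun x => Num.min M (g_ N x))); first exact: cst_continuous.
  by apply: (@continuous_min _ _ (cst M) (g_ N)); [exact: cst_continuous|exact: cg].
exists g; split => //.
have mg : measurable_fun `[0, l] g.
  by apply: subspace_continuous_measurable_fun => //; exact: continuous_subspaceT.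
have h1 : rL2 l (fun x => 1 * g x + (-1) * f x).
  by apply: rL2_lin; [exact: (@rL2_bounded _ _ _ M)|exact: rL2_bounded hM].
apply: (@le_lt_trans _ _ (\int[mu]_(x in `[0, l]) ((2 * M) * `|f x - g_ N x|))).
  apply: le_Rintegral => //.
  + by case: h1 => _; apply: eq_intg => x _; rewrite mul1r mulN1r.
  + exact: intgZ.
  + move=> x; rewrite /= in_itv /= => /hM fx; have gx := gM x.
    have k1 : `|g x - f x| <= `|f x - g_ N x|.
      move: fx; rewrite ler_norml => /andP[f1 f2]; rewrite /g.
      rewrite [leRHS]distrC; have [p|p] := leP M (g_ N x).
        rewrite max_r; last lra. rewrite !ger0_norm; lra.
      have [q|q] := leP (- M) (g_ N x) => //.
      rewrite !ler0_norm; lra.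
    rewrite -real_normK ?num_real // expr2; apply: ler_pM => //.
    by apply: (le_trans (ler_normB _ _)); lra.
rewrite RintZ //; move: hN; rewrite ltr_pdivlMr; last lra.
have : 0 <= \int[mu]_(x in `[0, l]) `|f x - g_ N x| by apply: Rintegral_ge0.
nra.
Qed.

Lemma primitive_derive (a : R) f x : (forall u, mu.-integrable `[a, u] (EFin \o f)) -> a < x ->
  {for x, continuous f} -> is_derive x 1 (fun y => \int[mu]_(t in `[a, y]) f t) (f x).
Proof.
move=> hf ax cx.
have [d e] := continuous_FTC1_closed (ltr_pwDr ltr01 (lexx x)) (hf (x + 1)) ax cx.
by apply: DeriveDef; [exact: d|rewrite -derive1E; exact: e].
Qed.

Lemma is_derive_shift f x (d r : R) : is_derive (x + r) 1 f d -> is_derive x 1 (fun y => f (y + r)) d.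
Proof.
move=> h; have h2 : is_derive x 1 (fun y : R => y + r) 1.
  by apply: is_derive_eq; rewrite addr0.
have := @is_derive1_comp _ f (fun y => y + r) x d 1 h h2.
by rewrite mulr1.
Qed.

(** [F r] is the second difference with step r of a twofold primitive of f, divided by r^2: an
    average of f over [x, x + 2r] against a hat function. It is twice differentiable, takes only
    values of f on this window by two applications of the mean value theorem, and has zero slope
    where f vanishes on the window. *)
Lemma steklov f M : continuous f -> (forall x, `|f x| <= M) ->
  exists F F1 : R -> R -> R, forall r : R, 0 < r -> [/\
    forall x, 0 <= x -> is_derive x 1 (F r) (F1 r x),
    forall x, 0 <= x -> is_derive x 1 (F1 r) ((f (x + r + r) - 2 * f (x + r) + f x) / r ^+ 2),
    forall x, 0 <= x -> exists2 y, x <= y <= x + 2 * r & F r x = f y &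
    forall x, 0 <= x -> (forall y, x <= y <= x + 2 * r -> f y = 0) -> F1 r x = 0].
Proof.
move=> cf fM.
have i0 (a b : R) h : {within `[a, b], continuous h} -> mu.-integrable `[a, b] (EFin \o h).
  by move=> c; apply: continuous_compact_integrable => //; exact: segment_compact.
(* The primitives start at -2 and -1, left of the interval, so that the derivative formulas hold at
   x = 0 too; [G2] starts later because [G] is continuous only to the right of -2. *)
pose G x := \int[mu]_(t in `[-2, x]) f t.
have dG x : -2 < x -> is_derive x 1 G (f x).
  move=> hx; apply: primitive_derive => //; last exact: cf.
  by move=> u; apply: i0; exact: continuous_subspaceT.
have cG x : -2 < x -> {for x, continuous G}.
  move=> /dG h; apply: differentiable_continuous; apply/derivable1_diffP; exact: ex_derive.
pose G2 x := \int[mu]_(t in `[-1, x]) G t.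
have dG2 x : -1 < x -> is_derive x 1 G2 (G x).
  move=> hx; apply: primitive_derive => //; last by apply: cG; lra.
  move=> u; apply: i0; apply: continuous_in_subspaceT => y; rewrite inE /= in_itv /= => /andP[h _].
  by apply: cG; lra.
exists (fun r x => (G2 (x + r + r) - 2 * G2 (x + r) + G2 x) / r ^+ 2).
exists (fun r x => (G (x + r + r) - 2 * G (x + r) + G x) / r ^+ 2).
move=> r r0.
have D (P P1 : R -> R) x : (forall y, x <= y -> is_derive y 1 P (P1 y)) ->
   is_derive x 1 (fun x => (P (x + r + r) - 2 * P (x + r) + P x) / r ^+ 2)
     ((P1 (x + r + r) - 2 * P1 (x + r) + P1 x) / r ^+ 2).
  move=> h.
  have d1 : is_derive x 1 (fun x => P (x + r + r)) (P1 (x + r + r)).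
    by apply: (@is_derive_shift (fun y => P (y + r))); apply: is_derive_shift; apply: h; lra.
  have d2 : is_derive x 1 (fun x => P (x + r)) (P1 (x + r)).
    by apply: is_derive_shift; apply: h; lra.
  have d3 : is_derive x 1 P (P1 x) by apply: h.
  by apply: is_derive_eq; rewrite /GRing.scale /=; ring.
have mvt (P P1 : R -> R) (a b : R) : a < b -> (forall y, a <= y -> is_derive y 1 P (P1 y)) ->
   exists2 c, a <= c <= b & P b - P a = P1 c * (b - a).
  move=> ab h; have [||c hc e] := @MVT _ P P1 a b ab.
  + by move=> y; rewrite in_itv /= => /andP[h1 _]; apply: h; exact: ltW.
  + apply: derivable_within_continuous => y; rewrite in_itv /= => /andP[h1 _].
    by have := h y h1 => -[].
  + by exists c => //; move: hc; rewrite in_itv /= => /andP[h1 h2]; rewrite !ltW.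
split.
- by move=> x x0; apply: D => y xy; apply: dG2; lra.
- by move=> x x0; apply: D => y xy; apply: dG; lra.
- move=> x x0.
  have [||c c1 e1] := @mvt (fun x => G2 (x + r) - G2 x) (fun x => G (x + r) - G x) x (x + r); first lra.
    move=> y xy; have d1 : is_derive y 1 (fun x => G2 (x + r)) (G (y + r)).
      by apply: is_derive_shift; apply: dG2; lra.
    have d2 : is_derive y 1 G2 (G y) by apply: dG2; lra.
    exact: is_deriveB.
  have [||c' c1' e1'] := @mvt G f c (c + r); first lra.
    by move=> y xy; apply: dG; lra.
  exists c'; first lra.
  have ex (z : R) : z + r - z = r by ring.
  rewrite e1' !ex in e1.
  have -> : G2 (x + r + r) - 2 * G2 (x + r) + G2 x = G2 (x + r + r) - G2 (x + r) - (G2 (x + r) - G2 x) by ring.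
  by rewrite e1; field; rewrite gt_eqF.
- move=> x x0 fz.
  have z a b : x <= a -> a < b -> b <= x + 2 * r -> G b - G a = 0.
    move=> h1 h2 h3; have [|c c1 ->] := @mvt G f a b h2.
      by move=> y xy; apply: dG; lra.
    by rewrite fz ?mul0r //; lra.
  have -> : G (x + r + r) - 2 * G (x + r) + G x = G (x + r + r) - G (x + r) - (G (x + r) - G x) by ring.
  by rewrite !z ?subrr ?mul0r //; lra.
Qed.
(** The function is truncated, approximated by a continuous one, damped near the ends and finally
    averaged; the damping is what produces zero data at 0 and l. *)
Lemma density_real l f : 0 < l -> rL2 l f -> forall eps, 0 < eps ->
  exists p p1 p2, [/\ rW1 l p p1, rW1 l p1 p2, [/\ p 0 = 0, p l = 0, p1 0 = 0 & p1 l = 0] &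
    \int[mu]_(x in `[0, l]) ((p x - f x) ^+ 2) < eps].
Proof.
move=> l0 hf eps eps0; have le0 := ltW l0.
(* There are three errors, and (a + b + c)^2 <= 3 (a^2 + b^2 + c^2). *)
have e9 : 0 < eps / 9 by lra.
have [k hk] := trunc_approx hf e9.
pose fk x := f x * ((`|f x| <= k%:R) && (k.+1%:R^-1 <= x <= l - k.+1%:R^-1))%:R.
have {}hk : \int[mu]_(x in `[0, l]) ((fk x - f x) ^+ 2) < eps / 9 by exact: hk.
have [mf _] := hf.
pose d : R := k.+1%:R^-1.
have d0 : 0 < d by rewrite invr_gt0.
have fkM x : `|fk x| <= k%:R.
  rewrite /fk normrM; have [h|h] := boolP (`|f x| <= k%:R); last by rewrite normr0 mulr0.
  case: (_ <= _ <= _); rewrite /= ?normr1 ?normr0 ?mulr1 ?mulr0 //.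
have mfk : measurable_fun `[0, l] fk by exact: trunc_meas.
have [g [cg gM hg]] := continuous_approx l0 mfk (ler0n _ k) (fun x _ => fkM x) e9.
(* [rho] is 1 on [d, l - d], outside which [fk] vanishes, and 0 within d / 2 of the ends. So damping
   does not increase the error, and [G] vanishes near both ends. *)
pose rho x := Num.max 0 (Num.min 1 (2 / d * Num.min x (l - x) - 1)).
have rho01 x : 0 <= rho x <= 1.
  by rewrite /rho le_max lexx /= ge_max ler01 ge_min lexx.
have crho : continuous rho.
  move=> x; apply: (@continuous_max _ _ (cst 0) (fun x => Num.min 1 (2 / d * Num.min x (l - x) - 1))); first exact: cst_continuous.
  apply: (@continuous_min _ _ (cst 1) (fun x => (2 / d * Num.min x (l - x) - 1))); first exact: cst_continuous.
  apply: continuousB; last exact: cst_continuous.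
  apply: continuousM; first exact: cst_continuous.
  apply: (@continuous_min _ _ id (fun x => l - x)) => //.
  by apply: continuousB; first exact: cst_continuous.
have rho0 x : x <= d / 2 \/ l - d / 2 <= x -> rho x = 0.
  move=> h; rewrite /rho; apply/eqP; rewrite eq_le ge_max lexx /= le_max lexx /= ge_min; apply/andP; split => //.
  apply/orP; right; rewrite subr_le0 mulrC mulrA ler_pdivrMr // mul1r.
  have : Num.min x (l - x) <= d / 2 by rewrite ge_min; case: h => h; apply/orP; [left|right]; lra.
  lra.
have rho1 x : d <= x <= l - d -> rho x = 1.
  move=> h; rewrite /rho min_l ?max_r //.
  rewrite lerBrDl mulrC mulrA ler_pdivlMr //.
  have : d <= Num.min x (l - x) by rewrite le_min; lra.
  lra.
pose G x := rho x * g x.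
have cG : continuous G by move=> x; apply: continuousM; [exact: crho|exact: cg].
have GM x : `|G x| <= k%:R.
  rewrite /G normrM -[leRHS]mul1r; apply: ler_pM => //.
  by have /andP[? ?] := rho01 x; rewrite ger0_norm.
have [F [F1 hF]] := steklov cG GM.
(* With 2 r <= d / 2 the averaging window starting at 0 stays where [G] vanishes; the window
   starting at l lies beyond the interval, where [G] is zero too. *)
pose r (n : nat) : R := d / 4 * n.+1%:R^-1.
have r0 n : 0 < r n by rewrite /r mulr_gt0 ?invr_gt0 //; lra.
have rd n : 2 * r n <= d / 2.
  have : n.+1%:R^-1 <= 1 :> R by rewrite invf_le1 // ler1n.
  rewrite /r; move: (n.+1%:R^-1) => t t1.
  have : d * t <= d by rewrite ler_piMr // ltW.
  lra.
have cF n x : 0 <= x -> {for x, continuous (F (r n))}.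
  move=> x0; have [h _ _ _] := hF _ (r0 n); have [h1 _] := h x x0.
  by apply: differentiable_continuous; exact/derivable1_diffP.
have cF1 n x : 0 <= x -> {for x, continuous (F1 (r n))}.
  move=> x0; have [_ h _ _] := hF _ (r0 n); have [h1 _] := h x x0.
  by apply: differentiable_continuous; exact/derivable1_diffP.
have mF n : measurable_fun `[0, l] (F (r n)).
  apply: subspace_continuous_measurable_fun => //; apply: continuous_in_subspaceT => x.
  by rewrite inE /= in_itv /= => /andP[x0 _]; exact: cF.
have mG : measurable_fun `[0, l] G.
  by apply: subspace_continuous_measurable_fun => //; exact: continuous_subspaceT.
have FM n x : 0 <= x -> `|F (r n) x| <= k%:R.
  by move=> x0; have [_ _ h _] := hF _ (r0 n); have [y _ ->] := h x x0.
have cvF x : 0 < x < l -> F (r n) x @[n --> \oo] --> G x.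
  move=> /andP[x0 xl]; apply/cvgrPdist_lt => e ep.
  have /cvgrPdist_lt/(_ _ ep)/nbhs_ballP[dl /= dl0 hd] := cG x.
  near=> n; have [_ _ h _] := hF _ (r0 n); have [y hy ->] := h x (ltW x0).
  apply: hd; rewrite /ball /= distrC ger0_norm; last lra.
  have : r n < dl / 2.
    rewrite /r mulrC -ltr_pdivlMr; last lra.
    near: n; apply: (near_infty_natSinv_lt (PosNum _)).
    by apply: divr_gt0; lra.
  lra.
have dF n x : 0 <= x <= l -> `|F (r n) x| <= k%:R by move=> /andP[x0 _]; exact: FM.
have rk : rL2 l (fun=> k%:R : R).
  by apply: (@rL2_bounded _ _ _ k%:R) => //; move=> x _; rewrite ger0_norm.
have [n hn] := L2_dct mF mG cvF dF (fun x _ => GM x) rk e9.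
have [D1 D2 D3 D4] := hF _ (r0 n); have rn := rd n.
have Gl y : l <= y -> G y = 0 by move=> h; rewrite /G rho0 ?mul0r //; right; lra.
have G0 y : y <= d / 2 -> G y = 0 by move=> h; rewrite /G rho0 ?mul0r //; left.
exists (F (r n)), (F1 (r n)), (fun x => (G (x + r n + r n) - 2 * G (x + r n) + G x) / r n ^+ 2); split.
- by apply: rW1_C1 => // x /andP[x0 _]; [exact: D1|exact: cF1].
- apply: rW1_C1 => // x /andP[x0 _]; first exact: D2.
  have cs (a : R) : {for x, continuous (fun y => G (y + a))}.
    apply: (@continuous_comp _ _ _ (fun y => y + a) G); last exact: cG.
    by apply: continuousD => //; exact: cst_continuous.
  apply: continuousM; last exact: cst_continuous.
  apply: continuousD; last exact: cG.
  apply: continuousB.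
    have := cs (r n + r n); rewrite (_ : (fun y => G (y + (r n + r n))) = (fun y => G (y + r n + r n))) //.
    by apply/funext => y; rewrite addrA.
  by apply: continuousM; [exact: cst_continuous|exact: cs].
- split.
  + by have [y /andP[y0 y1] ->] := D3 0 (lexx _); apply: G0; lra.
  + by have [y /andP[y0 y1] ->] := D3 l le0; apply: Gl.
  + by apply: D4 => // y /andP[y0 y1]; apply: G0; lra.
  + by apply: D4 => // y /andP[y0 y1]; apply: Gl.
- have iF : rL2 l (F (r n)) by apply: (@rL2_bounded _ _ _ k%:R) => // x /andP[x0 _]; exact: FM.
  have iG : rL2 l G by exact: (@rL2_bounded _ _ _ k%:R).
  have ik : rL2 l fk by exact: (@rL2_bounded _ _ _ k%:R).
  have ig : rL2 l g.
    apply: (@rL2_bounded _ _ _ k%:R) => //.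
    by apply: subspace_continuous_measurable_fun => //; exact: continuous_subspaceT.
  have I (u v : R -> R) : rL2 l u -> rL2 l v -> intg l (fun x => (u x - v x) ^+ 2).
    move=> hu hv; have [_] := rL2_lin 1 (-1) hu hv; apply: eq_intg => x _; by rewrite mul1r mulN1r.
  apply: (@le_lt_trans _ _ (3 * \int[mu]_(x in `[0, l]) ((F (r n) x - G x) ^+ 2) +
      (3 * \int[mu]_(x in `[0, l]) ((g x - fk x) ^+ 2) + 3 * \int[mu]_(x in `[0, l]) ((fk x - f x) ^+ 2)))); last lra.
  rewrite -!RintZ; try exact: I.
  rewrite -!RintD; try (by apply: intgZ; exact: I); last by apply: intgD; apply: intgZ; exact: I.
  apply: le_Rintegral => //; first exact: I.
    by apply: intgD; [|apply: intgD]; apply: intgZ; exact: I.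
  move=> x _.
  have k1 : (G x - fk x) ^+ 2 <= (g x - fk x) ^+ 2.
    rewrite /G /fk; have [h|h] := boolP (k.+1%:R^-1 <= x <= l - k.+1%:R^-1); first by rewrite rho1 // mul1r.
    rewrite andbF mulr0 !subr0 exprMn ler_piMl ?sqr_ge0 //.
    have /andP[? ?] := rho01 x; nra.
  have := sqr_ge0 ((F (r n) x - G x) - (G x - fk x)); have := sqr_ge0 ((G x - fk x) - (fk x - f x)).
  have := sqr_ge0 ((F (r n) x - G x) - (fk x - f x)).
  nra.
Unshelve. all: by end_near. Qed.

End Density.

(** * Explicit edge functions and weak second derivatives *)

Section EdgeFunctions.
Context {R : realType}.
Notation mu := (@lebesgue_measure R).
Notation C := R[i].
Notation Re := complex.Re.
Notation Im := complex.Im.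
Notation normc := ComplexField.Normc.normc.
Implicit Types (f g h : R -> C) (a b c z w : C) (l x t : R).

Lemma W1_cst l c : 0 <= l -> W1 l (fun=> c) (fun=> 0).
Proof.
move=> l0; apply: W1_C1 => //= x.
- exact: is_derive_cst.
- exact: is_derive_cst.
- exact: cst_continuous.
- exact: cst_continuous.
Qed.

Lemma W1_mon l k : 0 <= l -> W1 l (fun x => (x%:C) ^+ k.+1) (fun x => k.+1%:R * (x%:C) ^+ k).
Proof.
move=> l0; have E x n : (x%:C) ^+ n = (x ^+ n)%:C :> C by rewrite rmorphXn.
have N n : (n%:R : C) = (n%:R : R)%:C by rewrite rmorph_nat.
apply: (@eq_W1 _ _ (fun x => (x ^+ k.+1)%:C) (fun x => (k.+1%:R * x ^+ k)%:C)) => //.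
  by move=> x _; rewrite E N rmorphM.
apply: W1_C1 => //= x.
- apply: DeriveDef; first exact: exprn_derivable.
  by rewrite exp_derive /GRing.scale /= mulr1.
- exact: is_derive_cst.
- have h : {for x, continuous (fun y : R => k.+1%:R * y ^+ k)}.
    by apply: continuousM; [exact: cst_continuous|exact: exprn_continuous].
  exact: h.
- exact: cst_continuous.
Qed.

Lemma W1_cubic l a b c z : 0 <= l ->
  W1 l (fun x => a + b * x%:C + c * x%:C ^+ 2 + z * x%:C ^+ 3)
       (fun x => b + 2 * c * x%:C + 3 * z * x%:C ^+ 2).
Proof.
move=> l0.
have h := W1_lin 1 1 l0 (W1_lin 1 b l0 (W1_cst a l0) (W1_mon 0 l0)) (W1_lin c z l0 (W1_mon 1 l0) (W1_mon 2 l0)).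
by apply: eq_W1 h => // x _; ring.
Qed.

(** Cubic Hermite interpolation: values and slopes at both ends are free, as required for test
    functions adapted to the vertices. *)
Lemma hermite l a b c z : 0 < l -> exists p p1 p2, W2 l p p1 p2 /\
  [/\ p 0 = a, p1 0 = b, p l = c & p1 l = z].
Proof.
move=> l0; have le0 := ltW l0; have L0 : l%:C != 0 :> C by rewrite eq_complex /= gt_eqF.
pose c2 : C := 3 * (c - a) / l%:C ^+ 2 - (2 * b + z) / l%:C.
pose c3 : C := 2 * (a - c) / l%:C ^+ 3 + (b + z) / l%:C ^+ 2.
exists (fun x => a + b * x%:C + c2 * x%:C ^+ 2 + c3 * x%:C ^+ 3).
exists (fun x => b + 2 * c2 * x%:C + 3 * c3 * x%:C ^+ 2).
exists (fun x => 2 * c2 + 2 * (3 * c3) * x%:C).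
split; first split.
- exact: W1_cubic.
- have h := W1_cubic b (2 * c2) (3 * c3) 0 le0.
  by apply: eq_W1 h => // x _; ring.
- split.
  + by rewrite (_ : (0 : R)%:C = 0 :> C) //; ring.
  + by rewrite (_ : (0 : R)%:C = 0 :> C) //; ring.
  + by rewrite /c2 /c3; field.
  + by rewrite /c2 /c3; field.
Qed.

Definition cexpx (k : C) (x : R) : C := (expR (Re k * x))%:C * (cos (Im k * x) +i* sin (Im k * x)).

Lemma W1_cexpx l k : 0 <= l -> W1 l (cexpx k) (fun x => k * cexpx k x).
Proof.
move=> l0.
have dm (r x : R) : is_derive x 1 (fun y => r * y) r.
  by apply: is_derive_eq; rewrite /GRing.scale /=; ring.
have de (r x : R) : is_derive x 1 (fun y => expR (r * y)) (expR (r * x) * r).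
  exact: (is_derive1_comp (is_derive_expR _) (dm r x)).
have dc (r x : R) : is_derive x 1 (fun y => cos (r * y)) (- sin (r * x) * r).
  exact: (is_derive1_comp (is_derive_cos _) (dm r x)).
have ds (r x : R) : is_derive x 1 (fun y => sin (r * y)) (cos (r * x) * r).
  exact: (is_derive1_comp (is_derive_sin _) (dm r x)).
have cc (F F' : R -> R) : (forall x, is_derive x 1 F (F' x)) -> continuous F.
  move=> h x; apply: differentiable_continuous; apply/derivable1_diffP.
  by have [] := h x.
have dR x : is_derive x 1 (fun y => Re (cexpx k y)) (Re (k * cexpx k x)).
  rewrite (_ : (fun y => _) = (fun y => expR (Re k * y) * cos (Im k * y))); last first.
    by apply/funext => y; rewrite /cexpx !cE /= mul0r subr0.
  have -> : Re (k * cexpx k x) = expR (Re k * x) *: (- sin (Im k * x) * Im k) + cos (Im k * x) *: (expR (Re k * x) * Re k).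
    by rewrite /cexpx !cE /= /GRing.scale /=; ring.
  exact: (is_deriveM (de (Re k) x) (dc (Im k) x)).
have dI x : is_derive x 1 (fun y => Im (cexpx k y)) (Im (k * cexpx k x)).
  rewrite (_ : (fun y => _) = (fun y => expR (Re k * y) * sin (Im k * y))); last first.
    by apply/funext => y; rewrite /cexpx !cE /= mul0r addr0.
  have -> : Im (k * cexpx k x) = expR (Re k * x) *: (cos (Im k * x) * Im k) + sin (Im k * x) *: (expR (Re k * x) * Re k).
    by rewrite /cexpx !cE /= /GRing.scale /=; ring.
  exact: (is_deriveM (de (Re k) x) (ds (Im k) x)).
have cR := cc _ _ dR; have cI := cc _ _ dI.
apply: W1_C1 => // x.
- have h : {for x, continuous (fun y : R => Re k * Re (cexpx k y) - Im k * Im (cexpx k y))}.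
    by apply: continuousB; apply: continuousM; try exact: cst_continuous; [exact: cR|exact: cI].
  rewrite (_ : (fun y => Re (k * cexpx k y)) = (fun y => Re k * Re (cexpx k y) - Im k * Im (cexpx k y))) //.
  by apply/funext => y; rewrite !cE.
- have h : {for x, continuous (fun y : R => Re k * Im (cexpx k y) + Im k * Re (cexpx k y))}.
    by apply: continuousD; apply: continuousM; try exact: cst_continuous; [exact: cI|exact: cR].
  rewrite (_ : (fun y => Im (k * cexpx k y)) = (fun y => Re k * Im (cexpx k y) + Im k * Re (cexpx k y))) //.
  by apply/funext => y; rewrite !cE.
Qed.

Lemma cexpx_norm k x : normc (cexpx k x) ^+ 2 = expR (Re k * x) ^+ 2.
Proof.
rewrite /cexpx normcM2 !normc2 /= expr0n /= addr0.
by rewrite cos2Dsin2 mulr1.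
Qed.

Lemma cexpx0 k : cexpx k 0 = 1.
Proof. by rewrite /cexpx !mulr0 expR0 cos0 sin0; apply: complexP; rewrite !cE /=; ring. Qed.

(* du Bois-Reymond: [u - w] is orthogonal to every second derivative, hence affine. *)
Lemma weak_W2 l u v : 0 < l -> cL2 l u -> cL2 l v ->
  (forall p p1 p2, W2 l p p1 p2 -> p 0 = 0 -> p l = 0 -> p1 0 = 0 -> p1 l = 0 ->
    ip l p2 u = ip l p v) ->
  exists f f1, W2 l f f1 v /\ {ae mu, forall x, 0 <= x <= l -> u x = f x}.
Proof.
move=> l0 hu hv H; have le0 := ltW l0; have L0 : l%:C != 0 :> C by rewrite eq_complex /= gt_eqF.
(* [w] will be a twofold primitive of v, so that u - w has weak second derivative zero. *)
pose w1 x : C := 0 + cint `[0, x] v.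
have hw1 : W1 l w1 v by exact: prim_W1.
pose w x : C := 0 + cint `[0, x] w1.
have hw : W1 l w w1 by apply: prim_W1; exact: W1_cL2 hw1.
have cw := W1_cL2 le0 hw.
pose r x := 1 * u x + (-1) * w x.
have cr : cL2 l r by exact: cL2_lin.
pose X x : C := x%:C.
have hX : W1 l X (fun=> 1).
  have := W1_mon 0 le0; apply: eq_W1 => // x _.
  by rewrite expr0 mulr1.
have cX := W1_cL2 le0 hX.
have h1 : cL2 l (fun=> 1 : C) by exact: (W1_cL2 le0 (W1_cst 1 le0)).
pose m0 := cint `[0, l] r.
pose m1 := cint `[0, l] (fun x => X x * r x).
have i1 : cint `[0, l] (fun=> 1) = l%:C.
  have := cint_parts le0 hX (W1_cst 1 le0); rewrite /X !mulr1 (_ : (0 : R)%:C = 0) // subr0 => <-.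
  by apply: eq_cint => x _; ring.
have iX : 2 * cint `[0, l] X = l%:C ^+ 2.
  have := cint_parts le0 hX hX; rewrite {3 4 5 6}/X (_ : (0 : R)%:C = 0) // mulr0 subr0 -expr2 => <-.
  rewrite -cintZ; last exact: cL2_cintg.
  by apply: eq_cint => x _; ring.
have iXX : 3 * cint `[0, l] (fun x => X x * X x) = l%:C ^+ 3.
  have hm := W1_mon 1 le0.
  have X0 : X 0 = 0 by [].
  have := cint_parts le0 hX hm; rewrite X0 mul0r subr0 => e.
  have -> : l%:C ^+ 3 = X l * l%:C ^+ 2 by rewrite exprS.
  rewrite -e -cintZ; last exact: cL2_mul.
  by apply: eq_cint => x _; rewrite /X; ring.
(* [a + b x] is the orthogonal projection of [r] onto the affine functions. *)
pose b := (12 * m1 / l%:C ^+ 3 - 6 * m0 / l%:C ^+ 2).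
pose a := (4 * m0 / l%:C - 6 * m1 / l%:C ^+ 2).
pose g x := 1 * r x + (-1) * (a * 1 + b * X x).
have cab : cL2 l (fun x => a * 1 + b * X x) by exact: (cL2_lin a b h1 cX).
have cg : cL2 l g by exact: cL2_lin.
have iX' : cint `[0, l] X = l%:C ^+ 2 / 2 by rewrite -iX; field.
have iXX' : cint `[0, l] (fun x => X x * X x) = l%:C ^+ 3 / 3 by rewrite -iXX; field.
have g0 : cint `[0, l] g = 0.
  rewrite /g (cint_lin _ _ (cL2_cintg cr) (cL2_cintg cab)) (cint_lin _ _ (cL2_cintg h1) (cL2_cintg cX)).
  by rewrite i1 iX' -/m0 /a /b; field.
have g1 : cint `[0, l] (fun x => X x * g x) = 0.
  rewrite (@eq_cint _ _ _ (fun x => 1 * (X x * r x) + (-1) * (a * X x + b * (X x * X x)))); last by move=> x _; rewrite /g; ring.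
  have cXX := cL2_mul cX cX.
  rewrite (cint_lin _ _ (cL2_mul cX cr)); last by apply: cintgD; apply: cintgZ => //; exact: cL2_cintg.
  rewrite (cint_lin _ _ (cL2_cintg cX) cXX).
  by rewrite iX' iXX' -/m1 /a /b; field.
(* The test function is the twofold primitive of the residual [g]; orthogonality of [g] to 1 and x
   says exactly that its data at l vanish. *)
pose p1 x : C := 0 + cint `[0, x] g.
have hp1 : W1 l p1 g by exact: prim_W1.
pose p x : C := 0 + cint `[0, x] p1.
have hp : W1 l p p1 by apply: prim_W1; exact: W1_cL2 hp1.
have s0 F : 0 + cint `[0, (0 : R)] F = 0 by rewrite set_itv1 /cint !Rintegral_set1 addr0.
have p10 : p1 0 = 0 by exact: s0.
have p1l : p1 l = 0 by rewrite /p1 g0 addr0.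
have p0 : p 0 = 0 by exact: s0.
have pl : p l = 0.
  have := cint_parts le0 hX hp1; rewrite p1l p10 !mulr0 subr0 cintD.
  - by rewrite g1 addr0 /p add0r => E; rewrite -[RHS]E; apply: eq_cint => x _; rewrite mul1r.
  - by apply: cL2_mul => //; exact: W1_cL2 hp1.
  - exact: cL2_mul.
have cp := W1_cL2 le0 hp.
have E := H p p1 g (conj hp hp1) p0 pl p10 p1l.
have E2 : ip l g w = ip l p v.
  have := green_ip le0 (conj hp hp1) (conj hw hw1).
  by rewrite p0 pl p10 p1l !mul0r !subrr => /subr0_eq.
have E3 : ip l g r = 0.
  have := ip_lin 1 (-1) hu cw cg; rewrite -/(r) => e.
  have : ip l r g = 0.
    by rewrite /r e (ipC cg hu) (ipC cg cw) E E2 mul1r mulN1r subrr.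
  move=> e2; rewrite (ipC cr cg) e2; apply: complexP; rewrite !cE //= oppr0 //.
(* [g] is the difference of [r] and an affine function and is orthogonal to both. *)
have E4 : ip l g g = 0.
  have : ip l g g = conjc (ip l g g) by exact: ipC.
  have e : ip l g g = ip l r g + (-1) * ip l (fun x => a * 1 + b * X x) g.
    by have := ip_lin 1 (-1) cr cab cg; rewrite mul1r.
  have e0 : ip l (fun x => a * 1 + b * X x) g = 0.
    rewrite (ip_lin a b h1 cX cg).
    have -> : ip l (fun=> 1) g = 0.
      rewrite /ip (@eq_cint _ _ _ (fun x => conjc (g x))); last by move=> x _; rewrite mul1r.
      rewrite cintJ ?g0; last exact: cL2_cintg.
      by apply: complexP; rewrite !cE /= ?oppr0.
    have -> : ip l X g = 0.
      rewrite /ip (@eq_cint _ _ _ (fun x => conjc (X x * g x))).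
        rewrite cintJ ?g1; last exact: cL2_mul.
        by apply: complexP; rewrite !cE /= ?oppr0.
      by move=> x _; rewrite conjcM; congr (_ * _); apply: complexP; rewrite !cE /= ?oppr0.
    by rewrite !mulr0 addr0.
  move=> _; rewrite e e0 mulr0 addr0 (ipC cg cr) E3; apply: complexP; rewrite !cE /= ?oppr0 //.
have n0 : nrm l g = 0 by move: E4; rewrite ipff // => -[].
have ae := nrm_eq0 cg n0.
exists (fun x => 1 * w x + 1 * (a + b * X x + 0 * x%:C ^+ 2 + 0 * x%:C ^+ 3)).
exists (fun x => 1 * w1 x + 1 * (b + 2 * 0 * x%:C + 3 * 0 * x%:C ^+ 2)).
split; first split.
- exact: (W1_lin 1 1 le0 hw (W1_cubic a b 0 0 le0)).
- have := W1_lin 1 1 le0 hw1 (W1_cst b le0); apply: eq_W1 => // x _; ring.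
- move: ae; apply: filterS; first exact: (ae_filter_ringOfSetsType mu).
  move=> x h hx; have := h hx; rewrite /g /r => e.
  apply/eqP; rewrite -subr_eq0; apply/eqP; rewrite -[RHS]e; ring.
Qed.

Lemma density l f : 0 < l -> cL2 l f -> forall eps, 0 < eps ->
  exists p p1 p2, [/\ W2 l p p1 p2, [/\ p 0 = 0, p l = 0, p1 0 = 0 & p1 l = 0] &
    nrm l (fun x => f x - p x) < eps].
Proof.
move=> l0 [h1 h2] eps eps0; have e2 : 0 < eps / 2 by lra.
have [p [p1 [p2 [w1 w2 [a b c d] n1]]]] := density_real l0 h1 e2.
have [q [q1 [q2 [v1 v2 [a' b' c' d'] n2]]]] := density_real l0 h2 e2.
exists (fun x => p x +i* q x), (fun x => p1 x +i* q1 x), (fun x => p2 x +i* q2 x); split.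
- by split; apply/W1P; split.
- by rewrite a b c d a' b' c' d'.
- have I (f1 f2 f3 : R -> R) : rW1 l f1 f2 -> rL2 l f3 -> intg l (fun x => (f1 x - f3 x) ^+ 2).
    move=> /(rW1_rL2 (ltW l0)) hu hv; have [_] := rL2_lin 1 (-1) hu hv.
    by apply: eq_intg => x _; rewrite mul1r mulN1r.
  rewrite /nrm (@eq_Rint _ _ _ (fun x => (p x - Re (f x)) ^+ 2 + (q x - Im (f x)) ^+ 2)).
    rewrite RintD; [lra|exact: I w1 h1|exact: I v1 h2].
  by move=> x _; rewrite normc2 !cE /=; ring.
Qed.

End EdgeFunctions.

(** * The Hilbert space of the antitree *)

Section Sequences.
Context {R : realType}.
Implicit Types (u v : nat -> R) (M eps : R).
Notation C := R[i].
Notation Re := complex.Re.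
Notation Im := complex.Im.

Lemma nneseries_le u M : (forall n, 0 <= u n) -> (forall N, \sum_(0 <= n < N) u n <= M) ->
  (\sum_(0 <= n <oo) (u n)%:E <= M%:E)%E.
Proof.
move=> u0 h; apply: lime_le; first by apply: is_cvg_nneseries => n _; rewrite lee_fin.
by apply: nearW => N /=; rewrite sumEFin lee_fin.
Qed.

Lemma nneseries_ge u N : (forall n, 0 <= u n) ->
  ((\sum_(0 <= n < N) u n)%:E <= \sum_(0 <= n <oo) (u n)%:E)%E.
Proof.
move=> u0; rewrite -sumEFin; apply: nneseries_lim_ge => n _ _; by rewrite lee_fin.
Qed.

Lemma series_bounded_cvg u M : (forall n, 0 <= u n) -> (forall N, \sum_(0 <= n < N) u n <= M) ->
  cvgn (series u).
Proof.
move=> u0 h; apply: nondecreasing_is_cvgn.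
  by apply/nondecreasing_seqP => n; rewrite seriesSr lerDl.
by exists M => _ [N _ <-]; exact: h.
Qed.

Lemma series_dominated_cvg u v M : (forall n, `|u n| <= v n) ->
  (forall N, \sum_(0 <= n < N) v n <= M) -> cvgn (series u).
Proof.
move=> h hM; apply: normed_cvg; apply: (@series_le_cvg _ _ v) => //.
- by move=> n /=; exact: normr_ge0.
- by move=> n; apply: le_trans (h n).
- by apply: series_bounded_cvg hM => n; apply: le_trans (h n).
Qed.

Lemma series_tail u M : (forall n, 0 <= u n) -> (forall N, \sum_(0 <= n < N) u n <= M) ->
  forall eps, 0 < eps -> exists N, forall m n, (N <= m)%N -> \sum_(m <= k < n) u k <= eps.
Proof.
move=> u0 h eps e0; have c := series_bounded_cvg u0 h.
have nd : nondecreasing_seq (series u) by apply/nondecreasing_seqP => n; rewrite seriesSr lerDl.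
move/cvgrPdist_lt : (c) => /(_ _ e0) [N _ hN]; exists N => m n Nm.
have [mn|nm] := leqP m n; last by rewrite big_geq ?ltW // ltnW.
have := hN m Nm; rewrite /= ger0_norm; last by rewrite subr_ge0; exact: nondecreasing_cvgn_le.
have := nondecreasing_cvgn_le nd c n.
rewrite /series /= (big_cat_nat (leq0n m) mn) /=; lra.
Qed.

(** Convergence is componentwise because [inner] is defined by two real limits. *)
Definition ccv (u : nat -> C) (z : C) := (Re (u n) @[n --> \oo] --> Re z) /\ (Im (u n) @[n --> \oo] --> Im z).

Lemma ccv_lin (u v : nat -> C) a b z w : ccv u z -> ccv v w -> ccv (fun n => a * u n + b * v n) (a * z + b * w).
Proof.
move=> [u1 u2] [v1 v2]; split; rewrite !cE.
- rewrite (_ : (fun n => _) = (fun n => (Re a * Re (u n) - Im a * Im (u n)) + (Re b * Re (v n) - Im b * Im (v n)))).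
    by apply: cvgD; apply: cvgB; apply: cvgMl_tmp.
  by apply/funext => n; rewrite !cE.
- rewrite (_ : (fun n => _) = (fun n => (Re a * Im (u n) + Im a * Re (u n)) + (Re b * Im (v n) + Im b * Re (v n)))).
    by apply: cvgD; apply: cvgD; apply: cvgMl_tmp.
  by apply/funext => n; rewrite !cE.
Qed.

Lemma ccv_conj (u : nat -> C) z : ccv u z -> ccv (fun n => conjc (u n)) (conjc z).
Proof.
move=> [u1 u2]; split; rewrite cE.
- by rewrite (_ : (fun n => _) = (fun n => Re (u n))) //; apply/funext => n; rewrite cE.
- by rewrite (_ : (fun n => _) = (fun n => - Im (u n))); [exact: cvgN|apply/funext => n; rewrite cE].
Qed.

Lemma ccv_uniq (u : nat -> C) z w : ccv u z -> ccv u w -> z = w.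
Proof.
move=> [u1 u2] [v1 v2]; apply: complexP.
- exact: (cvg_unique _ u1 v1).
- exact: (cvg_unique _ u2 v2).
Qed.

Lemma ccv_near (u v : nat -> C) z N : (forall n, (N <= n)%N -> u n = v n) -> ccv u z -> ccv v z.
Proof.
move=> h [u1 u2]; split.
- by apply: cvg_trans u1; apply: near_eq_cvg; exists N => // n /= hn; rewrite h.
- by apply: cvg_trans u2; apply: near_eq_cvg; exists N => // n /= hn; rewrite h.
Qed.

End Sequences.

Section L2Space.
Context {R : realType}.
Variables (s : nat -> nat) (l : nat -> R).
Hypothesis l_gt0 : forall n, 0 < l n.
Notation mu := (@lebesgue_measure R).
Notation C := R[i].
Notation Re := complex.Re.
Notation Im := complex.Im.
Notation normc := ComplexField.Normc.normc.
Local Notation efun := (efun R s).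
Implicit Types (e : edge s) (f g h u v : efun) (a b c z w : C) (M eps t : R).

Lemma mkedgeE e : exists n (i : 'I_(s n)) (j : 'I_(s n.+1)), e = mkedge i j.
Proof. by case: e => n [i j]; exists n, i, j. Qed.

Lemma elen_gt0 e : 0 < elen l e. Proof. exact: l_gt0. Qed.

(** The sets [J n] partition the edges and each is finite; for nonnegative terms the unordered sum
    may be grouped along them. *)
Lemma esum_edge (a : edge s -> \bar R) : (forall e, 0 <= a e)%E ->
  (\esum_(e in [set: edge s]) a e =
   \sum_(0 <= n <oo) \sum_(i < s n) \sum_(j < s n.+1) a (mkedge i j))%E.
Proof.
move=> a0.
pose J n := [set e : edge s | tag e = n].
have -> : [set: edge s] = \bigcup_(n in [set: nat]) J n.
  by apply/seteqP; split => // e _; exists (tag e).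
rewrite esum_bigcupT //; last first.
  by move=> m n _ _ [e [<- <-]].
rewrite -nneseries_esumT; last by move=> n; exact: esum_ge0.
apply: eq_eseriesr => n _.
pose m (p : 'I_(s n) * 'I_(s n.+1)) : edge s := mkedge p.1 p.2.
have bm : set_bij [set: 'I_(s n) * 'I_(s n.+1)] (J n) m.
  split.
  - by move=> p _.
  - by move=> [i j] [i' j'] _ _; rewrite /m /mkedge /= => /eqP; rewrite eq_Tagged => /eqP.
  - by move=> [k [i j]]; rewrite /J /= => e; move: i j; rewrite e => i j; exists (i, j).
rewrite (reindex_esum _ _ _ _ bm) esum_fset //; last by exact: finite_finset.
rewrite pair_bigA /=.
rewrite [RHS](@bigfs _ _ _ _ (index_enum _) predT) ?index_enum_uniq //; last first.
  by move=> i _; rewrite mem_index_enum.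
have -> : [set` (predT : pred ('I_(s n) * 'I_(s n.+1)))] = setT by apply/seteqP; split.
by [].
Qed.

Definition lc a f b g : efun := fun e x => a * f e x + b * g e x.
Definition eL2 f := forall e, cL2 (elen l e) (f e).
Definition lnrm f n : R := \sum_(i < s n) \sum_(j < s n.+1) nrm (l n) (f (mkedge i j)).
Definition linp f g n : C := \sum_(i < s n) \sum_(j < s n.+1) ip (l n) (f (mkedge i j)) (g (mkedge i j)).
(** A real-valued squared norm. It equals [sqnorm] on L^2; outside L^2 the limit may be a default
    value. *)
Definition sqn f : R := limn (series (lnrm f)).

Lemma eL2_lc a f b g : eL2 f -> eL2 g -> eL2 (lc a f b g).
Proof. by move=> hf hg e; exact: cL2_lin. Qed.

Lemma lnrm_ge0 f n : 0 <= lnrm f n.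
Proof. by apply: sumr_ge0 => i _; apply: sumr_ge0 => j _; exact: nrm_ge0. Qed.

Lemma sqnormE f : eL2 f -> sqnorm l f = (\sum_(0 <= n <oo) (lnrm f n)%:E)%E.
Proof.
move=> hf; rewrite /sqnorm esum_edge; last first.
  by move=> e; rewrite sqintE ?lee_fin ?nrm_ge0.
apply: eq_eseriesr => n _; rewrite /lnrm -sumEFin; apply: eq_bigr => i _.
rewrite -sumEFin; apply: eq_bigr => j _; exact: sqintE.
Qed.

Lemma L2P f : L2 l f <-> eL2 f /\ exists M, forall N, \sum_(0 <= n < N) lnrm f n <= M.
Proof.
split.
- move=> [m q]; have hf : eL2 f.
    move=> e; apply/cL2P; split; first exact: m.
    apply: le_lt_trans q; rewrite /sqnorm.
    rewrite (esumID [set e]); last first.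
      by move=> ? _; apply: integral_ge0 => x _; rewrite lee_fin sqr_ge0.
    rewrite setTI esum_set1; last by apply: integral_ge0 => x _; rewrite lee_fin sqr_ge0.
    rewrite leeDl //; apply: esum_ge0 => ? _; apply: integral_ge0 => x _; rewrite lee_fin sqr_ge0 //.
  split => //; rewrite sqnormE // in q.
  set S := (\sum_(0 <= n <oo) _)%E in q.
  have S0 : (0 <= S)%E by apply: nneseries_ge0 => n _ _; rewrite lee_fin lnrm_ge0.
  exists (fine S) => N; rewrite -lee_fin fineK; last by rewrite ge0_fin_numE.
  by apply: nneseries_ge => n; exact: lnrm_ge0.
- move=> [hf [M hM]]; split; first by move=> e; have /cL2P[] := hf e.
  rewrite sqnormE //; apply: le_lt_trans (ltry M); apply: nneseries_le hM; exact: lnrm_ge0.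
Qed.

Lemma L2_eL2 f : L2 l f -> eL2 f. Proof. by move=> /L2P[]. Qed.

Lemma sqn_ge f N : L2 l f -> \sum_(0 <= n < N) lnrm f n <= sqn f.
Proof.
move=> /L2P[hf [M hM]]; apply: (@nondecreasing_cvgn_le _ (series (lnrm f))).
  by apply/nondecreasing_seqP => n; rewrite seriesSr lerDl lnrm_ge0.
by apply: series_bounded_cvg hM; exact: lnrm_ge0.
Qed.

Lemma sqn_le f M : (forall N, \sum_(0 <= n < N) lnrm f n <= M) -> sqn f <= M.
Proof.
move=> hM; apply: limr_le; first by apply: series_bounded_cvg hM; exact: lnrm_ge0.
exact: nearW.
Qed.

Lemma sqn_ge0 f : L2 l f -> 0 <= sqn f.
Proof. by move=> hf; have := sqn_ge 0 hf; rewrite big_geq. Qed.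

Lemma sqnorm_sqn f : L2 l f -> sqnorm l f = (sqn f)%:E.
Proof.
move=> hf; apply/eqP; rewrite eq_le sqnormE; last exact: L2_eL2.
rewrite nneseries_le; [|exact: lnrm_ge0|by move=> N; exact: sqn_ge].
have S0 : (0 <= \sum_(0 <= n <oo) (lnrm f n)%:E)%E by apply: nneseries_ge0 => n _ _; rewrite lee_fin lnrm_ge0.
have Sf : (\sum_(0 <= n <oo) (lnrm f n)%:E)%E \is a fin_num.
  by rewrite ge0_fin_numE // -sqnormE; [case: hf|exact: L2_eL2].
rewrite -(fineK Sf) lee_fin; apply: sqn_le => N; rewrite -lee_fin fineK //.
by apply: nneseries_ge; exact: lnrm_ge0.
Qed.

Lemma sqn_tail f : L2 l f -> forall eps, 0 < eps ->
  exists N, forall m n, (N <= m)%N -> \sum_(m <= k < n) lnrm f k <= eps.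
Proof. by move=> /L2P[_ [M hM]]; apply: series_tail hM; exact: lnrm_ge0. Qed.

Lemma lnrm_lc a f b g n : eL2 f -> eL2 g ->
  lnrm (lc a f b g) n <= 2 * normc a ^+ 2 * lnrm f n + 2 * normc b ^+ 2 * lnrm g n.
Proof.
move=> hf hg; rewrite /lnrm !mulr_sumr -big_split /=; apply: ler_sum => i _.
rewrite !mulr_sumr -big_split /=; apply: ler_sum => j _.
by apply: nrm_lin; [exact: (hf (mkedge i j))|exact: (hg (mkedge i j))].
Qed.

Lemma sum_lnrm_lc a f b g N : L2 l f -> L2 l g ->
  \sum_(0 <= n < N) lnrm (lc a f b g) n <= 2 * normc a ^+ 2 * sqn f + 2 * normc b ^+ 2 * sqn g.
Proof.
move=> hf hg.
apply: (@le_trans _ _ (\sum_(0 <= n < N) (2 * normc a ^+ 2 * lnrm f n + 2 * normc b ^+ 2 * lnrm g n))).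
  by apply: ler_sum => n _; apply: lnrm_lc; exact: L2_eL2.
rewrite big_split /= -!mulr_sumr; apply: lerD; apply: ler_wpM2l; try exact: sqn_ge.
- by rewrite mulr_ge0 // sqr_ge0.
- by rewrite mulr_ge0 // sqr_ge0.
Qed.

Lemma L2_lc a f b g : L2 l f -> L2 l g -> L2 l (lc a f b g).
Proof.
move=> hf hg; apply/L2P; split; first by apply: eL2_lc; exact: L2_eL2.
by eexists => N; exact: sum_lnrm_lc.
Qed.

Lemma sqn_lc a f b g : L2 l f -> L2 l g ->
  sqn (lc a f b g) <= 2 * normc a ^+ 2 * sqn f + 2 * normc b ^+ 2 * sqn g.
Proof. by move=> hf hg; apply: sqn_le => N; exact: sum_lnrm_lc. Qed.

Lemma fsubE f g : fsub f g = lc 1 f (-1) g.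
Proof. by apply/funext => e; apply/funext => x; rewrite /fsub /lc mul1r mulN1r. Qed.

Lemma inner_uptoE f g N : inner_upto l f g N = \sum_(0 <= n < N) linp f g n.
Proof. by rewrite big_mkord. Qed.

(** Multiplication by -i turns the imaginary part into the real part and preserves the norm. *)
Lemma ip_young_Im x (f g : R -> C) t : 0 < t -> cL2 x f -> cL2 x g ->
  `|Im (ip x f g)| <= (t * nrm x f + t^-1 * nrm x g) / 2.
Proof.
move=> t0 hf hg; have hf' := cL2_lin (0 -i* 1) 0 hf hf.
have := ip_young t0 hf' hg; rewrite ip_lin // mul0r addr0 cE /= mul0r sub0r mulN1r opprK.
move/le_trans; apply; rewrite ler_pM2r // lerD2r ler_pM2l //.
have := nrmZ (0 -i* 1) hf; rewrite normc2 /= expr0n /= sqrrN expr1n add0r mul1r => <-.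
by rewrite le_eqVlt; apply/orP; left; apply/eqP; apply: eq_nrm => y _; rewrite mul0r addr0.
Qed.

Lemma Re_sum I (r : seq I) (P : pred I) (F : I -> C) : Re (\sum_(i <- r | P i) F i) = \sum_(i <- r | P i) Re (F i).
Proof. exact: (big_morph (@complex.Re R) (@ReD R) erefl). Qed.
Lemma Im_sum I (r : seq I) (P : pred I) (F : I -> C) : Im (\sum_(i <- r | P i) F i) = \sum_(i <- r | P i) Im (F i).
Proof. exact: (big_morph (@complex.Im R) (@ImD R) erefl). Qed.

Lemma linp_young f g n t : 0 < t -> eL2 f -> eL2 g ->
  `|Re (linp f g n)| <= (t * lnrm f n + t^-1 * lnrm g n) / 2 /\
  `|Im (linp f g n)| <= (t * lnrm f n + t^-1 * lnrm g n) / 2.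
Proof.
move=> t0 hf hg.
have -> : (t * lnrm f n + t^-1 * lnrm g n) / 2 = \sum_(i < s n) \sum_(j < s n.+1)
   ((t * nrm (l n) (f (mkedge i j)) + t^-1 * nrm (l n) (g (mkedge i j))) / 2).
  rewrite /lnrm !mulr_sumr -big_split /= mulr_suml; apply: eq_bigr => i _.
  by rewrite !mulr_sumr -big_split /= mulr_suml.
rewrite /linp; split.
- rewrite Re_sum; apply: (le_trans (ler_norm_sum _ _ _)); apply: ler_sum => i _.
  rewrite Re_sum; apply: (le_trans (ler_norm_sum _ _ _)); apply: ler_sum => j _.
  by apply: ip_young => //; [exact: (hf (mkedge i j))|exact: (hg (mkedge i j))].
- rewrite Im_sum; apply: (le_trans (ler_norm_sum _ _ _)); apply: ler_sum => i _.
  rewrite Im_sum; apply: (le_trans (ler_norm_sum _ _ _)); apply: ler_sum => j _.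
  by apply: ip_young_Im => //; [exact: (hf (mkedge i j))|exact: (hg (mkedge i j))].
Qed.

Lemma sum_young f g t N : 0 < t -> L2 l f -> L2 l g ->
  \sum_(0 <= n < N) ((t * lnrm f n + t^-1 * lnrm g n) / 2) <= (t * sqn f + t^-1 * sqn g) / 2.
Proof.
move=> t0 hf hg; rewrite -mulr_suml big_split /= -!mulr_sumr ler_pM2r //.
apply: lerD; rewrite ler_pM2l ?invr_gt0 //; exact: sqn_ge.
Qed.

(** The two limits in [inner] exist because Young's inequality with weight 1 dominates the layer
    terms by summable ones. *)
Lemma inner_ccv f g : L2 l f -> L2 l g -> ccv (inner_upto l f g) (inner l f g).
Proof.
move=> hf hg; have ef := L2_eL2 hf; have eg := L2_eL2 hg.
split; rewrite /inner /=.
- rewrite (_ : (fun N => _) = series (fun n => Re (linp f g n))); last first.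
    by apply/funext => N; rewrite inner_uptoE Re_sum.
  apply: (@series_dominated_cvg _ _ (fun n => (1 * lnrm f n + 1^-1 * lnrm g n) / 2)).
    by move=> n; have [] := linp_young n (@ltr01 R) ef eg.
  by move=> N; exact: sum_young.
- rewrite (_ : (fun N => _) = series (fun n => Im (linp f g n))); last first.
    by apply/funext => N; rewrite inner_uptoE Im_sum.
  apply: (@series_dominated_cvg _ _ (fun n => (1 * lnrm f n + 1^-1 * lnrm g n) / 2)).
    by move=> n; have [] := linp_young n (@ltr01 R) ef eg.
  by move=> N; exact: sum_young.
Qed.

Lemma inner_young f g t : 0 < t -> L2 l f -> L2 l g ->
  `|Re (inner l f g)| <= (t * sqn f + t^-1 * sqn g) / 2 /\
  `|Im (inner l f g)| <= (t * sqn f + t^-1 * sqn g) / 2.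
Proof.
move=> t0 hf hg; have ef := L2_eL2 hf; have eg := L2_eL2 hg.
have [c1 c2] := inner_ccv hf hg.
have B (F : C -> R) : (F = @complex.Re R \/ F = @complex.Im R) -> (F (inner_upto l f g n) @[n --> \oo] --> F (inner l f g)) ->
   `|F (inner l f g)| <= (t * sqn f + t^-1 * sqn g) / 2.
  move=> hF c; have c' : `|F (inner_upto l f g n)| @[n --> \oo] --> `|F (inner l f g)| by exact: cvg_norm.
  rewrite -(cvg_lim _ c') //; apply: limr_le.
    by apply/cvg_ex; eexists; exact: c'.
  apply: nearW => N; apply: le_trans (sum_young N t0 hf hg).
  rewrite inner_uptoE; case: hF => ->; [rewrite Re_sum|rewrite Im_sum]; apply: (le_trans (ler_norm_sum _ _ _));
   apply: ler_sum => n _; by have [] := linp_young n t0 ef eg.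
by split; [apply: (B (@complex.Re R)); [left|]|apply: (B (@complex.Im R)); [right|]].
Qed.

Lemma linp_lc a f b g h n : eL2 f -> eL2 g -> eL2 h ->
  linp (lc a f b g) h n = a * linp f h n + b * linp g h n.
Proof.
move=> hf hg hh; rewrite /linp !mulr_sumr -big_split /=; apply: eq_bigr => i _.
rewrite !mulr_sumr -big_split /=; apply: eq_bigr => j _.
by apply: ip_lin; [exact: (hf (mkedge i j))|exact: (hg (mkedge i j))|exact: (hh (mkedge i j))].
Qed.

Lemma linpC f g n : eL2 f -> eL2 g -> linp g f n = conjc (linp f g n).
Proof.
move=> hf hg; rewrite /linp (big_morph conjc conjcD (_ : conjc 0 = 0)); last by apply: complexP; rewrite /= ?oppr0.
apply: eq_bigr => i _.
rewrite (big_morph conjc conjcD (_ : conjc 0 = 0)); last by apply: complexP; rewrite /= ?oppr0.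
apply: eq_bigr => j _.
by apply: ipC; [exact: (hf (mkedge i j))|exact: (hg (mkedge i j))].
Qed.

Lemma inner_lcl a f b g h : L2 l f -> L2 l g -> L2 l h ->
  inner l (lc a f b g) h = a * inner l f h + b * inner l g h.
Proof.
move=> hf hg hh; apply: (ccv_uniq (inner_ccv (L2_lc a b hf hg) hh)).
apply: (ccv_near (N := 0) _ (ccv_lin a b (inner_ccv hf hh) (inner_ccv hg hh))) => N _.
rewrite !inner_uptoE !mulr_sumr -big_split /=; apply: eq_bigr => n _.
by rewrite linp_lc //; exact: L2_eL2.
Qed.

Lemma innerC f g : L2 l f -> L2 l g -> inner l g f = conjc (inner l f g).
Proof.
move=> hf hg; apply: (ccv_uniq (inner_ccv hg hf)).
apply: (ccv_near (N := 0) _ (ccv_conj (inner_ccv hf hg))) => N _.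
rewrite !inner_uptoE (big_morph conjc conjcD (_ : conjc 0 = 0)); last by apply: complexP; rewrite /= ?oppr0.
by apply: eq_bigr => n _; rewrite -linpC //; exact: L2_eL2.
Qed.

Lemma inner_lcr a f b g h : L2 l f -> L2 l g -> L2 l h ->
  inner l h (lc a f b g) = conjc a * inner l h f + conjc b * inner l h g.
Proof.
move=> hf hg hh; rewrite (innerC (L2_lc a b hf hg) hh) (inner_lcl a b hf hg hh) conjcD !conjcM.
by rewrite -(innerC hf hh) -(innerC hg hh).
Qed.

Lemma inner_self f : L2 l f -> inner l f f = (sqn f)%:C.
Proof.
move=> hf; apply: (ccv_uniq (inner_ccv hf hf)).
have E N : inner_upto l f f N = (\sum_(0 <= n < N) lnrm f n)%:C.
  rewrite inner_uptoE rmorph_sum /=; apply: eq_bigr => n _.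
  rewrite /linp /lnrm rmorph_sum /=; apply: eq_bigr => i _; rewrite rmorph_sum; apply: eq_bigr => j _.
  by apply: ipff; exact: (L2_eL2 hf (mkedge i j)).
split.
- rewrite (_ : (fun N => _) = series (lnrm f)); last by apply/funext => N; rewrite E.
  by have /L2P[_ [M hM]] := hf; apply: series_bounded_cvg hM; exact: lnrm_ge0.
- rewrite (_ : (fun N => _) = (fun=> 0)); last by apply/funext => N; rewrite E.
  exact: cvg_cst.
Qed.

Lemma inner0l f g : L2 l f -> L2 l g -> sqn f = 0 -> inner l f g = 0.
Proof.
move=> hf hg f0.
have K (x : R) : (forall t, 0 < t -> `|x| <= (t * sqn f + t^-1 * sqn g) / 2) -> x = 0.
  move=> h; apply/eqP/negPn/negP => x0; have g0 := sqn_ge0 hg.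
  have xp : 0 < `|x| by rewrite normr_gt0.
  (* As [sqn f] is 0, a large weight makes the bound small; this one gives at most |x| / 2. *)
  have t0 : 0 < (sqn g + 1) / `|x| by apply: divr_gt0 => //; lra.
  have := h _ t0; rewrite f0 mulr0 add0r invf_div.
  have : `|x| / (sqn g + 1) * sqn g <= `|x|.
    rewrite mulrAC -mulrA ler_piMr // ler_pdivrMr; lra.
  lra.
by apply: complexP; apply: K => t t0; have [] := inner_young t0 hf hg.
Qed.

End L2Space.
Section Arithmetic.
Context {R : realType}.
Notation C := R[i].
Notation Re := complex.Re.
Notation Im := complex.Im.
Implicit Types (A B z w : C) (X Y Z t x y U V K : R).

Lemma norm_sub_bounds A B X Y Z : `|Re A| <= X -> `|Im A| <= X -> `|Re B| <= Y -> `|Im B| <= Y ->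
  X + Y <= Z -> `|Re (A - B)| <= Z /\ `|Im (A - B)| <= Z.
Proof.
move=> a1 a2 b1 b2 h; rewrite ReD ImD ReN ImN.
by split; apply: (le_trans (ler_normB _ _)); apply: le_trans h; apply: lerD.
Qed.

Lemma young_close t x y U V : 0 < t -> 0 <= U -> 0 <= V -> 0 <= x < t ^+ 2 -> 0 <= y < t ^+ 2 ->
  (t * U + t^-1 * x) / 2 + (t * V + t^-1 * y) / 2 <= (U + V + 2) * t.
Proof.
move=> t0 U0 V0 /andP[x0 xt] /andP[y0 yt].
have e r : r < t ^+ 2 -> t^-1 * r <= t by move=> h; rewrite mulrC ler_pdivrMr // -expr2 ltW.
have := e _ xt; have := e _ yt; have := mulr_ge0 (ltW t0) U0; have := mulr_ge0 (ltW t0) V0.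
lra.
Qed.

Lemma le_all_pos_eq0 K x : 0 < K -> (forall t, 0 < t -> `|x| <= K * t) -> x = 0.
Proof.
move=> K0 h; apply/eqP/negPn/negP => x0; have xp : 0 < `|x| by rewrite normr_gt0.
have t0 : 0 < `|x| / (2 * K) by apply: divr_gt0 => //; lra.
have := h _ t0; have -> : K * (`|x| / (2 * K)) = `|x| / 2 by field; rewrite gt_eqF.
lra.
Qed.

Lemma lin_sub_eq0 z w : 1 * z + -1 * w = 0 -> z = w.
Proof. by rewrite mul1r mulN1r => /subr0_eq. Qed.

Lemma lin_sub A B z z' w w' : z' = w' -> A = 1 * z + -1 * z' -> B = 1 * w + -1 * w' -> z - w = A - B.
Proof. by move=> -> -> ->; ring. Qed.

Lemma conjc0 : conjc (0 : C) = 0.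
Proof. by apply: complexP; rewrite /= ?oppr0. Qed.

Lemma conjc1 : conjc (1 : C) = 1.
Proof. by apply: complexP; rewrite /= ?oppr0. Qed.

Lemma conjcN1 : conjc (-1 : C) = -1.
Proof. by rewrite conjcN conjc1. Qed.

Lemma conjc_nat n : conjc (n%:R : C) = n%:R.
Proof. by rewrite -(rmorph_nat (real_complex R)); apply: complexP; rewrite /= ?oppr0. Qed.

End Arithmetic.

Opaque inner sqn.

(** * Green's formula on the first N layers *)

Section Operators.
Context {R : realType}.
Variables (s : nat -> nat) (l : nat -> R).
Hypothesis l_gt0 : forall n, 0 < l n.
Notation mu := (@lebesgue_measure R).
Notation C := R[i].
Notation Re := complex.Re.
Notation Im := complex.Im.
Notation normc := ComplexField.Normc.normc.
Local Notation efun := (efun R s).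
Implicit Types (e : edge s) (f g h u v : efun) (a b c z w : C) (M eps t : R) (p q : efun * efun).

Lemma efun_ext f g : (forall e x, f e x = g e x) -> f = g.
Proof. by move=> h; apply/funext => e; apply/funext => x. Qed.

Lemma lnrm_aeq f g : eL2 l f -> eL2 l g -> aeq l f g -> lnrm l (lc 1 f (-1) g) =1 (fun=> 0).
Proof.
move=> hf hg h n; rewrite /lnrm big1 // => i _; rewrite big1 // => j _.
apply: nrm_ae0; first exact: (eL2_lc 1 (-1) hf hg (mkedge i j)).
have := h (mkedge i j); apply: filterS; first exact: (ae_filter_ringOfSetsType mu).
by move=> x hx /hx; rewrite /lc => ->; ring.
Qed.

Lemma aeq_sym f g : aeq l f g -> aeq l g f.
Proof.
move=> h e; have := h e; apply: filterS; first exact: (ae_filter_ringOfSetsType mu).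
by move=> x hx /hx.
Qed.

Lemma aeq_refl f : aeq l f f.
Proof. by move=> e; apply: nearW. Qed.

Lemma aeq_trans f g h : aeq l f g -> aeq l g h -> aeq l f h.
Proof.
move=> h1 h2 e; have := h1 e; have := h2 e; apply: filterS2; first exact: (ae_filter_ringOfSetsType mu).
by move=> x hx hx' H; rewrite (hx' H) (hx H).
Qed.

Lemma aeq_lc a f b g f' g' : aeq l f f' -> aeq l g g' -> aeq l (lc a f b g) (lc a f' b g').
Proof.
move=> h1 h2 e; have := h1 e; have := h2 e; apply: filterS2; first exact: (ae_filter_ringOfSetsType mu).
by move=> x hx hx' H; rewrite /lc (hx' H) (hx H).
Qed.

Lemma L2_0 : L2 (s := s) l (fun _ _ => 0 : C).
Proof.
apply/L2P => //; split.
  move=> e; apply: (W1_cL2 (ltW (l_gt0 _)) (W1_cst 0 (ltW (l_gt0 _)))).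
exists 0 => N; rewrite big1 // => n _; rewrite /lnrm big1 // => i _; rewrite big1 // => j _.
rewrite /nrm (@eq_Rint _ _ _ (fun=> 0)) ?Rintegral_cst ?mul0r // => x _.
by rewrite normc2 /= expr0n /= addr0.
Qed.

Lemma aeq_sqn f g : L2 l f -> eL2 l g -> aeq l f g -> L2 l g /\ sqn l (lc 1 f (-1) g) = 0.
Proof.
move=> hf hg h; have ef := L2_eL2 hf; have z := lnrm_aeq ef hg h.
have hd : L2 l (lc 1 f (-1) g).
  by apply/L2P => //; split; [exact: eL2_lc|exists 0 => N; rewrite big1 // => n _; rewrite z].
split.
  have -> : g = lc 1 f (-1) (lc 1 f (-1) g) by apply: efun_ext => e x; rewrite /lc; ring.
  exact: L2_lc.
by apply/eqP; rewrite eq_le sqn_ge0 // andbT; apply: sqn_le => N; rewrite big1 // => n _; rewrite z.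
Qed.

Lemma inner_aeql f f' g : L2 l f -> L2 l f' -> L2 l g -> aeq l f f' -> inner l f g = inner l f' g.
Proof.
move=> hf hf' hg h; have [_ z] := aeq_sqn hf (L2_eL2 hf') h.
by apply: lin_sub_eq0; rewrite -(inner_lcl 1 (-1) hf hf' hg) (inner0l (L2_lc 1 (-1) hf hf') hg z).
Qed.

Lemma inner_aeqr f f' g : L2 l f -> L2 l f' -> L2 l g -> aeq l f f' -> inner l g f = inner l g f'.
Proof.
by move=> hf hf' hg h; rewrite (innerC hf hg) (innerC hf' hg) (inner_aeql hf hf' hg h).
Qed.

Lemma sqn0_aeq f : L2 l f -> sqn l f = 0 -> aeq l f (fun _ _ => 0).
Proof.
move=> hf z e; have [n [i [j ->]]] := mkedgeE e.
have h : nrm (l n) (f (mkedge i j)) = 0.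
  apply/eqP; rewrite eq_le nrm_ge0 andbT -z; apply: le_trans (sqn_ge n.+1 hf).
  rewrite big_nat_recr //= /lnrm (bigD1 i) //= (bigD1 j) //=.
  apply: ler_wpDl; first by apply: sumr_ge0 => k _; exact: lnrm_ge0.
  rewrite -addrA lerDl; apply: addr_ge0; first by apply: sumr_ge0 => *; exact: nrm_ge0.
  by apply: sumr_ge0 => *; apply: sumr_ge0 => *; exact: nrm_ge0.
exact: (nrm_eq0 (L2_eL2 hf (mkedge i j)) h).
Qed.

Lemma approx_inner u v p : L2 l u -> L2 l v -> L2 l p.1 -> L2 l p.2 ->
  (forall eps, 0 < eps -> exists q, [/\ L2 l q.1, L2 l q.2, inner l u q.1 = inner l v q.2 &
     (sqnorm l (fsub p.1 q.1) < eps%:E)%E /\ (sqnorm l (fsub p.2 q.2) < eps%:E)%E]) ->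
  inner l u p.1 = inner l v p.2.
Proof.
move=> hu hv h1 h2 H.
have u0 := sqn_ge0 hu; have v0 := sqn_ge0 hv.
have K0 : 0 < sqn l u + sqn l v + 2 by rewrite ltr_wpDl // addr_ge0.
have B t : 0 < t -> `|Re (inner l u p.1 - inner l v p.2)| <= (sqn l u + sqn l v + 2) * t /\
    `|Im (inner l u p.1 - inner l v p.2)| <= (sqn l u + sqn l v + 2) * t.
  (* Errors below t^2 enter Young's inequality with the factor 1 / t, so that the whole bound is of
     order t. *)
  move=> t0; have [|q [q1 q2 E [n1 n2]]] := H (t ^+ 2); first exact: exprn_gt0.
  have d1 := L2_lc 1 (-1) h1 q1; have d2 := L2_lc 1 (-1) h2 q2.
  rewrite fsubE (sqnorm_sqn d1) lte_fin in n1; rewrite fsubE (sqnorm_sqn d2) lte_fin in n2.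
  have e1 : inner l u (lc 1 p.1 (-1) q.1) = 1 * inner l u p.1 + -1 * inner l u q.1.
    rewrite (inner_lcr 1 (-1) h1 q1 hu) conjc1 conjcN1; exact: erefl.
  have e2 : inner l v (lc 1 p.2 (-1) q.2) = 1 * inner l v p.2 + -1 * inner l v q.2.
    rewrite (inner_lcr 1 (-1) h2 q2 hv) conjc1 conjcN1; exact: erefl.
  rewrite (lin_sub E e1 e2).
  have [a1 a2] := inner_young t0 hu d1; have [b1 b2] := inner_young t0 hv d2.
  apply: (norm_sub_bounds a1 a2 b1 b2); apply: (young_close t0 u0 v0).
  - by rewrite (sqn_ge0 d1) n1.
  - by rewrite (sqn_ge0 d2) n2.
apply/eqP; rewrite -subr_eq0; apply/eqP; apply: complexP; apply: (le_all_pos_eq0 K0) => t /B [h h'].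
- exact: h.
- exact: h'.
Qed.

Lemma sum_edge_delta (V : nmodType) (F : edge s -> V) e0 N : (tag e0 < N)%N ->
  (forall e, e != e0 -> F e = 0) ->
  \sum_(0 <= n < N) \sum_(i < s n) \sum_(j < s n.+1) F (mkedge i j) = F e0.
Proof.
have [n [i [j ->]]] := mkedgeE e0 => /= nN h.
have D m (i' : 'I_(s m)) (j' : 'I_(s m.+1)) : m != n -> F (mkedge i' j') = 0.
  by move=> mn; apply: h; apply: contra_neq mn => /(congr1 tag).
rewrite big_mkord (bigD1 (Ordinal nN)) //= [X in _ + X]big1 ?addr0; last first.
  by move=> m mn; rewrite big1 // => i' _; rewrite big1 // => j' _; exact: D.
rewrite (bigD1 i) //= [X in _ + X]big1 ?addr0; last first.
  move=> i' hi; rewrite big1 // => j' _; apply: h.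
  by rewrite /mkedge eq_Tagged /= xpair_eqE negb_and hi.
rewrite (bigD1 j) //= [X in _ + X]big1 ?addr0 //.
by move=> j' hj; apply: h; rewrite /mkedge eq_Tagged /= xpair_eqE negb_and hj orbT.
Qed.

(** Packing the sphere with the index makes vertices of different spheres comparable. *)
Definition vtx n (i : 'I_(s n)) : {n : nat & 'I_(s n)} := existT _ n i.

Lemma sum_vertex_delta (F : forall n, 'I_(s n) -> C) n (i : 'I_(s n)) N : (n < N)%N ->
  \sum_(0 <= m < N) \sum_(k < s m) F m k * (vtx k == vtx i)%:R = F n i.
Proof.
move=> nN; rewrite big_mkord (bigD1 (Ordinal nN)) //= [X in _ + X]big1 ?addr0; last first.
  move=> m mn; rewrite big1 // => k _; rewrite (_ : (_ == _) = false) ?mulr0 //.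
  by apply/negbTE; apply: contra mn => /eqP /(congr1 tag) /= e; apply/eqP/val_inj.
rewrite (bigD1 i) //= eqxx mulr1 big1 ?addr0 //.
by move=> k hk; rewrite /vtx eq_Tagged /= (negbTE hk) mulr0.
Qed.

(** This and [sum_down_delta] compute vertex fluxes of data concentrated on a single edge. *)
Lemma sum_up_delta n m (k : 'I_(s m)) (i : 'I_(s n)) (j : 'I_(s n.+1)) :
  \sum_(r < s m.+1) ((mkedge k r == mkedge i j)%:R : C) = (vtx k == vtx i)%:R.
Proof.
have [e|mn] := eqVneq m n; last first.
  rewrite (_ : (vtx k == _) = false); last by apply/negbTE; apply: contra_neq mn => /(congr1 tag).
  rewrite big1 // => r _; rewrite (_ : (_ == _) = false) //.
  by apply/negbTE; apply: contra_neq mn => /(congr1 tag).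
move: k; rewrite e => k; rewrite /vtx /mkedge eq_Tagged /= (bigD1 j) //= big1 ?addr0.
  by rewrite eq_Tagged /= xpair_eqE eqxx andbT.
by move=> r hr; rewrite eq_Tagged /= xpair_eqE (negbTE hr) andbF.
Qed.

Lemma sum_down_delta n m (k : 'I_(s m.+1)) (i : 'I_(s n)) (j : 'I_(s n.+1)) :
  \sum_(r < s m) ((mkedge r k == mkedge i j)%:R : C) = (vtx k == vtx j)%:R.
Proof.
have [e|mn] := eqVneq m n; last first.
  rewrite (_ : (vtx k == _) = false); last first.
    by apply/negbTE; apply: contra_neq mn => /(congr1 tag) /= [].
  rewrite big1 // => r _; rewrite (_ : (_ == _) = false) //.
  by apply/negbTE; apply: contra_neq mn => /(congr1 tag).
move: k; rewrite e => k; rewrite /vtx /mkedge eq_Tagged /= (bigD1 i) //= big1 ?addr0.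
  by rewrite eq_Tagged /= xpair_eqE eqxx.
by move=> r hr; rewrite eq_Tagged /= xpair_eqE (negbTE hr).
Qed.

Lemma sum_flux (f1 : efun) (c : forall n, 'I_(s n) -> C) n :
  \sum_(i < s n) \sum_(j < s n.+1) (f1 (mkedge i j) (l n) * c n.+1 j - f1 (mkedge i j) 0 * c n i) =
  \sum_(j < s n.+1) - flux_down l f1 j * c n.+1 j - \sum_(i < s n) flux_up f1 i * c n i.
Proof.
under eq_bigr do rewrite sumrB.
rewrite sumrB; congr (_ - _).
  rewrite exchange_big /=; apply: eq_bigr => j _.
  by rewrite -sumrN mulr_suml; apply: eq_bigr => i _; rewrite opprK.
by apply: eq_bigr => i _; rewrite /flux_up mulr_suml.
Qed.

(** Kirchhoff's condition cancels inflow and outflow at every sphere before S_N, and the root has no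
    inflow; only the flux out of S_N survives. *)
Lemma sum_flux_telescope (f1 : efun) (c : forall n, 'I_(s n) -> C) N :
  (forall n (i : 'I_(s n)), flux_down l f1 i + flux_up f1 i = 0) ->
  \sum_(0 <= n < N) \sum_(i < s n) \sum_(j < s n.+1)
     (f1 (mkedge i j) (l n) * c n.+1 j - f1 (mkedge i j) 0 * c n i) =
  \sum_(i < s N) flux_up f1 i * c N i.
Proof.
move=> K; elim: N => [|N IH].
  rewrite big_geq // big1 // => i _; have := K 0%N i.
  by rewrite /= add0r => ->; rewrite mul0r.
rewrite big_nat_recr //= IH sum_flux addrC subrK; apply: eq_bigr => j _.
by have /eqP := K N.+1 j; rewrite addrC addr_eq0 => /eqP ->.
Qed.

(** A representative of an element of the maximal domain on which vertex values and slopes make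
    sense; the operator sends it to -f2. *)
Definition hrep f f1 f2 : Prop := [/\ edgewise_W2 l f f1 f2, kirchhoff l f f1, L2 l f & L2 l f2].

Lemma edgewise_eL2 f f1 f2 : edgewise_W2 l f f1 f2 -> [/\ eL2 l f, eL2 l f1 & eL2 l f2].
Proof.
move=> h; split=> e; have [h1 h2] := h e; have le0 := ltW (elen_gt0 l_gt0 e).
- exact: W1_cL2 h1.
- exact: W1_cL2 h2.
- exact: W1_cL2' h2.
Qed.

Lemma linp_green f f1 f2 g g1 g2 n : edgewise_W2 l f f1 f2 -> edgewise_W2 l g g1 g2 ->
  linp l f2 g n - linp l f g2 n = \sum_(i < s n) \sum_(j < s n.+1)
   ((f1 (mkedge i j) (l n) * conjc (g (mkedge i j) (l n)) - f (mkedge i j) (l n) * conjc (g1 (mkedge i j) (l n))) -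
    (f1 (mkedge i j) 0 * conjc (g (mkedge i j) 0) - f (mkedge i j) 0 * conjc (g1 (mkedge i j) 0))).
Proof.
move=> hf hg; rewrite /linp -sumrB; apply: eq_bigr => i _; rewrite -sumrB; apply: eq_bigr => j _.
exact: (green_ip (ltW (l_gt0 n)) (hf (mkedge i j)) (hg (mkedge i j))).
Qed.

Lemma flux_upJ (f1 : efun) n (i : 'I_(s n)) : flux_up (fun e x => conjc (f1 e x)) i = conjc (flux_up f1 i).
Proof. by rewrite /flux_up (big_morph conjc (@conjcD R) (@conjc0 R)). Qed.

Lemma flux_downJ (f1 : efun) n (i : 'I_(s n)) : flux_down l (fun e x => conjc (f1 e x)) i = conjc (flux_down l f1 i).
Proof.
have z := @conjc0 R.
case: n i => [|n] i /=; first by apply: complexP; rewrite /= ?oppr0.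
by rewrite (big_morph conjc (@conjcD R) z); apply: eq_bigr => k _; rewrite conjcN.
Qed.

(** The telescoping sum is used twice: for the flux of f against the vertex values of g, and with
    the roles exchanged. *)
Lemma green_layers f f1 f2 g g1 g2 (cf cg : forall n, 'I_(s n) -> C) N :
  edgewise_W2 l f f1 f2 -> edgewise_W2 l g g1 g2 ->
  (forall n (i : 'I_(s n)), flux_down l f1 i + flux_up f1 i = 0) ->
  (forall n (i : 'I_(s n)), flux_down l g1 i + flux_up g1 i = 0) ->
  (forall n (i : 'I_(s n)) (j : 'I_(s n.+1)), f (mkedge i j) 0 = cf n i /\ f (mkedge i j) (l n) = cf n.+1 j) ->
  (forall n (i : 'I_(s n)) (j : 'I_(s n.+1)), g (mkedge i j) 0 = cg n i /\ g (mkedge i j) (l n) = cg n.+1 j) ->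
  inner_upto l f2 g N - inner_upto l f g2 N =
  \sum_(i < s N) flux_up f1 i * conjc (cg N i) - \sum_(i < s N) conjc (flux_up g1 i) * cf N i.
Proof.
move=> hf hg Kf Kg ef eg; rewrite !inner_uptoE -sumrB.
have z := @conjc0 R.
have Kg' n (i : 'I_(s n)) : flux_down l (fun e x => conjc (g1 e x)) i + flux_up (fun e x => conjc (g1 e x)) i = 0.
  by rewrite flux_upJ flux_downJ -conjcD Kg z.
rewrite -(sum_flux_telescope (fun n i => conjc (cg n i)) N Kf).
under [X in _ = _ - X]eq_bigr do rewrite -flux_upJ.
rewrite -(sum_flux_telescope cf N Kg') -sumrB; apply: eq_bigr => n _.
rewrite (linp_green n hf hg) -sumrB; apply: eq_bigr => i _; rewrite -sumrB; apply: eq_bigr => j _.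
have [-> ->] := ef n i j; have [-> ->] := eg n i j; ring.
Qed.

Lemma fin_supp_deriv f f1 f2 N : edgewise_W2 l f f1 f2 ->
  (forall e, (N <= tag e)%N -> forall x : R, 0 <= x <= elen l e -> f e x = 0) ->
  forall e, (N <= tag e)%N -> forall x : R, 0 <= x <= elen l e -> f1 e x = 0.
Proof. by move=> h z e hN; apply: (W2_eq0 (elen_gt0 l_gt0 e) (h e)); exact: z. Qed.

Lemma sym_fin f f1 f2 g g1 g2 : (forall n, (1 <= s n)%N) -> hrep f f1 f2 -> hrep g g1 g2 ->
  finitely_supported l f -> inner l f2 g = inner l f g2.
Proof.
move=> s1 [Wf [[cf ef] Kf] Lf Lf2] [Wg [[cg eg] Kg] Lg Lg2] [N hN].
have hN1 := fin_supp_deriv Wf hN.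
apply: (ccv_uniq (inner_ccv Lf2 Lg)).
apply: (ccv_near (N := N) _ (inner_ccv Lf Lg2)) => n Nn.
apply/eqP; rewrite eq_sym -subr_eq0; apply/eqP; rewrite (green_layers n Wf Wg Kf Kg ef eg).
rewrite !big1 ?subrr // => i _.
- have [<- _] := ef n i (Ordinal (s1 n.+1)).
  by rewrite hN ?mulr0 //= lexx ltW // l_gt0.
- rewrite /flux_up big1 ?mul0r // => j _.
  by apply: hN1 => //=; rewrite lexx ltW // l_gt0.
Qed.

End Operators.

(** * The adjoint of the minimal operator *)

Section MaximalOperator.
Context {R : realType}.
Variables (s : nat -> nat) (l : nat -> R).
Hypothesis l_gt0 : forall n, 0 < l n.
Hypothesis s_ge1 : forall n, (1 <= s n)%N.
Notation mu := (@lebesgue_measure R).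
Notation C := R[i].
Notation Re := complex.Re.
Notation Im := complex.Im.
Notation normc := ComplexField.Normc.normc.
Local Notation efun := (efun R s).
Implicit Types (e : edge s) (f g h u v : efun) (a b c z w : C) (M eps t : R) (p q : efun * efun).

(* The Kirchhoff Laplacian without support condition; it turns out to be the adjoint of [H0]. *)
Definition Hmax : set (efun * efun) := [set p | [/\ L2 l p.1, L2 l p.2 &
  exists f f1 f2, [/\ edgewise_W2 l f f1 f2, kirchhoff l f f1, aeq l p.1 f & aeq l p.2 (fun e x => - f2 e x)]]].

Lemma eL2N f : eL2 l f -> eL2 l (fun e x => - f e x).
Proof.
move=> h e; have := cL2_lin (-1) 0 (h e) (h e); apply: eq_cL2 => x _.
by rewrite mulN1r mul0r addr0.
Qed.

Lemma lcN f : (fun e x => - f e x) = lc (-1) f 0 f.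
Proof. by apply: efun_ext => e x; rewrite /lc mulN1r mul0r addr0. Qed.

Lemma HmaxE p : Hmax p -> exists f f1 f2, [/\ hrep l f f1 f2, aeq l p.1 f & aeq l p.2 (lc (-1) f2 0 f2)].
Proof.
move=> [h1 h2 [f [f1 [f2 [W K e1 e2]]]]]; exists f, f1, f2.
have [c0 _ c2] := edgewise_eL2 l_gt0 W.
have [L0 _] := aeq_sqn h1 c0 e1.
have [L2' _] := aeq_sqn h2 (eL2N c2) e2.
suff h3 : L2 l f2 by rewrite -lcN; split; [split|exact: e1|exact: e2].
have -> : f2 = lc (-1) (fun e x => - f2 e x) 0 f2.
  by apply: efun_ext => e x; rewrite /lc mul0r addr0 mulN1r opprK.
have h0 := L2_lc (-1) 0 L2' (@L2_0 R s l l_gt0).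
have -> : lc (-1) (fun e x => - f2 e x) 0 f2 = lc (-1) (fun e x => - f2 e x) 0 (fun _ _ => 0).
  by apply: efun_ext => e x; rewrite /lc !mul0r.
exact: h0.
Qed.

Lemma Hmax_hrep f f1 f2 : hrep l f f1 f2 -> Hmax (f, lc (-1) f2 0 f2).
Proof.
move=> [W K h h2]; split; [exact: h|exact: L2_lc|].
by exists f, f1, f2; split; [exact: W|exact: K|exact: aeq_refl|rewrite lcN; exact: aeq_refl].
Qed.

Lemma H0_Hmax : H0 l `<=` Hmax.
Proof.
move=> p [h1 [f [f1 [f2 [e1 W fs K [h2 e2]]]]]]; split => //.
by exists f, f1, f2.
Qed.

Lemma inner_scale a f g : L2 l f -> L2 l g -> inner l (lc a f 0 f) g = a * inner l f g.
Proof. by move=> hf hg; rewrite (inner_lcl a 0 hf hf hg) mul0r addr0. Qed.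

Lemma inner_scaler a f g : L2 l f -> L2 l g -> inner l g (lc a f 0 f) = conjc a * inner l g f.
Proof. by move=> hf hg; rewrite (inner_lcr a 0 hf hf hg) conjc0 mul0r addr0. Qed.

Lemma H0_sym p q : H0 l p -> Hmax q -> inner l p.2 q.1 = inner l p.1 q.2.
Proof.
move=> [h1 [f [f1 [f2 [e1 W fs K [h2 e2]]]]]] Hq; have [g1 g2 _] := Hq.
have [g [g' [g'' [hg e3 e4]]]] := HmaxE Hq.
have hf : Hmax p by split => //; exists f, f1, f2.
have [c0 _ c2] := edgewise_eL2 l_gt0 W.
have [Lf _] := aeq_sqn h1 c0 e1.
have Lf2 : L2 l f2.
  have [L _] := aeq_sqn h2 (eL2N c2) e2; rewrite lcN in L.
  have := L2_lc (-1) 0 L L; congr (L2 l _); apply: efun_ext => e x; rewrite /lc; ring.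
have hh : hrep l f f1 f2 by split.
have [_ _ Lg Lg2] := hg.
have Lmf2 := L2_lc (-1) 0 Lf2 Lf2; have Lmg2 := L2_lc (-1) 0 Lg2 Lg2.
rewrite lcN in e2.
rewrite (inner_aeql h2 Lmf2 g1 e2) (inner_aeqr g1 Lg Lmf2 e3).
rewrite (inner_aeql h1 Lf g2 e1) (inner_aeqr g2 Lmg2 Lf e4).
rewrite (inner_scale (-1) Lf2 Lg) (inner_scaler (-1) Lg2 Lf) conjcN1 (sym_fin l_gt0 s_ge1 hh hg fs).
exact: erefl.
Qed.

Lemma fin_L2 f N : eL2 l f -> (forall e, (N <= tag e)%N -> forall x : R, 0 <= x <= elen l e -> f e x = 0) -> L2 l f.
Proof.
move=> hf z; apply/L2P => //; split => //.
have zl n : (N <= n)%N -> lnrm l f n = 0.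
  move=> Nn; rewrite /lnrm big1 // => i _; rewrite big1 // => j _.
  rewrite /nrm (@eq_Rint _ _ _ (fun=> 0)); last first.
    by move=> x hx; rewrite (z (mkedge i j)) // normc2 /= expr0n addr0.
  rewrite Rintegral_cst //; exact: mul0r.
exists (\sum_(0 <= n < N) lnrm l f n) => M.
have [MN|NM] := leqP M N.
  rewrite [leRHS](big_cat_nat (leq0n M) MN) /= lerDl; apply: sumr_ge0 => *; exact: lnrm_ge0.
rewrite (big_cat_nat (leq0n N) (ltnW NM)) /= [X in _ + X](_ : _ = 0) ?addr0 //.
by rewrite big_nat_cond big1 // => n /andP[/andP[h _] _]; exact: zl.
Qed.

(** Hermite interpolation on each of the finitely many edges before S_N, and zero beyond. *)
Lemma test_functions (A A' B B' : edge s -> C) N :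
  (forall e, (N <= tag e)%N -> [/\ A e = 0, A' e = 0, B e = 0 & B' e = 0]) ->
  exists f f1 f2 : efun, [/\ edgewise_W2 l f f1 f2,
    forall e, [/\ f e 0 = A e, f1 e 0 = A' e, f e (elen l e) = B e & f1 e (elen l e) = B' e] &
    forall e, (N <= tag e)%N -> forall x, [/\ f e x = 0, f1 e x = 0 & f2 e x = 0]].
Proof.
move=> z.
have H e : exists q : (R -> C) * (R -> C) * (R -> C), [/\ W2 (elen l e) q.1.1 q.1.2 q.2,
    [/\ q.1.1 0 = A e, q.1.2 0 = A' e, q.1.1 (elen l e) = B e & q.1.2 (elen l e) = B' e] &
    (N <= tag e)%N -> forall x, [/\ q.1.1 x = 0, q.1.2 x = 0 & q.2 x = 0]].
  have [Nt|tN] := leqP N (tag e).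
    exists (fun=> 0, fun=> 0, fun=> 0); have [-> -> -> ->] := z e Nt; split => //.
    by split; apply: W1_cst; exact/ltW/elen_gt0.
  have [p [p1 [p2 [W E]]]] := hermite (A e) (A' e) (B e) (B' e) (elen_gt0 l_gt0 e).
  by exists (p, p1, p2).
have [F hF] := choice H.
exists (fun e => (F e).1.1), (fun e => (F e).1.2), (fun e => (F e).2); split.
- by move=> e; have [] := hF e.
- by move=> e; have [] := hF e.
- by move=> e; have [] := hF e.
Qed.

Lemma inner_fin f g N : L2 l f -> L2 l g -> (forall e, (N <= tag e)%N -> forall x : R, f e x = 0) ->
  inner l f g = inner_upto l f g N.
Proof.
move=> hf hg z; apply: (ccv_uniq (inner_ccv hf hg)).
have E n : (N <= n)%N -> inner_upto l f g N = inner_upto l f g n.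
  move=> Nn; rewrite !inner_uptoE [RHS](big_cat_nat (leq0n N) Nn) /=.
  rewrite [X in _ + X]big_nat_cond [X in _ + X]big1 ?addr0 // => k /andP[/andP[Nk _] _].
  rewrite /linp big1 // => i _; rewrite big1 // => j _.
  rewrite /ip (@eq_cint _ _ _ (fun x => 0 * f (mkedge i j) x)); last first.
    by move=> x _; rewrite (z (mkedge i j)) // !mul0r.
  by rewrite cintZ ?mul0r //; apply: cL2_cintg; exact: (L2_eL2 hf (mkedge i j)).
apply: (ccv_near (N := N) E).
by split; exact: cvg_cst.
Qed.

(** Functions supported on one edge with zero data at its ends satisfy all vertex conditions, so
    every edge can be tested separately. *)
Lemma adjoint_edge p e : adjoint l (H0 l) p -> exists f f1 : R -> C, W2 (elen l e) f f1 (fun x => - p.2 e x) /\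
  {ae mu, forall x, 0 <= x <= elen l e -> p.1 e x = f x}.
Proof.
move=> [h1 h2 adj]; have e1 := L2_eL2 h1 e; have e2 := L2_eL2 h2 e.
have le0 := ltW (elen_gt0 l_gt0 e).
have e2' : cL2 (elen l e) (fun x => - p.2 e x).
  by have := eL2N (L2_eL2 h2) e.
apply: (weak_W2 (elen_gt0 l_gt0 e) e1 e2') => q q1 q2 [W W'] z0 zl z10 z1l.
pose ext (r : R -> C) : efun := fun e' x => if e' == e then r x else 0.
have ext0 r e' : (tag e < tag e')%N -> forall x : R, ext r e' x = 0.
  by move=> h x; rewrite /ext; case: eqP => // E; move: h; rewrite E ltnn.
have extW : edgewise_W2 l (ext q) (ext q1) (ext q2).
  move=> e'; have [->|ne] := eqVneq e' e.
    by split; [apply: eq_W1 W|apply: eq_W1 W'] => // x _; rewrite /ext eqxx.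
  have l' := ltW (elen_gt0 l_gt0 e').
  by split; apply: eq_W1 (W1_cst 0 l') => // x _; rewrite /ext (negbTE ne).
have [c0 _ c2] := edgewise_eL2 l_gt0 extW.
have L0 : L2 l (ext q) by apply: (@fin_L2 _ (tag e).+1) => // e' h x _; exact: ext0.
have L2' : L2 l (ext q2) by apply: (@fin_L2 _ (tag e).+1) => // e' h x _; exact: ext0.
have LN := L2_lc (-1) 0 L2' L2'.
have zz e' : ext q e' 0 = 0 /\ ext q e' (elen l e') = 0 /\ ext q1 e' 0 = 0 /\ ext q1 e' (elen l e') = 0.
  by rewrite /ext; have [->|ne] := eqVneq e' e.
have K : kirchhoff l (ext q) (ext q1).
  split.
    exists (fun _ _ => 0) => n i j; have [a [b _]] := zz (mkedge i j); by split.
  move=> n i; have -> : flux_up (ext q1) i = 0.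
    by rewrite /flux_up big1 // => j _; have [_ [_ []]] := zz (mkedge i j).
  case: n i => [|n] i /=; rewrite addr0 // big1 // => k _.
  by have [_ [_ [_]]] := zz (mkedge k i); rewrite /elen /= => ->; rewrite oppr0.
have hH : H0 l (ext q, lc (-1) (ext q2) 0 (ext q2)).
  split => //; exists (ext q), (ext q1), (ext q2); split => //.
  - exact: aeq_refl.
  - by exists (tag e).+1 => e' h x _; exact: ext0.
  - by split => //; rewrite lcN; exact: aeq_refl.
have := adj _ hH; rewrite /= inner_scale // (inner_fin L2' h1 (ext0 q2)) (inner_fin L0 h2 (ext0 q)).
have U r v : inner_upto l (ext r) v (tag e).+1 = ip (elen l e) r (v e).
  rewrite inner_uptoE.
  transitivity (\sum_(0 <= n < (tag e).+1) \sum_(i < s n) \sum_(j < s n.+1)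
     ((fun e' => ip (elen l e') (ext r e') (v e')) (mkedge i j))); first by [].
  rewrite (sum_edge_delta (F := fun e' => ip (elen l e') (ext r e') (v e')) (e0 := e)) //.
    by apply: eq_cint => x _; rewrite /ext eqxx.
  move=> e' ne; rewrite /ip (@eq_cint _ _ _ (fun x => 0 * 0)).
    by rewrite cintZ ?mul0r //; apply: cL2_cintg; apply: W1_cL2 (W1_cst 0 _); exact/ltW/elen_gt0.
  by move=> x _; rewrite /ext (negbTE ne) !mul0r.
rewrite !U => E.
have -> : ip (elen l e) q (fun x => - p.2 e x) = - ip (elen l e) q (p.2 e).
  rewrite /ip -cintN; last by apply: cL2_mul; [exact: W1_cL2 W|exact: cL2_conj].
  by apply: eq_cint => x _; rewrite conjcN mulrN.
by rewrite -E mulN1r opprK.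
Qed.

(** For a test function with end data [A], [A'], [B], [B'], the adjoint relation cancels the edge
    integrals in Green's formula and leaves the boundary terms. The conditions on the data are
    continuity and Kirchhoff's condition for the test function. *)
Lemma adjoint_boundary p f f1 : adjoint l (H0 l) p ->
  (forall e, W2 (elen l e) (f e) (f1 e) (fun x => - p.2 e x)) -> aeq l p.1 f ->
  forall (A A' B B' : edge s -> C) (c : forall n, 'I_(s n) -> C) N,
  (forall e, (N <= tag e)%N -> [/\ A e = 0, A' e = 0, B e = 0 & B' e = 0]) ->
  (forall n (i : 'I_(s n)) (j : 'I_(s n.+1)), A (mkedge i j) = c n i /\ B (mkedge i j) = c n.+1 j) ->
  (forall i : 'I_(s 0), \sum_(j < s 1) A' (mkedge i j) = 0) ->
  (forall n (i : 'I_(s n.+1)), \sum_(k < s n) B' (mkedge k i) = \sum_(j < s n.+2) A' (mkedge i j)) ->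
  \sum_(0 <= n < N) \sum_(i < s n) \sum_(j < s n.+1)
    ((f1 (mkedge i j) (l n) * conjc (B (mkedge i j)) - f (mkedge i j) (l n) * conjc (B' (mkedge i j))) -
     (f1 (mkedge i j) 0 * conjc (A (mkedge i j)) - f (mkedge i j) 0 * conjc (A' (mkedge i j)))) = 0.
Proof.
move=> [h1 h2 adj] Wf ef A A' B B' c N z cc K0 K.
have [g [g1 [g2 [Wg bg zg]]]] := test_functions z.
have [c0 _ c2] := edgewise_eL2 l_gt0 Wg.
have L0 : L2 l g by apply: (@fin_L2 _ N) => // e' h x _; have [] := zg e' h x.
have L2' : L2 l g2 by apply: (@fin_L2 _ N) => // e' h x _; have [] := zg e' h x.
have LN := L2_lc (-1) 0 L2' L2'.
have bA n (i : 'I_(s n)) j : g1 (mkedge i j) 0 = A' (mkedge i j) by have [] := bg (mkedge i j).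
have bB n (i : 'I_(s n)) j : g1 (mkedge i j) (l n) = B' (mkedge i j) by have [_ _ _ <-] := bg (mkedge i j).
have Kg : kirchhoff l g g1.
  split.
    by exists c => n i j; have [<- <-] := cc n i j; have [] := bg (mkedge i j).
  move=> [|n] i /=.
    by rewrite add0r /flux_up -[RHS](K0 i); apply: eq_bigr => j _.
  rewrite sumrN; under eq_bigr do rewrite bB.
  rewrite K /flux_up; under [X in _ + X]eq_bigr do rewrite bA.
  by rewrite addNr.
have hH : H0 l (g, lc (-1) g2 0 g2).
  split => //; exists g, g1, g2; split => //.
  - exact: aeq_refl.
  - by exists N => e' h x _; have [] := zg e' h x.
  - by split => //; rewrite lcN; exact: aeq_refl.
have := adj _ hH; rewrite /= inner_scale //.
have ef2 : edgewise_W2 l f f1 (fun e x => - p.2 e x) by [].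
have [cf _ _] := edgewise_eL2 l_gt0 ef2.
have [Lf _] := aeq_sqn h1 cf ef.
rewrite (inner_aeqr h1 Lf L2' ef).
have L2N := L2_lc (-1) 0 h2 h2.
have E2 : inner l g p.2 = - inner l g (lc (-1) p.2 0 p.2) by rewrite inner_scaler // conjcN1 mulN1r opprK.
rewrite E2 mulN1r => /oppr_inj E.
have Z r r' : (forall e, (N <= tag e)%N -> forall x, [/\ r e x = 0, r' e x = 0 & g2 e x = 0]) -> forall e, (N <= tag e)%N -> forall x : R, r e x = 0.
  by move=> H e h x; have [] := H e h x.
rewrite (@inner_fin g2 f N) // in E; last by move=> e h x; have [] := zg e h x.
rewrite (@inner_fin g _ N) // in E; last by move=> e h x; have [] := zg e h x.
have G : \sum_(0 <= n < N) (linp l g2 f n - linp l g (fun e x => - p.2 e x) n) = 0.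
  by rewrite sumrB -!inner_uptoE E lcN subrr.
(* The test function occupies the first slot of [inner], so Green's formula yields the conjugate of
   the claim. *)
apply: (can_inj (@conjccK R)); rewrite conjc0.
apply: etrans (etrans (congr1 -%R G) (oppr0 _)).
rewrite (big_morph conjc (@conjcD R) (@conjc0 R)) -sumrN; apply: eq_bigr => n _.
rewrite (linp_green l_gt0 n Wg ef2) (big_morph conjc (@conjcD R) (@conjc0 R)) -sumrN; apply: eq_bigr => i _.
rewrite (big_morph conjc (@conjcD R) (@conjc0 R)) -sumrN; apply: eq_bigr => j _.
have [-> -> b3 b4] := bg (mkedge i j).
rewrite /elen /= in b3 b4; rewrite b3 b4.
move: (f _ _) (f1 _ _) (f _ _) (f1 _ _) (A _) (A' _) (B _) (B' _) => x1 x2 x3 x4 x5 x6 x7 x8.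
by rewrite !(conjcD, conjcN, conjcM, conjccK); ring.
Qed.

Lemma conjcIndic (x : bool) : conjc (x%:R : C) = x%:R. Proof. exact: conjc_nat. Qed.

Lemma adjoint_H0 : adjoint l (H0 l) = Hmax.
Proof.
apply/seteqP; split; last first.
  move=> p Hp; have [h1 h2 _] := Hp; split; [exact: h1|exact: h2|move=> q Hq; exact: H0_sym].
move=> p adj; have [h1 h2 _] := adj.
have H e : exists q : (R -> C) * (R -> C), W2 (elen l e) q.1 q.2 (fun x => - p.2 e x) /\
    {ae mu, forall x, 0 <= x <= elen l e -> p.1 e x = q.1 x}.
  by have [f [f1 [W E]]] := adjoint_edge e adj; exists (f, f1).
have [F hF] := choice H.
pose f : efun := fun e => (F e).1; pose f1 : efun := fun e => (F e).2.
have Wf e : W2 (elen l e) (f e) (f1 e) (fun x => - p.2 e x) by have [] := hF e.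
have ef : aeq l p.1 f by move=> e; have [] := hF e.
have P := adjoint_boundary adj Wf ef.
split => //; exists f, f1, (fun e x => - p.2 e x); split => //; last first.
  by move=> e; apply: nearW => x _; rewrite opprK.
have k0 n : 'I_(s n) by exists 0%N; exact: s_ge1.
pose dl (e e' : edge s) : C := (e == e')%:R.
have dl0 e e' N : (tag e' < N)%N -> (N <= tag e)%N -> dl e e' = 0.
  move=> h1' h2'; rewrite /dl; case: eqP => // E; move: h1'; rewrite -E ltnNge h2' //.
have SD e0 N (X : edge s -> C) : (tag e0 < N)%N ->
    \sum_(0 <= n < N) \sum_(i < s n) \sum_(j < s n.+1) X (mkedge i j) * dl (mkedge i j) e0 = X e0.
  move=> hN; rewrite (sum_edge_delta (F := fun e => X e * dl e e0) (e0 := e0)) //.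
    by rewrite /dl eqxx mulr1.
  by move=> e ne; rewrite /dl (negbTE ne) mulr0.
have dlJ e e' : conjc (dl e e') = dl e e' by exact: conjcIndic.
(* Opposite slopes on two edges leaving the same vertex have zero total flux and compare the two
   initial values. *)
have up n (i : 'I_(s n)) (j j' : 'I_(s n.+1)) : f (mkedge i j) 0 = f (mkedge i j') 0.
  have Q := P (fun=> 0) (fun e => dl e (mkedge i j) - dl e (mkedge i j')) (fun=> 0) (fun=> 0) (fun _ _ => 0) n.+1.
  have {}Q : \sum_(0 <= m < n.+1) \sum_(i0 < s m) \sum_(j0 < s m.+1)
      (f (mkedge i0 j0) 0 * dl (mkedge i0 j0) (mkedge i j) - f (mkedge i0 j0) 0 * dl (mkedge i0 j0) (mkedge i j')) = 0.
    rewrite -[RHS]Q.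
    - apply: eq_bigr => m _; apply: eq_bigr => i0 _; apply: eq_bigr => j0 _.
      by rewrite conjc0 conjcD conjcN !dlJ; ring.
    - by move=> e he; split => //; rewrite !(dl0 _ _ n.+1) ?subrr.
    - by [].
    - by move=> i0; rewrite sumrB /dl !sum_up_delta subrr.
    - by move=> m i0; rewrite sumrB /dl !sum_up_delta subrr big1.
  move: Q; under eq_bigr do under eq_bigr do rewrite sumrB.
  under eq_bigr do rewrite sumrB.
  rewrite sumrB (SD (mkedge i j) n.+1 (fun e => f e 0)) // (SD (mkedge i j') n.+1 (fun e => f e 0)) //.
  exact: subr0_eq.
(* Unit slopes on an edge entering j and on an edge leaving j balance each other and compare the
   values of f at j along these edges. *)
have down n (i : 'I_(s n)) (j : 'I_(s n.+1)) (k : 'I_(s n.+2)) : f (mkedge i j) (l n) = f (mkedge j k) 0.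
  have Q := P (fun=> 0) (fun e => dl e (mkedge j k)) (fun=> 0) (fun e => dl e (mkedge i j)) (fun _ _ => 0) n.+2.
  have {}Q : \sum_(0 <= m < n.+2) \sum_(i0 < s m) \sum_(j0 < s m.+1)
      (f (mkedge i0 j0) 0 * dl (mkedge i0 j0) (mkedge j k) - f (mkedge i0 j0) (l m) * dl (mkedge i0 j0) (mkedge i j)) = 0.
    rewrite -[RHS]Q.
    - apply: eq_bigr => m _; apply: eq_bigr => i0 _; apply: eq_bigr => j0 _.
      by rewrite conjc0 !dlJ; ring.
    - by move=> e he; split => //; rewrite (dl0 _ _ n.+2).
    - by [].
    - move=> i0; by rewrite /dl sum_up_delta (_ : (vtx i0 == vtx j) = false).
    - by move=> m i0; rewrite /dl sum_up_delta sum_down_delta.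
  move: Q; under eq_bigr do under eq_bigr do rewrite sumrB.
  under eq_bigr do rewrite sumrB.
  rewrite sumrB (SD (mkedge j k) n.+2 (fun e => f e 0)) // (SD (mkedge i j) n.+2 (fun e => f e (l (tag e)))) //.
  by move/subr0_eq.
split.
  exists (fun n i => f (mkedge i (k0 n.+1)) 0) => n i j; split; [exact: up|exact: down].
move=> n i.
(* A test function equal to 1 at the vertex i and 0 at all others, with zero slopes, isolates the
   flux at i. *)
pose c m (k : 'I_(s m)) : C := (vtx k == vtx i)%:R.
have c0 m (k : 'I_(s m)) : m != n -> c m k = 0.
  by move=> mn; rewrite /c (_ : (_ == _) = false) //; apply/negbTE; apply: contra_neq mn => /(congr1 tag).
have Q := P (fun e => c (tag e) (tagged e).1) (fun=> 0) (fun e => c (tag e).+1 (tagged e).2) (fun=> 0) c n.+1.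
have {}Q : \sum_(0 <= m < n.+1) \sum_(i0 < s m) \sum_(j0 < s m.+1)
      (f1 (mkedge i0 j0) (l m) * c m.+1 j0 - f1 (mkedge i0 j0) 0 * c m i0) = 0.
  rewrite -[RHS]Q.
  - apply: eq_bigr => m _; apply: eq_bigr => i0 _; apply: eq_bigr => j0 _.
    by rewrite conjc0 /= !conjcIndic; ring.
  - move=> e he; split => //; apply: c0; apply/eqP => E; move: he; rewrite -?E ?ltnn //.
    by rewrite leqNgt ltnS leqW // -E.
  - by [].
  - by move=> i0; rewrite big1.
  - by move=> m i0; rewrite !big1.
move: Q; under eq_bigr do rewrite sum_flux.
rewrite sumrB (sum_vertex_delta (fun m k => flux_up f1 k)) //.
have -> : \sum_(0 <= m < n.+1) \sum_(j < s m.+1) - flux_down l f1 j * c m.+1 j = - flux_down l f1 i.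
  rewrite -(sum_vertex_delta (fun m k => - flux_down l f1 k) i (leqW (ltnSn n))).
  rewrite [RHS]big_nat_recl //= [X in X + _]big1 ?add0r //.
  by move=> k _; rewrite oppr0 mul0r.
by move/eqP; rewrite -opprD oppr_eq0 => /eqP.
Qed.

End MaximalOperator.
Section RealBounds.
Context {R : realType}.

Lemma lt_sum_fifth (x y w eps : R) : 0 < eps -> x <= eps / 5 -> y < eps / 5 ->
  w <= 2 * (1 + 0) * x + 2 * (1 + 0) * y -> w < eps.
Proof. lra. Qed.

Lemma lt_weighted_sum (x y k a b : R) : 0 < k -> 0 <= a -> 0 <= b -> x < k -> y < k ->
  2 * a * x + 2 * b * y < k * (1 + 2 * a + 2 * b).
Proof. nra. Qed.

End RealBounds.

(** * The closure of the operator on finitely supported functions *)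

Section MinimalOperator.
Context {R : realType}.
Variables (s : nat -> nat) (l : nat -> R).
Hypothesis l_gt0 : forall n, 0 < l n.
Hypothesis s_ge1 : forall n, (1 <= s n)%N.
Notation mu := (@lebesgue_measure R).
Notation C := R[i].
Notation Re := complex.Re.
Notation Im := complex.Im.
Notation normc := ComplexField.Normc.normc.
Local Notation efun := (efun R s).
Implicit Types (e : edge s) (f g h u v : efun) (a b c z w : C) (M eps t : R) (p q : efun * efun).

Definition plc a p b q : efun * efun := (lc a p.1 b q.1, lc a p.2 b q.2).

Definition L2pair (A : set (efun * efun)) : Prop := forall p, A p -> L2 l p.1 /\ L2 l p.2.

Lemma H0_L2 : L2pair (H0 l).
Proof. by move=> p [h1 [f [f1 [f2 [_ _ _ _ [h2 _]]]]]]. Qed.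

Lemma lc_self f : L2 l f -> sqn l (lc 1 f (-1) f) = 0.
Proof. by move=> h; have [] := aeq_sqn h (L2_eL2 h) (@aeq_refl R s l f). Qed.

Lemma sqnorm_fsub f g eps : L2 l f -> L2 l g -> (sqnorm l (fsub f g) < eps%:E)%E = (sqn l (lc 1 f (-1) g) < eps).
Proof. by move=> hf hg; rewrite fsubE (sqnorm_sqn (L2_lc 1 (-1) hf hg)) lte_fin. Qed.

Lemma sub_closure (A : set (efun * efun)) : L2pair A -> A `<=` closure_op l A.
Proof.
move=> HA p Ap; have [h1 h2] := HA p Ap; split; [exact: h1|exact: h2|move=> eps e0].
by exists p; split; [exact: Ap| |]; rewrite sqnorm_fsub // lc_self.
Qed.

Lemma closureP (A : set (efun * efun)) p : L2pair A -> closure_op l A p <->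
  [/\ L2 l p.1, L2 l p.2 & forall eps, 0 < eps -> exists q, [/\ A q,
    sqn l (lc 1 p.1 (-1) q.1) < eps & sqn l (lc 1 p.2 (-1) q.2) < eps]].
Proof.
move=> HA; split.
- move=> [h1 h2 h]; split; [exact: h1|exact: h2|move=> eps e0].
  have [q [Aq n1 n2]] := h eps e0; have [q1 q2] := HA q Aq.
  by exists q; split; [exact: Aq|rewrite -sqnorm_fsub|rewrite -sqnorm_fsub].
- move=> [h1 h2 h]; split; [exact: h1|exact: h2|move=> eps e0].
  have [q [Aq n1 n2]] := h eps e0; have [q1 q2] := HA q Aq.
  by exists q; split; [exact: Aq|rewrite sqnorm_fsub|rewrite sqnorm_fsub].
Qed.

Lemma closure_inner (A : set (efun * efun)) u v p : L2pair A -> L2 l u -> L2 l v ->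
  (forall q, A q -> inner l u q.1 = inner l v q.2) -> closure_op l A p -> inner l u p.1 = inner l v p.2.
Proof.
move=> HA hu hv E [h1 h2 h]; apply: approx_inner => // eps e0.
have [q [Aq n1 n2]] := h eps e0; have [q1 q2] := HA q Aq.
by exists q; split; [exact: q1|exact: q2|exact: E|split].
Qed.

(** An adjoint relation survives limits in the graph norm, by continuity of the inner product. *)
Lemma adjoint_closure (A : set (efun * efun)) : L2pair A -> adjoint l (closure_op l A) = adjoint l A.
Proof.
move=> HA; apply/seteqP; split => w [h1 h2 h]; split; [exact: h1|exact: h2| |exact: h1|exact: h2|].
- by move=> q Aq; apply: h; exact: sub_closure.
- move=> q cq; have [q1 q2 _] := cq.
  have E : inner l w.2 q.1 = inner l w.1 q.2.
    apply: (closure_inner HA h2 h1 _ cq) => r Ar; have [r1 r2] := HA r Ar.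
    by rewrite (innerC r1 h2) (innerC r2 h1) (h r Ar).
  by rewrite (innerC h1 q2) (innerC h2 q1) E.
Qed.

(** The closure is closed. This also makes it stable under [aeq], since approximants at distance 0
    qualify. *)
Lemma closureK (A : set (efun * efun)) p : L2pair A -> L2 l p.1 -> L2 l p.2 ->
  (forall eps, 0 < eps -> exists q, [/\ closure_op l A q,
    sqn l (lc 1 p.1 (-1) q.1) <= eps & sqn l (lc 1 p.2 (-1) q.2) <= eps]) -> closure_op l A p.
Proof.
move=> HA h1 h2 H; apply/closureP => //; split; [exact: h1|exact: h2|move=> eps e0].
(* Twice eps / 5 plus twice eps / 5 stays below eps. *)
have e5 : 0 < eps / 5 by lra.
have [q [/(closureP _ HA)[q1 q2 hq] n1 n2]] := H _ e5.
have [r [Ar m1 m2]] := hq _ e5; have [r1 r2] := HA r Ar.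
have K f g h : L2 l f -> L2 l g -> L2 l h -> sqn l (lc 1 f (-1) g) <= eps / 5 -> sqn l (lc 1 g (-1) h) < eps / 5 ->
    sqn l (lc 1 f (-1) h) < eps.
  move=> hf hg hh k1 k2.
  have E : lc 1 f (-1) h = lc 1 (lc 1 f (-1) g) 1 (lc 1 g (-1) h) by apply: efun_ext => e x; rewrite /lc; ring.
  have := sqn_lc 1 1 (L2_lc 1 (-1) hf hg) (L2_lc 1 (-1) hg hh); rewrite -E normc2 /= expr1n expr0n /=.
  exact: (lt_sum_fifth e0).
exists r; split; [exact: Ar|exact: (K _ q.1)|exact: (K _ q.2)].
Qed.

Lemma kirchhoff_lc a b f f1 g g1 : kirchhoff l f f1 -> kirchhoff l g g1 -> kirchhoff l (lc a f b g) (lc a f1 b g1).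
Proof.
move=> [[cf ef] Kf] [[cg eg] Kg]; split.
  exists (fun n i => a * cf n i + b * cg n i) => n i j.
  by have [e1 e2] := ef n i j; have [e3 e4] := eg n i j; rewrite /lc e1 e2 e3 e4.
have U n (i : 'I_(s n)) : flux_up (lc a f1 b g1) i = a * flux_up f1 i + b * flux_up g1 i.
  by rewrite /flux_up /lc big_split /= -!mulr_sumr.
have D n (i : 'I_(s n)) : flux_down l (lc a f1 b g1) i = a * flux_down l f1 i + b * flux_down l g1 i.
  case: n i => [|n] i /=; first by rewrite !mulr0 addr0.
  by rewrite /lc !mulr_sumr -big_split /=; apply: eq_bigr => k _; ring.
move=> n i; rewrite U D.
have -> : a * flux_down l f1 i + b * flux_down l g1 i + (a * flux_up f1 i + b * flux_up g1 i) =
  a * (flux_down l f1 i + flux_up f1 i) + b * (flux_down l g1 i + flux_up g1 i) by ring.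
by rewrite Kf Kg !mulr0 addr0.
Qed.

Lemma edgewise_lc a b f f1 f2 g g1 g2 : edgewise_W2 l f f1 f2 -> edgewise_W2 l g g1 g2 ->
  edgewise_W2 l (lc a f b g) (lc a f1 b g1) (lc a f2 b g2).
Proof. by move=> hf hg e; apply: W2_lin => //; exact/ltW/elen_gt0. Qed.

Lemma hrep_lc a b f f1 f2 g g1 g2 : hrep l f f1 f2 -> hrep l g g1 g2 ->
  hrep l (lc a f b g) (lc a f1 b g1) (lc a f2 b g2).
Proof.
move=> [W K h1 h2] [W' K' h1' h2']; split; [exact: edgewise_lc|exact: kirchhoff_lc|exact: L2_lc|exact: L2_lc].
Qed.

Lemma H0_lc a b p q : H0 l p -> H0 l q -> H0 l (plc a p b q).
Proof.
move=> [h1 [f [f1 [f2 [e1 W [N fs] K [h2 e2]]]]]] [h1' [g [g1 [g2 [e1' W' [N' fs'] K' [h2' e2']]]]]].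
split; first exact: L2_lc.
exists (lc a f b g), (lc a f1 b g1), (lc a f2 b g2); split.
- exact: aeq_lc.
- exact: edgewise_lc.
- exists (maxn N N') => e; rewrite geq_max => /andP[n1 n2] x hx.
  by rewrite /lc fs // fs' // !mulr0 addr0.
- exact: kirchhoff_lc.
- split; first exact: L2_lc.
  apply: aeq_trans (aeq_lc a b e2 e2') _ => e; apply: nearW => x _; rewrite /lc; ring.
Qed.

Lemma closure_lc (A : set (efun * efun)) a b p q : L2pair A -> (forall p q, A p -> A q -> A (plc a p b q)) ->
  closure_op l A p -> closure_op l A q -> closure_op l A (plc a p b q).
Proof.
move=> HA Alc /(closureP _ HA)[p1 p2 hp] /(closureP _ HA)[q1 q2 hq]; apply/(closureP _ HA).
split; [exact: L2_lc|exact: L2_lc|move=> eps e0].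
(* The constants of [sqn_lc], with 1 added for the case a = b = 0. *)
pose K := 1 + 2 * normc a ^+ 2 + 2 * normc b ^+ 2.
have K0 : 0 < K by have := sqr_ge0 (normc a); have := sqr_ge0 (normc b); rewrite /K; lra.
have e1 : 0 < eps / K by exact: divr_gt0.
have [r [Ar r1 r2]] := hp _ e1; have [t [At t1 t2]] := hq _ e1.
have [lr1 lr2] := HA r Ar; have [lt1 lt2] := HA t At.
have B f f' g g' : L2 l f -> L2 l f' -> L2 l g -> L2 l g' -> sqn l (lc 1 f (-1) f') < eps / K ->
    sqn l (lc 1 g (-1) g') < eps / K -> sqn l (lc 1 (lc a f b g) (-1) (lc a f' b g')) < eps.
  move=> hf hf' hg hg' k1 k2.
  have E : lc 1 (lc a f b g) (-1) (lc a f' b g') = lc a (lc 1 f (-1) f') b (lc 1 g (-1) g').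
    by apply: efun_ext => e x; rewrite /lc; ring.
  rewrite E; apply: le_lt_trans (sqn_lc a b (L2_lc 1 (-1) hf hf') (L2_lc 1 (-1) hg hg')) _.
  have EK : eps = eps / K * K by rewrite divfK // gt_eqF.
  rewrite [ltRHS]EK; apply: lt_weighted_sum => //; exact: sqr_ge0.
exists (plc a r b t); split; [exact: Alc|exact: B|exact: B].
Qed.

Lemma Hmin_L2 : L2pair (Hmin s l).
Proof. by move=> p [h1 h2 _]. Qed.

Lemma Hmin_lc a b p q : Hmin s l p -> Hmin s l q -> Hmin s l (plc a p b q).
Proof. apply: closure_lc; [exact: H0_L2|move=> *; exact: H0_lc]. Qed.

Lemma adjoint_Hmin : adjoint l (Hmin s l) = @Hmax R s l.
Proof. by rewrite /Hmin adjoint_closure ?adjoint_H0 //; exact: H0_L2. Qed.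

Lemma Hmin_Hmax : Hmin s l `<=` @Hmax R s l.
Proof.
move=> p Hp; have [p1 p2 _] := Hp; rewrite -(adjoint_H0 l_gt0 s_ge1); split; [exact: p1|exact: p2|move=> q Hq].
have [q1 q2] := H0_L2 Hq.
apply: (closure_inner H0_L2 q2 q1 _ Hp) => r Hr.
by apply: (H0_sym l_gt0 s_ge1 Hq); exact: H0_Hmax.
Qed.

Lemma H0_dense : densely_defined l (@H0 R s l).
Proof.
move=> f hf eps e0.
have e2 : 0 < eps / 3 by lra.
have [N tail] := sqn_tail hf e2.
(* [K] counts the edges of the first N layers, each of which is allotted an equal share of the
   error. *)
pose K : nat := \sum_(0 <= n < N) s n * s n.+1.
have d0 : 0 < eps / 3 / K.+1%:R by rewrite divr_gt0.
have H e : exists q : (R -> C) * (R -> C) * (R -> C), [/\ W2 (elen l e) q.1.1 q.1.2 q.2,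
    [/\ q.1.1 0 = 0, q.1.1 (elen l e) = 0, q.1.2 0 = 0 & q.1.2 (elen l e) = 0],
    (tag e < N)%N -> nrm (elen l e) (fun x => f e x - q.1.1 x) < eps / 3 / K.+1%:R &
    (N <= tag e)%N -> forall x, q.1.1 x = 0 /\ q.2 x = 0].
  have [Nt|tN] := leqP N (tag e).
    exists (fun=> 0, fun=> 0, fun=> 0); split => //.
    by split; apply: W1_cst; exact/ltW/elen_gt0.
  have [q [q1 [q2 [W E n]]]] := density (elen_gt0 l_gt0 e) (L2_eL2 hf e) d0.
  by exists (q, q1, q2).
have [F hF] := choice H.
pose g : efun := fun e => (F e).1.1; pose g1 : efun := fun e => (F e).1.2; pose g2 : efun := fun e => (F e).2.
have W : edgewise_W2 l g g1 g2 by move=> e; have [] := hF e.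
have [c0 _ c2] := edgewise_eL2 l_gt0 W.
have z e : (N <= tag e)%N -> forall x, g e x = 0 /\ g2 e x = 0 by have [] := hF e.
have zb e : [/\ g e 0 = 0, g e (elen l e) = 0, g1 e 0 = 0 & g1 e (elen l e) = 0] by have [] := hF e.
have Lg : L2 l g by apply: (fin_L2 (N := N)) => // e h x _; have [] := z e h x.
have Lg2 : L2 l g2 by apply: (fin_L2 (N := N)) => // e h x _; have [] := z e h x.
have K0 : kirchhoff l g g1.
  split.
    by exists (fun _ _ => 0) => n i j; have [a [b _]] := zb (mkedge i j); split.
  move=> n i; have -> : flux_up g1 i = 0.
    by rewrite /flux_up big1 // => j _; have [_ _ ] := zb (mkedge i j).
  case: n i => [|n] i /=; rewrite addr0 // big1 // => k _.
  by have [_ _ _] := zb (mkedge k i); rewrite /elen /= => ->; rewrite oppr0.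
exists (g, lc (-1) g2 0 g2); split.
  split; first exact: Lg.
  exists g, g1, g2; split; [exact: aeq_refl|exact: W| |exact: K0|].
  - by exists N => e h x _; have [] := z e h x.
  - by split; [exact: L2_lc|rewrite lcN; exact: aeq_refl].
rewrite sqnorm_fsub //=; apply: (@le_lt_trans _ _ (eps / 3 + eps / 3)); last lra.
have L1 n : (n < N)%N -> lnrm l (lc 1 f (-1) g) n <= (s n * s n.+1)%N%:R * (eps / 3 / K.+1%:R).
  move=> nN; rewrite /lnrm; apply: (@le_trans _ _ (\sum_(i < s n) \sum_(j < s n.+1) (eps / 3 / K.+1%:R))).
    apply: ler_sum => i _; apply: ler_sum => j _.
    have [_ _ h _] := hF (mkedge i j); have := ltW (h nN).
    rewrite (@eq_nrm _ _ _ (lc 1 f (-1) g (mkedge i j))) // => x _.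
    by rewrite /lc mul1r mulN1r.
  by rewrite !sumr_const !card_ord -mulrnA (mulnC (s n.+1)) mulr_natl.
have L2' n : (N <= n)%N -> lnrm l (lc 1 f (-1) g) n = lnrm l f n.
  move=> Nn; rewrite /lnrm; apply: eq_bigr => i _; apply: eq_bigr => j _; apply: eq_nrm => x _.
  by have [h _] := z (mkedge i j) Nn x; rewrite /lc h mul1r mulr0 addr0.
have S1 : \sum_(0 <= n < N) lnrm l (lc 1 f (-1) g) n <= eps / 3.
  apply: (@le_trans _ _ (\sum_(0 <= n < N) (s n * s n.+1)%N%:R * (eps / 3 / K.+1%:R))).
    by rewrite [leLHS]big_nat_cond [leRHS]big_nat_cond; apply: ler_sum => n /andP[/andP[_ h] _]; exact: L1.
  rewrite -mulr_suml -natr_sum -/K mulrCA; apply: ler_piMr; first exact: (ltW e2).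
  by rewrite ler_pdivrMr ?ltr0n // mul1r ler_nat leqnSn.
apply: sqn_le => M; have [MN|NM] := leqP M N.
  apply: (@le_trans _ _ (eps / 3)); last lra.
  apply: le_trans S1; rewrite [leRHS](big_cat_nat (leq0n M) MN) /= lerDl; apply: sumr_ge0 => *; exact: lnrm_ge0.
rewrite (big_cat_nat (leq0n N) (ltnW NM)) /=; apply: lerD => //.
apply: le_trans (tail N M (leqnn N)); rewrite [leLHS]big_nat_cond [leRHS]big_nat_cond.
by apply: ler_sum => n /andP[/andP[h _] _]; rewrite L2'.
Qed.

Lemma dense_sub (A B : set (efun * efun)) : A `<=` B -> densely_defined l A -> densely_defined l B.
Proof.
move=> AB h f hf eps e0; have [q [Aq n]] := h f hf eps e0.
by exists q; split; [exact: AB|exact: n].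
Qed.

Lemma Hmin_dense : densely_defined l (Hmin s l).
Proof. by apply: dense_sub H0_dense; apply: sub_closure; exact: H0_L2. Qed.

End MinimalOperator.

(** * Radial profiles *)

Section Averages.
Context {R : realType}.
Notation C := R[i].
Notation Re := complex.Re.
Notation Im := complex.Im.
Notation normc := ComplexField.Normc.normc.
Implicit Types (x l : R) (K : nat).

Lemma sqr_sum_step (k S Q y : R) : 0 <= k -> 0 <= Q -> S ^+ 2 <= k * Q ->
  (S + y) ^+ 2 <= (k + 1) * (Q + y ^+ 2).
Proof.
move=> k0 Q0 h; suff : 2 * S * y <= Q + k * y ^+ 2 by nra.
have [k1|k1] := ltP 0 k.
  by rewrite -(ler_pM2l k1); have := sqr_ge0 (S - k * y); nra.
have kE : k = 0 by lra.
have S0 : S = 0 by apply/eqP; rewrite -sqrf_eq0 eq_le sqr_ge0 andbT; move: h; rewrite kE mul0r.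
by rewrite S0 kE; lra.
Qed.

Lemma sqr_sum_le K (x : 'I_K -> R) : (\sum_(k < K) x k) ^+ 2 <= K%:R * \sum_(k < K) x k ^+ 2.
Proof.
elim: K x => [|K IH] x; first by rewrite !big_ord0 expr0n mul0r.
rewrite !big_ord_recr /= -natr1; apply: sqr_sum_step; [by []| |exact: (IH (fun k => x (widen_ord (leqnSn K) k)))].
by apply: sumr_ge0 => k _; exact: sqr_ge0.
Qed.

Lemma normc_sum_le K (z : 'I_K -> C) :
  normc (\sum_(k < K) z k) ^+ 2 <= K%:R * \sum_(k < K) normc (z k) ^+ 2.
Proof.
rewrite normc2 Re_sum Im_sum [X in _ <= _ * X](eq_bigr (fun k => Re (z k) ^+ 2 + Im (z k) ^+ 2)); last first.
  by move=> k _; exact: normc2.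
by rewrite big_split /= mulrDr; apply: lerD; exact: sqr_sum_le.
Qed.

Lemma intg_sum (I : Type) (r : seq I) l (F : I -> R -> R) : (forall k, intg l (F k)) ->
  intg l (fun x => \sum_(k <- r) F k x).
Proof.
move=> h; elim: r => [|k r IH].
  by apply: (eq_intg _ (intg_cst l 0)) => x _; rewrite big_nil.
by apply: (eq_intg _ (intgD (h k) IH)) => x _; rewrite big_cons.
Qed.

Lemma Rint_sum (I : Type) (r : seq I) l (F : I -> R -> R) : (forall k, intg l (F k)) ->
  \int[lebesgue_measure]_(x in `[0, l]) (\sum_(k <- r) F k x) =
  \sum_(k <- r) \int[lebesgue_measure]_(x in `[0, l]) F k x.
Proof.
move=> h; elim: r => [|k r IH].
  rewrite big_nil (@eq_Rint _ _ _ (fun=> 0)) ?Rintegral_cst // ?mul0r // => x _; by rewrite big_nil.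
rewrite big_cons -IH -RintD //; last exact: intg_sum.
by apply: eq_Rint => x _; rewrite big_cons.
Qed.

Lemma cL2_sum (I : Type) (r : seq I) l (F : I -> R -> C) : 0 <= l -> (forall k, cL2 l (F k)) ->
  cL2 l (fun x => \sum_(k <- r) F k x).
Proof.
move=> l0 h; elim: r => [|k r IH].
  by apply: (eq_cL2 _ (W1_cL2 l0 (W1_cst 0 l0))) => x _; rewrite big_nil.
by apply: (eq_cL2 _ (cL2_lin 1 1 (h k) IH)) => x _; rewrite big_cons !mul1r.
Qed.

Lemma W1_sum (I : Type) (r : seq I) l (F F1 : I -> R -> C) : 0 <= l -> (forall k, W1 l (F k) (F1 k)) ->
  W1 l (fun x => \sum_(k <- r) F k x) (fun x => \sum_(k <- r) F1 k x).
Proof.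
move=> l0 h; elim: r => [|k r IH].
  by apply: (eq_W1 l0 _ _ (W1_cst 0 l0)) => x _; rewrite big_nil.
by apply: (eq_W1 l0 _ _ (W1_lin 1 1 l0 (h k) IH)) => x _; rewrite big_cons !mul1r.
Qed.

Definition avg K (F : 'I_K -> R -> C) (x : R) : C := K%:R^-1 * \sum_(k < K) F k x.

Lemma W1_avg K l (F F1 : 'I_K -> R -> C) : 0 <= l -> (forall k, W1 l (F k) (F1 k)) -> W1 l (avg F) (avg F1).
Proof.
move=> l0 h; have S := W1_sum (index_enum _) l0 h.
by apply: (eq_W1 l0 _ _ (W1_lin (K%:R^-1) 0 l0 S S)) => x _; rewrite mul0r addr0.
Qed.

Lemma cL2_avg K l (F : 'I_K -> R -> C) : 0 <= l -> (forall k, cL2 l (F k)) -> cL2 l (avg F).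
Proof.
move=> l0 h; have S := cL2_sum (index_enum _) l0 h.
by apply: (eq_cL2 _ (cL2_lin (K%:R^-1) 0 S S)) => x _; rewrite mul0r addr0.
Qed.

Lemma natC K : (K%:R : C) = (K%:R : R)%:C. Proof. by rewrite rmorph_nat. Qed.

Lemma natC_neq0 K : (0 < K)%N -> (K%:R : C) != 0.
Proof. by rewrite lt0n natC eq_complex /= pnatr_eq0 negb_and => ->. Qed.

Lemma normc_natV K : normc ((K%:R : C)^-1) ^+ 2 = (K%:R^-1) ^+ 2.
Proof. by rewrite natC -fmorphV normc2 /= expr0n addr0. Qed.

Lemma natC_mulKn K (z : C) : (0 < K)%N -> K%:R^-1 * (z *+ K) = z.
Proof. by move=> K0; rewrite -[z *+ K]mulr_natl mulKf // natC_neq0. Qed.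

(** Convexity of the squared modulus: averaging does not increase the mean squared norm. *)
Lemma nrm_avg K l (F : 'I_K -> R -> C) : (0 < K)%N -> 0 <= l -> (forall k, cL2 l (F k)) ->
  nrm l (avg F) <= K%:R^-1 * \sum_(k < K) nrm l (F k).
Proof.
move=> K0 l0 h.
have K0' : 0 < K%:R :> R by rewrite ltr0n.
have i k : intg l (fun x => normc (F k x) ^+ 2) by exact: cL2_normc2.
have iS := intg_sum (index_enum 'I_K) i.
rewrite /nrm -(Rint_sum (index_enum 'I_K) i) -RintZ //.
apply: le_Rintegral => //; [exact: (cL2_normc2 (cL2_avg l0 h))|exact: intgZ|].
move=> x _; rewrite /avg normcM2 normc_natV.
have := normc_sum_le (fun k => F k x); rewrite -(ler_pM2l (exprn_gt0 2 (_ : 0 < K%:R^-1))) ?invr_gt0 //.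
move/le_trans; apply; rewrite expr2 -mulrA (mulrA _ K%:R) mulVf ?mul1r // gt_eqF //.
Qed.

End Averages.

Section Radial.
Context {R : realType}.
Variables (s : nat -> nat) (l : nat -> R).
Hypothesis l_gt0 : forall n, 0 < l n.
Hypothesis s_ge1 : forall n, (1 <= s n)%N.
Notation C := R[i].
Notation Re := complex.Re.
Notation Im := complex.Im.
Notation normc := ComplexField.Normc.normc.
Local Notation efun := (efun R s).
Implicit Types (e : edge s) (f g h u v : efun) (b c z w : C) (M eps t : R) (p q : efun * efun)
  (a : nat -> R -> C).

Definition mun (n : nat) : R := (s n * s n.+1)%:R.
Definition lift a : efun := fun e x => a (tag e) x.
(* [a n] is a radial profile on layer n, translated to start at 0. The last two conditions are the Kirchhoff
   conditions of the radial function. *)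
Definition rprof a (a1 a2 : nat -> R -> C) : Prop :=
  [/\ forall n, W2 (l n) (a n) (a1 n) (a2 n), forall n, a n (l n) = a n.+1 0,
      forall n, (mun n)%:C * a1 n (l n) = (mun n.+1)%:C * a1 n.+1 0 & a1 0%N 0 = 0].
(** A nested average rather than a single one, so that the lemmas on [avg] apply twice. *)
Definition psym f n : R -> C := avg (fun i : 'I_(s n) => avg (fun j : 'I_(s n.+1) => f (mkedge i j))).

Lemma mun_gt0 n : 0 < mun n. Proof. by rewrite ltr0n muln_gt0 !s_ge1. Qed.

Lemma munC n : (mun n)%:C = (s n)%:R * (s n.+1)%:R :> C.
Proof. by rewrite /mun -natC natrM. Qed.

Lemma munC_neq0 n : (mun n)%:C != 0 :> C.
Proof. by rewrite eq_complex /= gt_eqF // mun_gt0. Qed.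

Lemma psymE f n x : (mun n)%:C * psym f n x = \sum_(i < s n) \sum_(j < s n.+1) f (mkedge i j) x.
Proof.
rewrite munC /psym /avg -mulr_sumr.
have h1 := @natC_neq0 R _ (s_ge1 n); have h2 := @natC_neq0 R _ (s_ge1 n.+1).
by move: (\sum_(i < s n) _) => z; field; rewrite h1 h2.
Qed.

Lemma psym_lc b f c g n x : psym (lc b f c g) n x = b * psym f n x + c * psym g n x.
Proof.
apply: (mulfI (munC_neq0 n)); rewrite mulrDr !(mulrCA _ b) !(mulrCA _ c) !psymE.
rewrite !mulr_sumr -big_split /=; apply: eq_bigr => i _.
by rewrite !mulr_sumr -big_split.
Qed.

Lemma psym_lift a n x : psym (lift a) n x = a n x.
Proof. apply: (mulfI (munC_neq0 n)); rewrite psymE munC /lift /= !sumr_const !card_ord -mulrnA mulrC -natrM mulr_natr mulnC.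
by []. Qed.

Lemma lnrm_lift a n : lnrm l (lift a) n = mun n * nrm (l n) (a n).
Proof. by rewrite /lnrm /lift /= !sumr_const !card_ord -mulrnA (mulnC (s n.+1)) /mun mulr_natl. Qed.

Lemma rprof_edgewise a a1 a2 : rprof a a1 a2 -> edgewise_W2 l (lift a) (lift a1) (lift a2).
Proof. by move=> [h _ _ _] e; exact: h. Qed.

(** At a vertex of S_(n+1), s_n edges come in and s_(n+2) go out; cancelling the common factor
    s_(n+1) in the flux condition of [rprof] gives Kirchhoff's condition. *)
Lemma rprof_kirchhoff a a1 a2 : rprof a a1 a2 -> kirchhoff l (lift a) (lift a1).
Proof.
move=> [_ h1 h2 h3]; split.
  by exists (fun n _ => a n 0) => n i j; split; [by []|exact: h1].
move=> [|n] i; rewrite /flux_up /lift /= ?sumr_const ?card_ord.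
  by rewrite h3 mul0rn addr0.
have := h2 n; rewrite !munC -mulrA (mulrCA (s n)%:R) -mulrA => /(mulfI (@natC_neq0 R _ (s_ge1 n.+1))) e.
by rewrite mulNrn -mulr_natl e mulr_natl addNr.
Qed.

Lemma rprof_lc b c a a1 a2 (d d1 d2 : nat -> R -> C) : rprof a a1 a2 -> rprof d d1 d2 ->
  rprof (fun n x => b * a n x + c * d n x) (fun n x => b * a1 n x + c * d1 n x) (fun n x => b * a2 n x + c * d2 n x).
Proof.
move=> [h1 h2 h3 h4] [k1 k2 k3 k4]; split.
- by move=> n; apply: W2_lin => //; exact: ltW.
- by move=> n; rewrite h2 k2.
- by move=> n; rewrite !mulrDr !(mulrCA _ b) !(mulrCA _ c) h3 k3.
- by rewrite h4 k4 !mulr0 addr0.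
Qed.

(** At a sphere the average over either adjacent layer is the mean of the vertex values; summing
    Kirchhoff's condition over the sphere gives the flux condition. *)
Lemma psym_rprof f f1 f2 : edgewise_W2 l f f1 f2 -> kirchhoff l f f1 -> rprof (psym f) (psym f1) (psym f2).
Proof.
move=> W [[c hc] K]; split.
- move=> n; have l0 := ltW (l_gt0 n).
  by split; apply: W1_avg => // i; apply: W1_avg => // j; have [] := W (mkedge i j).
- move=> n; rewrite /psym /avg.
  transitivity ((s n.+1)%:R^-1 * \sum_(j < s n.+1) c n.+1 j).
    under eq_bigr do under eq_bigr do rewrite (hc _ _ _).2.
    by rewrite sumr_const card_ord natC_mulKn.
  congr (_ * _); apply: eq_bigr => j _; under eq_bigr do rewrite (hc _ _ _).1.
  by rewrite sumr_const card_ord natC_mulKn.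
- move=> n; rewrite !psymE exchange_big /=; apply: eq_bigr => j _.
  have := K n.+1 j; rewrite /= sumrN addrC => /subr0_eq; exact: esym.
- apply: (mulfI (munC_neq0 0)); rewrite psymE mulr0 big1 // => i _.
  by have := K 0%N i; rewrite /= add0r.
Qed.

Lemma lnrm_psym f n : eL2 l f -> lnrm l (lift (psym f)) n <= lnrm l f n.
Proof.
move=> hf; have l0 := ltW (l_gt0 n); rewrite lnrm_lift -ler_pdivlMl ?mun_gt0 //.
have h i j : cL2 (l n) (f (@mkedge s n i j)) by exact: (hf (mkedge i j)).
apply: (le_trans (nrm_avg (s_ge1 n) l0 (fun i => cL2_avg l0 (h i)))).
rewrite /mun natrM invfM -mulrA ler_pM2l ?invr_gt0 ?ltr0n ?s_ge1 //.
rewrite mulr_sumr; apply: ler_sum => i _; exact: nrm_avg.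
Qed.

Lemma L2_psym f : L2 l f -> L2 l (lift (psym f)).
Proof.
move=> /L2P[hf [M hM]]; apply/L2P; split.
  move=> e; have l0 := ltW (l_gt0 (tag e)).
  by apply: cL2_avg => // i; apply: cL2_avg => // j; exact: (hf (mkedge i j)).
exists M => N; apply: le_trans (hM N); apply: ler_sum => n _; exact: lnrm_psym.
Qed.

Lemma hrep_lift a a1 a2 : rprof a a1 a2 -> L2 l (lift a) -> L2 l (lift a2) -> hrep l (lift a) (lift a1) (lift a2).
Proof. by move=> h h1 h2; split; [exact: rprof_edgewise h|exact: rprof_kirchhoff h|exact: h1|exact: h2]. Qed.

Lemma hrep_psym f f1 f2 : hrep l f f1 f2 -> hrep l (lift (psym f)) (lift (psym f1)) (lift (psym f2)).
Proof. by move=> [W K h h2]; apply: hrep_lift; [exact: psym_rprof|exact: L2_psym|exact: L2_psym]. Qed.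

(* A function whose radial average vanishes is cut off at the sphere S_(N+1) by averaging
   over the outer ends of the edges between S_N and S_(N+1). *)
Definition pav f : efun := fun e => avg (fun k : 'I_(s (tag e).+1) => f (mkedge (tagged e).1 k)).
Definition cutoff N f : efun := fun e x =>
  if (tag e < N)%N then f e x else if tag e == N then pav f e x else 0.

Lemma edgewise_cutoff N f f1 f2 : edgewise_W2 l f f1 f2 ->
  edgewise_W2 l (cutoff N f) (cutoff N f1) (cutoff N f2).
Proof.
move=> W e; have l0 := ltW (elen_gt0 l_gt0 e).
rewrite /cutoff /=; case: (tag e < N)%N; first exact: W.
case: (tag e == N); last by split; exact: W1_cst.
by split; apply: W1_avg => // k; have [] := W (mkedge (tagged e).1 k).
Qed.

Lemma lnrm_pav f n : eL2 l f -> lnrm l (pav f) n <= lnrm l f n.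
Proof.
move=> hf; have l0 := ltW (l_gt0 n); apply: ler_sum => i _.
have h j : cL2 (l n) (f (@mkedge s n i j)) by exact: (hf (mkedge i j)).
rewrite /pav /= sumr_const card_ord -mulr_natl -ler_pdivlMl ?ltr0n ?s_ge1 //.
exact: (nrm_avg (s_ge1 n.+1) l0 h).
Qed.

(** On layer N all edges leaving i start with the same value, and replacing their slopes by the mean
    preserves the flux at i. At the outer ends the value and the flux are multiples of the two
    averages assumed to vanish. *)
Lemma kirchhoff_cutoff N f f1 : kirchhoff l f f1 -> psym f N (l N) = 0 -> psym f1 N (l N) = 0 ->
  kirchhoff l (cutoff N f) (cutoff N f1).
Proof.
move=> [[c hc] K] z z1; split.
  exists (fun n i => if (n <= N)%N then c n i else 0) => n i j; rewrite /cutoff /=.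
  have [nN|Nn|E] := ltngtP n N; last subst n.
  - by have [-> ->] := hc n i j.
  - by [].
  - rewrite /pav /avg /=; split.
      under eq_bigr do rewrite (hc _ _ _).1.
      by rewrite sumr_const card_ord natC_mulKn.
    rewrite -[RHS]z /psym /avg /=.
    under eq_bigr do rewrite (hc _ _ _).2.
    under [X in _ = _ * X]eq_bigr do under eq_bigr do rewrite (hc _ _ _).2.
    by rewrite sumr_const card_ord natC_mulKn.
have U n (i : 'I_(s n)) : flux_up (cutoff N f1) i = if (n <= N)%N then flux_up f1 i else 0.
  rewrite /flux_up /cutoff /=; have [nN|Nn|E] := ltngtP n N; last subst n.
  - by [].
  - by rewrite big1.
  - by rewrite /pav /avg /= sumr_const card_ord -mulrnAr natC_mulKn.
have D n (i : 'I_(s n)) : flux_down l (cutoff N f1) i = if (n <= N)%N then flux_down l f1 i else 0.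
  case: n i => [|n] i /=; first by [].
  rewrite /cutoff /=; have [nN|Nn|E] := ltngtP n N; last subst n.
  - by [].
  - by rewrite big1 // => k _; rewrite oppr0.
  - rewrite sumrN (_ : \sum_(k < s N) _ = 0) ?oppr0 //.
    have := z1; rewrite /psym /pav /avg /= => /eqP; rewrite mulf_eq0 invr_eq0 (negbTE (@natC_neq0 R _ (s_ge1 N))) /=.
    by move/eqP.
by move=> n i; rewrite U D; case: ifP => _; [exact: K|rewrite addr0].
Qed.

(** Only layers from N on are affected. The factor 4 is 2 + 2 from the square of a difference, as
    [pav] does not increase the norm. *)
Lemma lnrm_cutoff N f n : eL2 l f -> lnrm l (lc 1 f (-1) (cutoff N f)) n <= if (n < N)%N then 0 else 4 * lnrm l f n.
Proof.
move=> hf; have l0 := ltW (l_gt0 n).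
have hp : eL2 l (pav f).
  by move=> e; apply: cL2_avg; [exact/ltW/elen_gt0|move=> k; exact: (hf (mkedge (tagged e).1 k))].
have f0 := lnrm_ge0 l f n.
have [nN|Nn|E] := ltngtP n N; last subst n.
- rewrite /lnrm big1 // => i _; rewrite big1 // => j _.
  rewrite /nrm (@eq_Rint _ _ _ (fun=> 0)) ?Rintegral_cst ?mul0r // => x _.
  by rewrite /lc /cutoff /= nN mul1r mulN1r subrr normc2 /= expr0n addr0.
- rewrite (_ : lnrm l _ n = lnrm l f n); first lra.
  apply: eq_bigr => i _; apply: eq_bigr => j _; apply: eq_nrm => x _.
  by rewrite /lc /cutoff /= ltnNge (ltnW Nn) gtn_eqF // mulr0 addr0 mul1r.
- rewrite (_ : lnrm l _ N = lnrm l (lc 1 f (-1) (pav f)) N).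
    have := lnrm_lc 1 (-1) N hf hp; have := lnrm_pav N hf.
    rewrite !normc2 /= !expr0n /= oppr0 !expr0n /= sqrrN expr1n !addr0.
    move: (lnrm _ _ _) (lnrm _ _ _) (lnrm _ _ _) => A B D; lra.
  by apply: eq_bigr => i _; apply: eq_bigr => j _; apply: eq_nrm => x _; rewrite /lc /cutoff /= ltnn eqxx.
Qed.

Lemma sum_lnrm_cutoff N f eps : eL2 l f ->
  (forall m n, (N <= m)%N -> \sum_(m <= k < n) lnrm l f k <= eps) -> 0 <= eps ->
  forall M : nat, \sum_(0 <= n < M) lnrm l (lc 1 f (-1) (cutoff N f)) n <= 4 * eps.
Proof.
move=> hf t e0 M.
have Z m : (m <= N)%N -> \sum_(0 <= n < m) lnrm l (lc 1 f (-1) (cutoff N f)) n <= 0.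
  move=> mN; rewrite big_nat_cond; apply: sumr_le0 => n /andP[/andP[_ nm] _].
  by have := lnrm_cutoff N n hf; rewrite (leq_trans nm mN).
have [MN|NM] := leqP M N; first by apply: (le_trans (Z M MN)); rewrite mulr_ge0.
rewrite (big_cat_nat (leq0n N) (ltnW NM)) /=; have := Z N (leqnn N) => ZN.
apply: (le_trans (_ : _ <= 0 + 4 * \sum_(N <= k < M) lnrm l f k)).
  apply: lerD => //; rewrite mulr_sumr [leLHS]big_nat_cond [leRHS]big_nat_cond.
  apply: ler_sum => n /andP[/andP[h _] _].
  by have := lnrm_cutoff N n hf; rewrite ltnNge h.
by rewrite add0r ler_pM2l //; exact: t.
Qed.

(** Both f and f2 are cut off at the same sphere at the cost of their tails only. A smooth cut-off
    factor would bring in derivatives that are large on short edges. *)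
Lemma zero_average_Hmin f f1 f2 : hrep l f f1 f2 ->
  (forall n, psym f n (l n) = 0) -> (forall n, psym f1 n (l n) = 0) -> Hmin s l (f, lc (-1) f2 0 f2).
Proof.
move=> [W K h h2] z z1; have hf := L2_eL2 h; have hf2 := L2_eL2 h2.
apply: closureK => /=; [exact: H0_L2|exact: h|exact: L2_lc|move=> eps e0].
have e4 : 0 < eps / 4 by lra.
have [N1 t1] := sqn_tail h e4; have [N2 t2] := sqn_tail h2 e4.
pose N := maxn N1 N2.
have Wc := edgewise_cutoff N W.
have [c0 _ c2] := edgewise_eL2 l_gt0 Wc.
have Lc : L2 l (cutoff N f).
  apply: (fin_L2 (N := N.+1)) => // e Ne x _.
  by rewrite /cutoff ltnNge (ltnW Ne) gtn_eqF.
have Lc2 : L2 l (cutoff N f2).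
  apply: (fin_L2 (N := N.+1)) => // e Ne x _.
  by rewrite /cutoff ltnNge (ltnW Ne) gtn_eqF.
exists (cutoff N f, lc (-1) (cutoff N f2) 0 (cutoff N f2)); split.
- apply: sub_closure; first exact: H0_L2.
  split; first exact: Lc.
  exists (cutoff N f), (cutoff N f1), (cutoff N f2); split.
  + exact: aeq_refl.
  + exact: Wc.
  + by exists N.+1 => e Ne x _; rewrite /cutoff ltnNge (ltnW Ne) gtn_eqF.
  + exact: kirchhoff_cutoff.
  + by split; [exact: L2_lc|rewrite lcN; exact: aeq_refl].
- apply: sqn_le => M /=; have -> : eps = 4 * (eps / 4) by field.
  apply: sum_lnrm_cutoff => //; last exact: ltW.
  by move=> m n hm; apply: t1; apply: leq_trans hm; exact: leq_maxl.
- apply: sqn_le => M /=; have -> : eps = 4 * (eps / 4) by field.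
  have T m n : (N <= m)%N -> \sum_(m <= k < n) lnrm l f2 k <= eps / 4.
    by move=> hm; apply: t2; apply: leq_trans hm; exact: leq_maxr.
  apply: le_trans (sum_lnrm_cutoff hf2 T (ltW e4) M).
  apply: ler_sum => n _; apply: ler_sum => i _; apply: ler_sum => j _.
  rewrite le_eqVlt; apply/orP; left; apply/eqP; apply: eq_Rint => x _.
  by rewrite -normcN2; congr (normc _ ^+ 2); rewrite /lc; ring.
Qed.

Lemma nonradial_Hmin f f1 f2 : hrep l f f1 f2 ->
  Hmin s l (lc 1 f (-1) (lift (psym f)), lc (-1) (lc 1 f2 (-1) (lift (psym f2))) 0 (lc 1 f2 (-1) (lift (psym f2)))).
Proof.
move=> hf; have hp := hrep_psym hf; have hd := hrep_lc l_gt0 1 (-1) hf hp.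
by apply: (zero_average_Hmin hd) => n; rewrite psym_lc psym_lift mul1r mulN1r subrr.
Qed.

End Radial.

(** * Energy flow along an edge *)

Section EdgeEnergy.
Context {R : realType}.
Notation C := R[i].
Notation Re := complex.Re.
Notation Im := complex.Im.
Notation normc := ComplexField.Normc.normc.
Implicit Types (f g : R -> C) (x l : R) (c : C).

Lemma ReCM (r : R) (z : C) : Re (r%:C * z) = r * Re z.
Proof. by rewrite ReM ReC ImC mul0r subr0. Qed.

Lemma W1S x l f f1 : x <= l -> W1 l f f1 -> W1 x f f1.
Proof. by move=> xl /W1P[h1 h2]; apply/W1P; split; apply: rW1S xl _. Qed.

Lemma ip_scaler l c f g : cL2 l f -> cL2 l g -> ip l f (fun x => c * g x) = conjc c * ip l f g.
Proof.
move=> hf hg; have hc : cL2 l (fun x => c * g x).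
  by apply: (eq_cL2 _ (cL2_lin c 0 hg hg)) => x _; rewrite mul0r addr0.
rewrite (ipC hc hf) (ipC hg hf).
rewrite (_ : ip l (fun x => c * g x) f = c * ip l g f) ?conjcM //.
rewrite -[RHS]addr0 -[X in _ + X](mul0r (ip l g f)) -(ip_lin c 0 hg hg hf).
by apply: eq_cint => x _; rewrite mul0r addr0.
Qed.

Lemma ip_am_gm l c f g : cL2 l f -> cL2 l g ->
  2 * Re (conjc c * ip l f g) <= nrm l f + normc c ^+ 2 * nrm l g.
Proof.
move=> hf hg; have hc : cL2 l (fun x => c * g x).
  by apply: (eq_cL2 _ (cL2_lin c 0 hg hg)) => x _; rewrite mul0r addr0.
have := ip_young ltr01 hf hc; rewrite ip_scaler // nrmZ // invr1 !mul1r => h.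
have := le_trans (ler_norm _) h; lra.
Qed.

Lemma nrm_half l f g : cL2 l f -> cL2 l g ->
  2 * Re (ip l f g) <= nrm l f + nrm l g.
Proof. by move=> hf hg; have := ip_am_gm 1 hf hg; rewrite conjc1 mul1r ComplexField.Normc.normc1 expr1n mul1r. Qed.

Lemma nrm_mono x l f : 0 <= x <= l -> cL2 l f -> nrm x f <= nrm l f.
Proof.
move=> xl hf; apply: le_trans (ler_norm _) _; apply: le_trans (le_prim (cL2_normc2 hf) xl) _.
by rewrite (@eq_Rint _ _ _ (fun y => normc (f y) ^+ 2)) // => y _; rewrite ger0_norm ?sqr_ge0.
Qed.

Lemma nrm_ge_bounded l f (c : R) : 0 <= l -> cL2 l f -> (forall x, 0 <= x <= l -> c <= normc (f x) ^+ 2) ->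
  c * l <= nrm l f.
Proof.
move=> l0 hf hc; have -> : c * l = \int[lebesgue_measure]_(x in `[0, l]) c.
  rewrite Rintegral_cst // [X in fine X]lebesgue_measure_itv /= lte_fin.
  by case: ltP => h; rewrite /= ?subr0 // (_ : l = 0) ?mulr0 //; apply/eqP; rewrite eq_le h.
have i1 := cL2_normc2 hf; have i2 : intg l (fun=> c) := intg_cst l c.
by apply: (le_Rintegral _ i2 i1) => // x; rewrite /= in_itv /=; exact: hc.
Qed.

(** Half the derivative of |f|^2 when f1 is the derivative of f. *)
Definition flow f f1 x : R := Re (f1 x * conjc (f x)).

(** The derivative of f1 conj f is f2 conj f + |f1|^2. With f2 = f - k, the cross term 2 Re (k, f)
    is at most |k|^2 + |f|^2, and |f1|^2 is dropped. *)
Lemma flow_growth x l f f1 f2 : 0 <= x <= l -> W2 l f f1 f2 ->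
  2 * flow f f1 0 + nrm x f - nrm x (fun y => f y - f2 y) <= 2 * flow f f1 x.
Proof.
move=> /andP[x0 xl] [w1 w2].
have v1 := W1S xl w1; have v2 := W1S xl w2.
have hf := W1_cL2 x0 v1; have h1 := W1_cL2' v1; have h2 := W1_cL2' v2.
have hk : cL2 x (fun y => f y - f2 y).
  by apply: (eq_cL2 _ (cL2_lin 1 (-1) hf h2)) => y _; rewrite mul1r mulN1r.
have P := cint_parts x0 v2 (W1_conj x0 v1).
have E : f1 x * conjc (f x) - f1 0 * conjc (f 0) = ip x f2 f + ip x f1 f1.
  rewrite -P /ip -cintD; [by []| |]; apply: cL2_mul => //; exact: cL2_conj.
have E2 : ip x f2 f = (nrm x f)%:C - ip x (fun y => f y - f2 y) f.
  rewrite -(ipff hf) -mulN1r -[X in X + _]mul1r -(ip_lin 1 (-1) hf hk hf); apply: eq_cint => y _; congr (_ * _); ring.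
have N := nrm_half hk hf; have := nrm_ge0 x f1.
move: E N; rewrite E2 (ipff h1); move: (ip _ _ _) => p E N.
by have := congr1 (@complex.Re R) E; rewrite !ReD !ReN !ReC /flow; lra.
Qed.

Lemma normc2_growth x l f f1 f2 : 0 <= x <= l -> W2 l f f1 f2 ->
  (forall y, 0 <= y <= l -> 0 <= flow f f1 y) -> normc (f 0) ^+ 2 <= normc (f x) ^+ 2.
Proof.
move=> /andP[x0 xl] [w1 w2] pos.
have v1 := W1S xl w1.
have hf := W1_cL2 x0 v1; have h1 := W1_cL2' v1.
have P := cint_parts x0 v1 (W1_conj x0 v1).
have := congr1 (@complex.Re R) P; rewrite !mul_conjc !cE /= => e.
rewrite -subr_ge0 -e; apply: Rintegral_ge0 => y; rewrite /= in_itv /= => /andP[y0 yx].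
have := pos y; rewrite y0 (le_trans yx xl) /flow !cE => /(_ isT); lra.
Qed.

End EdgeEnergy.

(** * Green's formula and coercivity for radial profiles *)

Section RadialEquation.
Context {R : realType}.
Variables (s : nat -> nat) (l : nat -> R).
Hypothesis l_gt0 : forall n, 0 < l n.
Hypothesis s_ge1 : forall n, (1 <= s n)%N.
Notation C := R[i].
Notation Re := complex.Re.
Notation Im := complex.Im.
Notation normc := ComplexField.Normc.normc.
Local Notation efun := (efun R s).
Local Notation mun := (@mun R s).
Local Notation rprof := (@rprof R s l).
Local Notation lift := (@lift R s).
Implicit Types (a b u y : nat -> R -> C) (N M : nat) (eps : R).

Lemma rprof_cL2 a a1 a2 n : rprof a a1 a2 -> [/\ cL2 (l n) (a n), cL2 (l n) (a1 n) & cL2 (l n) (a2 n)].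
Proof.
move=> [h _ _ _]; have [w1 w2] := h n; have l0 := ltW (l_gt0 n).
by split; [exact: W1_cL2 w1|exact: W1_cL2 w2|exact: W1_cL2' w2].
Qed.

Lemma rprof_eL2 a a1 a2 : rprof a a1 a2 -> [/\ eL2 l (lift a), eL2 l (lift a1) & eL2 l (lift a2)].
Proof. by move=> h; split=> e; have [] := rprof_cL2 (tag e) h. Qed.

(** Values and weighted slopes match at the spheres, so Green's formula telescopes; nothing enters
    at the root because a1 and b1 vanish there. *)
Lemma rgreen a a1 a2 b b1 b2 N : rprof a a1 a2 -> rprof b b1 b2 ->
  \sum_(0 <= n < N) (mun n)%:C * (ip (l n) (a2 n) (b n) - ip (l n) (a n) (b2 n)) =
  (mun N)%:C * (a1 N 0 * conjc (b N 0) - a N 0 * conjc (b1 N 0)).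
Proof.
move=> [wa ea fa za] [wb eb fb zb]; elim: N => [|N IH].
  by rewrite big_geq // za zb conjc0 mul0r mulr0 subrr mulr0.
rewrite big_nat_recr //= IH (green_ip (ltW (l_gt0 N)) (wa N) (wb N)) -ea -eb.
have fb' : (mun N)%:C * conjc (b1 N (l N)) = (mun N.+1)%:C * conjc (b1 N.+1 0).
  by have := congr1 conjc (fb N); rewrite !conjcM !conjc_real.
transitivity ((mun N)%:C * a1 N (l N) * conjc (b N (l N)) - a N (l N) * ((mun N)%:C * conjc (b1 N (l N)))); first by ring.
by rewrite fa fb'; ring.
Qed.

(** [mun] times [flow] is continuous across spheres, so the edge estimates add up; a - a2 is the
    profile of (1 + H) a. *)
Lemma coercive_growth a a1 a2 N M : (N <= M)%N -> rprof a a1 a2 ->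
  2 * mun N * flow (a N) (a1 N) 0 + \sum_(N <= n < M) mun n * nrm (l n) (a n)
   - \sum_(N <= n < M) mun n * nrm (l n) (fun x => a n x - a2 n x) <= 2 * mun M * flow (a M) (a1 M) 0.
Proof.
move=> NM [w e f _]; elim: M NM => [|M IH].
  by rewrite leqn0 => /eqP ->; rewrite !big_geq //; lra.
rewrite leq_eqVlt => /orP[/eqP <-|]; first by rewrite !big_geq //; lra.
rewrite ltnS => NM; rewrite !big_nat_recr //=; have := IH NM.
have l1 : 0 <= l M <= l M by rewrite lexx andbT ltW.
have := flow_growth l1 (w M); rewrite -(ler_pM2l (@mun_gt0 R s s_ge1 M)).
have : mun M * flow (a M) (a1 M) (l M) = mun M.+1 * flow (a M.+1) (a1 M.+1) 0.
  have E : (mun M)%:C * (a1 M (l M) * conjc (a M (l M))) = (mun M.+1)%:C * (a1 M.+1 0 * conjc (a M.+1 0)).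
    by rewrite mulrA f e mulrA.
  by have := congr1 (@complex.Re R) E; rewrite !ReCM.
set A := flow _ _ _; set B := flow _ _ 0; set D := flow _ _ 0; set E := flow _ _ 0.
move: (\sum_(_ <= _ < _) _) (\sum_(_ <= _ < _) _) => S T.
move: (nrm _ _) (nrm _ _) => p q; nra.
Qed.

Hypothesis vol_infty : forall B, exists M, B < \sum_(0 <= n < M) mun n * l n.

(* Otherwise |a|^2 would increase from layer N on, which is impossible for a square integrable profile
   in infinite volume. *)
Lemma flow_small a a1 a2 eps N : rprof a a1 a2 -> L2 l (lift a) -> 0 <= eps ->
  (forall M, (N <= M)%N -> \sum_(N <= n < M) mun n * nrm (l n) (fun x => a n x - a2 n x) <= eps) ->
  2 * mun N * flow (a N) (a1 N) 0 <= eps.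
Proof.
move=> ha La e0 tail; rewrite leNgt; apply/negP => big.
have [w ea f _] := ha.
(* An initial surplus above eps outweighs the source on all later layers, so the flow stays positive
   from S_N on. *)
have pos n x : (N <= n)%N -> 0 <= x <= l n -> 0 < flow (a n) (a1 n) x.
  move=> Nn xl; have [x0 xn] := andP xl.
  have [ca _ c2] := rprof_cL2 n ha.
  have ck : cL2 (l n) (fun z => a n z - a2 n z).
    by apply: (eq_cL2 _ (cL2_lin 1 (-1) ca c2)) => z _; rewrite mul1r mulN1r.
  have m0 := @mun_gt0 R s s_ge1 n.
  have h1 := flow_growth xl (w n); have h2 := coercive_growth Nn ha.
  have h3 := nrm_mono xl ck.
  have h4 := tail n.+1 (leqW Nn); rewrite big_nat_recr //= in h4.
  have h5 : 0 <= \sum_(N <= k < n) mun k * nrm (l k) (a k).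
    by apply: sumr_ge0 => k _; rewrite mulr_ge0 ?nrm_ge0 // ltW // mun_gt0.
  have h6 := nrm_ge0 x (a n).
  rewrite -(pmulr_rgt0 _ (mulr_gt0 (ltr0n R 2) m0)).
  move: big h1 h2 h3 h4 h5 h6; clear - m0; move: (mun n) m0 => m m0.
  move: (nrm _ _) (nrm _ _) (nrm _ _) (\sum_(_ <= _ < _) _) (\sum_(_ <= _ < _) _) => p q r S T.
  move: (flow _ _ _) (flow _ _ _) (_ * flow _ _ _) => F G H h0 h1 h2 h3 h4 h5 h6.
  have := ler_wpM2l (ltW m0) h1; have := ler_wpM2l (ltW m0) h3; have := mulr_ge0 (ltW m0) h6.
  lra.
have d0 : 0 < normc (a N 0) ^+ 2.
  rewrite lt_def sqr_ge0 andbT; apply/eqP => /normc2_eq0 z.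
  by have := pos N 0 (leqnn N); rewrite lexx (ltW (l_gt0 N)) /flow z conjc0 mulr0 ltxx => /(_ isT).
have grow n x : (N <= n)%N -> 0 <= x <= l n -> normc (a n 0) ^+ 2 <= normc (a n x) ^+ 2.
  by move=> Nn hx; apply: (normc2_growth hx (w n)) => z hz; exact/ltW/pos.
have grow0 k : normc (a N 0) ^+ 2 <= normc (a (N + k)%N 0) ^+ 2.
  elim: k => [|k IH]; first by rewrite addn0.
  apply: le_trans IH _; rewrite addnS -ea; apply: grow; rewrite ?leq_addr // lexx andbT; exact: ltW.
have low n : (N <= n)%N -> normc (a N 0) ^+ 2 * l n <= nrm (l n) (a n).
  move=> Nn; have [ca _ _] := rprof_cL2 n ha.
  apply: (nrm_ge_bounded (ltW (l_gt0 n)) ca) => x hx; apply: le_trans (grow n x Nn hx).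
  by have := grow0 (n - N)%N; rewrite subnKC.
have [B hB] : exists B, forall M, \sum_(0 <= n < M) lnrm l (lift a) n <= B by have /L2P[] := La.
(* From S_N on |a|^2 is at least its value at S_N, so a volume above B / |a|^2 beyond S_N forces the
   squared norm above B. *)
have [M hM] := vol_infty (\sum_(0 <= n < N) mun n * l n + B / normc (a N 0) ^+ 2).
have B0 : 0 <= B by have := hB 0%N; rewrite big_geq.
have NM : (N <= M)%N.
  rewrite leqNgt; apply/negP => MN.
  move: hM; rewrite (big_cat_nat (leq0n M) (ltnW MN)) /= ltNge => /negP; apply.
  rewrite -addrA lerDl addr_ge0 ?divr_ge0 ?(ltW d0) //.
  by apply: sumr_ge0 => n _; rewrite mulr_ge0 ?ltW ?mun_gt0.
move: hM; rewrite (big_cat_nat (leq0n N) NM) /= ltrD2l ltr_pdivrMr // ltNge => /negP; apply.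
apply: le_trans (hB M); rewrite (big_cat_nat (leq0n N) NM) /=.
apply: (@le_trans _ _ (0 + \sum_(N <= n < M) lnrm l (lift a) n)); last first.
  by rewrite lerD2r; apply: sumr_ge0 => n _; exact: lnrm_ge0.
rewrite add0r mulr_suml [leLHS]big_nat_cond [leRHS]big_nat_cond.
apply: ler_sum => n /andP[/andP[Nn _] _]; rewrite lnrm_lift -mulrA ler_pM2l ?mun_gt0 // mulrC.
exact: low.
Qed.

(** The flow vanishes at the root and, up to eps, nothing is gained at large N; hence (1 + H) a
    controls a. *)
Lemma radial_coercive a a1 a2 K : rprof a a1 a2 -> L2 l (lift a) ->
  (forall M, \sum_(0 <= n < M) mun n * nrm (l n) (fun x => a n x - a2 n x) <= K) ->
  forall M, \sum_(0 <= n < M) mun n * nrm (l n) (a n) <= K.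
Proof.
move=> ha La hK M; have pk n : 0 <= mun n * nrm (l n) (fun x => a n x - a2 n x).
  by rewrite mulr_ge0 ?nrm_ge0 // ltW ?mun_gt0.
have pa n : 0 <= mun n * nrm (l n) (a n) by rewrite mulr_ge0 ?nrm_ge0 // ltW ?mun_gt0.
apply/ler_addgt0Pr => eps e0.
have [N1 tail] := series_tail pk hK e0.
pose N := maxn N1 M.
have fs : 2 * mun N * flow (a N) (a1 N) 0 <= eps.
  by apply: (flow_small ha La (ltW e0)) => m Nm; apply: tail; exact: leq_maxl.
have h1 := coercive_growth (leq0n N) ha.
have [_ _ _ z] := ha; rewrite {1}/flow z mul0r /= mulr0 add0r in h1.
have h2 := hK N.
have h3 : \sum_(0 <= k < M) mun k * nrm (l k) (a k) <= \sum_(0 <= k < N) mun k * nrm (l k) (a k).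
  by rewrite [leRHS](big_cat_nat (leq0n M) (leq_maxr N1 M)) /= lerDl sumr_ge0.
lra.
Qed.

End RadialEquation.

(** * Hyperbolic functions on an edge *)

Section Hyperbolic.
Context {R : realType}.
Notation C := R[i].
Notation Re := complex.Re.
Notation Im := complex.Im.
Implicit Types (x l : R).

Lemma W1_real l (f f1 f2 : R -> R) : 0 <= l -> (forall x, is_derive x 1 f (f1 x)) ->
  (forall x, is_derive x 1 f1 (f2 x)) -> W1 l (fun x => (f x)%:C) (fun x => (f1 x)%:C).
Proof.
move=> l0 d d1; apply: W1_C1 => //= x; [exact: is_derive_cst| |exact: cvg_cst].
by apply: differentiable_continuous; apply/derivable1_diffP; have [] := d1 x.
Qed.

Definition chr x : R := (expR x + expR (- x)) / 2.
Definition shr x : R := (expR x - expR (- x)) / 2.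

Lemma is_derive_expRN x : is_derive x 1 (fun y => expR (- y)) (- expR (- x)).
Proof. by rewrite -mulrN1; exact: (is_derive1_comp (is_derive_expR _) (is_deriveNid x 1)). Qed.

Lemma is_derive_chr x : is_derive x 1 chr (shr x).
Proof.
have h := is_derive_expRN x; rewrite /chr /shr.
apply: (@is_derive_eq _ _ _ _ _ _ _ _ (is_deriveM (is_deriveD (is_derive_expR x) h) (is_derive_cst (2^-1 : R) x 1))).
by rewrite /GRing.scale /=; ring.
Qed.

Lemma is_derive_shr x : is_derive x 1 shr (chr x).
Proof.
have h := is_derive_expRN x; rewrite /chr /shr.
apply: (@is_derive_eq _ _ _ _ _ _ _ _ (is_deriveM (is_deriveB (is_derive_expR x) h) (is_derive_cst (2^-1 : R) x 1))).
by rewrite /GRing.scale /=; ring.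
Qed.

Lemma is_derive_xM (f f1 : R -> R) x : is_derive x 1 f (f1 x) -> is_derive x 1 (fun y => y * f y) (f x + x * f1 x).
Proof.
move=> h; apply: (@is_derive_eq _ _ _ _ _ _ _ _ (is_deriveM (is_derive_id x 1) h)).
by rewrite /GRing.scale /=; ring.
Qed.

Lemma W1_chr l : 0 <= l -> W1 l (fun x => (chr x)%:C) (fun x => (shr x)%:C).
Proof. by move=> l0; exact: (W1_real l0 is_derive_chr is_derive_shr). Qed.

Lemma W1_shr l : 0 <= l -> W1 l (fun x => (shr x)%:C) (fun x => (chr x)%:C).
Proof. by move=> l0; exact: (W1_real l0 is_derive_shr is_derive_chr). Qed.

(** x sinh x and, in the next lemma, x cosh x - sinh x solve w'' - w = 2 cosh x and w'' - w = 2 sinh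
    x with zero data at 0. They serve the resonant equation, whose right-hand side itself solves the
    homogeneous one. *)
Lemma W2_xshr l : 0 <= l -> W2 l (fun x => (x * shr x)%:C) (fun x => (shr x + x * chr x)%:C)
  (fun x => (chr x + (chr x + x * shr x))%:C).
Proof.
move=> l0.
have d1 x : is_derive x 1 (fun x => x * shr x) (shr x + x * chr x) by apply: is_derive_xM; exact: is_derive_shr.
have d2 x : is_derive x 1 (fun x => x * chr x) (chr x + x * shr x) by apply: is_derive_xM; exact: is_derive_chr.
have d3 x : is_derive x 1 (fun x => shr x + x * chr x) (chr x + (chr x + x * shr x)).
  exact: (is_deriveD (is_derive_shr x) (d2 x)).
have d4 x : is_derive x 1 (fun x => chr x + (chr x + x * shr x)) (shr x + (shr x + (shr x + x * chr x))).
  exact: (is_deriveD (is_derive_chr x) (is_deriveD (is_derive_chr x) (d1 x))).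
by split; [exact: (W1_real l0 d1 d3)|exact: (W1_real l0 d3 d4)].
Qed.

Lemma W2_xchr l : 0 <= l -> W2 l (fun x => (x * chr x - shr x)%:C) (fun x => (x * shr x)%:C)
  (fun x => (shr x + x * chr x)%:C).
Proof.
move=> l0.
have d1 x : is_derive x 1 (fun x => x * shr x) (shr x + x * chr x) by apply: is_derive_xM; exact: is_derive_shr.
have d2 x : is_derive x 1 (fun x => x * chr x) (chr x + x * shr x) by apply: is_derive_xM; exact: is_derive_chr.
have d0 x : is_derive x 1 (fun x => x * chr x - shr x) (x * shr x).
  by apply: (@is_derive_eq _ _ _ _ _ _ _ _ (is_deriveB (d2 x) (is_derive_shr x))); ring.
have d3 x : is_derive x 1 (fun x => shr x + x * chr x) (chr x + (chr x + x * shr x)).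
  exact: (is_deriveD (is_derive_shr x) (d2 x)).
by split; [exact: (W1_real l0 d0 d1)|exact: (W1_real l0 d1 d3)].
Qed.

Lemma chr0 : chr 0 = 1. Proof. by rewrite /chr oppr0 expR0; field. Qed.
Lemma shr0 : shr 0 = 0. Proof. by rewrite /shr oppr0 expR0; field. Qed.
Lemma chr_ge1 x : 1 <= chr x.
Proof. by have := expR_ge1Dx x; have := expR_ge1Dx (- x); rewrite /chr; lra. Qed.
Lemma shr_ge0 x : 0 <= x -> 0 <= shr x.
Proof. move=> x0; have h : expR (- x) <= expR x.
  by rewrite ler_expR (le_trans _ x0) // oppr_le0.
by rewrite /shr; lra. Qed.

End Hyperbolic.

(** * Solutions built layer by layer, and cut-off profiles *)

Section LayeredSolutions.
Context {R : realType}.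
Variables (s : nat -> nat) (l : nat -> R).
Hypothesis l_gt0 : forall n, 0 < l n.
Hypothesis s_ge1 : forall n, (1 <= s n)%N.
Notation C := R[i].
Notation Re := complex.Re.
Notation Im := complex.Im.
Notation normc := ComplexField.Normc.normc.
Local Notation efun := (efun R s).
Local Notation mun := (@mun R s).
Local Notation rprof := (@rprof R s l).
Local Notation lift := (@lift R s).
Implicit Types (a b u q : nat -> R -> C) (N M : nat) (eps : R) (c : C).

Lemma eq_rprof a a1 a2 b2 : rprof a a1 a2 -> (forall n x, 0 <= x <= l n -> a2 n x = b2 n x) -> rprof a a1 b2.
Proof.
move=> [w e f z] h; split => // n.
exact: (eq_W2 (ltW (l_gt0 n)) (fun _ _ => erefl) (fun _ _ => erefl) (h n) (w n)).
Qed.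

(* [P n] and [Q n] are the solutions of the layer equation with data (1, 0) and (0, 1) at the inner
   end of layer n, and [r n] is a particular solution with zero data. *)
Lemma layered P P1 P2 Q Q1 Q2 r r1 r2 z :
  (forall n, W2 (l n) (P n) (P1 n) (P2 n)) -> (forall n, W2 (l n) (Q n) (Q1 n) (Q2 n)) ->
  (forall n, W2 (l n) (r n) (r1 n) (r2 n)) ->
  (forall n, [/\ P n 0 = 1, P1 n 0 = 0, Q n 0 = 0 & Q1 n 0 = 1]) -> (forall n, r n 0 = 0 /\ r1 n 0 = 0) ->
  exists A B : nat -> C, [/\ A 0%N = z, B 0%N = 0 &
    rprof (fun n x => A n * P n x + B n * Q n x + r n x) (fun n x => A n * P1 n x + B n * Q1 n x + r1 n x)
          (fun n x => A n * P2 n x + B n * Q2 n x + r2 n x)].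
Proof.
move=> wP wQ wr h hr.
(* Value and slope at the inner end of layer n, carried across the sphere by continuity of the value
   and of [mun] times the slope. *)
pose fix st n : C * C := if n is m.+1 then
  ((st m).1 * P m (l m) + (st m).2 * Q m (l m) + r m (l m),
   (mun m.+1)%:C^-1 * ((mun m)%:C * ((st m).1 * P1 m (l m) + (st m).2 * Q1 m (l m) + r1 m (l m)))) else (z, 0).
exists (fun n => (st n).1), (fun n => (st n).2); split => //; split.
- move=> n; have l0 := ltW (l_gt0 n).
  apply: (eq_W2 l0 _ _ _ (W2_lin 1 1 l0 (W2_lin (st n).1 (st n).2 l0 (wP n) (wQ n)) (wr n))) => x _; by rewrite !mul1r.
- move=> n; have [-> _ -> _] := h n.+1; have [-> _] := hr n.+1.
  by rewrite mulr0 mulr1 !addr0.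
- move=> n; have [_ -> _ ->] := h n.+1; have [_ ->] := hr n.+1.
  by rewrite mulr0 add0r mulr1 addr0 /= mulVKf // munC_neq0.
- by have [_ -> _ _] := h 0%N; have [_ ->] := hr 0%N; rewrite mul0r mulr0 !addr0.
Qed.

(** Reality of [u] and of its slopes at the spheres turns the boundary terms of [rgreen], which
    contain conjugates, into genuine Wronskians. *)
Lemma growing_solution : exists u u1 y y1 : nat -> R -> C,
  [/\ rprof u u1 u, rprof y y1 (fun n x => y n x - u n x),
      forall n x, 0 <= x -> exists2 r : R, 1 <= r & u n x = r%:C & forall n, conjc (u1 n 0) = u1 n 0].
Proof.
have l0 n : 0 <= l n by exact: ltW.
have W n : W2 (l n) (fun x => (chr x)%:C) (fun x => (shr x)%:C) (fun x => (chr x)%:C).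
  by split; [exact: W1_chr|exact: W1_shr].
have W' n : W2 (l n) (fun x => (shr x)%:C) (fun x => (chr x)%:C) (fun x => (shr x)%:C).
  by split; [exact: W1_shr|exact: W1_chr].
have W0 n : W2 (l n) (fun=> 0 : C) (fun=> 0) (fun=> 0) by split; exact: W1_cst.
have D : [/\ (chr (0 : R))%:C = 1 :> C, (shr (0 : R))%:C = 0 :> C, (shr (0 : R))%:C = 0 :> C & (chr (0 : R))%:C = 1 :> C].
  by rewrite chr0 shr0.
have [A [B [A0 B0 hu]]] := layered 1 W W' W0 (fun=> D) (fun=> conj erefl erefl).
(* The factor -1/2 matches the right-hand sides 2 cosh x and 2 sinh x with the required -u. *)
pose r n x : C := (- A n / 2) * (x * shr x)%:C + (- B n / 2) * (x * chr x - shr x)%:C.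
pose r1 n x : C := (- A n / 2) * (shr x + x * chr x)%:C + (- B n / 2) * (x * shr x)%:C.
pose r2 n x : C := (- A n / 2) * (chr x + (chr x + x * shr x))%:C + (- B n / 2) * (shr x + x * chr x)%:C.
have Wr n : W2 (l n) (r n) (r1 n) (r2 n) by exact: (W2_lin _ _ (l0 n) (W2_xshr (l0 n)) (W2_xchr (l0 n))).
have Dr n : r n 0 = 0 /\ r1 n 0 = 0.
  by rewrite /r /r1 shr0 !mul0r addr0 subr0 !mulr0 addr0.
have [A' [B' [_ _ hy]]] := layered 0 W W' Wr (fun=> D) Dr.
(* The layer coefficients stay real with A >= 1 and B >= 0, because cosh >= 1 and sinh >= 0 on the
   layers. *)
have pos n : exists2 w : R * R, 1 <= w.1 /\ 0 <= w.2 & A n = w.1%:C /\ B n = w.2%:C.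
  elim: n => [|n [[v w] /= [v1 w0] [eA eB]]].
    by exists (1, 0) => //; rewrite A0 B0.
  have [_ e f _] := hu; have c1 := chr_ge1 (l n); have s0 := shr_ge0 (l0 n).
  exists (v * chr (l n) + w * shr (l n), (mun n.+1)^-1 * (mun n * (v * shr (l n) + w * chr (l n)))) => /=.
    split.
      by have := mulr_ge0 w0 s0; nra.
    have v0 : 0 <= v by lra.
    have k0 : 0 <= chr (l n) by lra.
    have m0 k : 0 <= mun k by exact/ltW/mun_gt0.
    have mi : 0 <= (mun n.+1)^-1 by rewrite invr_ge0; exact: m0.
    exact: (mulr_ge0 mi (mulr_ge0 (m0 n) (addr_ge0 (mulr_ge0 v0 s0) (mulr_ge0 w0 k0)))).
  have := e n; have := f n; rewrite chr0 shr0 !mulr0 !mulr1 !addr0 !add0r eA eB => fB fA.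
  split; first by rewrite -fA rmorphD !rmorphM.
  apply: (mulfI (@munC_neq0 R s s_ge1 n.+1)); rewrite -fB [X in _ = _ * X]rmorphM fmorphV /= mulVKf ?(@munC_neq0 R s s_ge1) //.
  by rewrite !(rmorphM, rmorphD).
exists (fun n x => A n * (chr x)%:C + B n * (shr x)%:C + 0), (fun n x => A n * (shr x)%:C + B n * (chr x)%:C + 0).
exists (fun n x => A' n * (chr x)%:C + B' n * (shr x)%:C + r n x), (fun n x => A' n * (shr x)%:C + B' n * (chr x)%:C + r1 n x).
split.
- exact: hu.
- apply: eq_rprof hy _ => n x _; rewrite /r /r2.
  by rewrite !(rmorphD, rmorphN, rmorphM) /=; field.
- move=> n x x0; have [[v w] /= [v1 w0] [-> ->]] := pos n.
  exists (v * chr x + w * shr x); last by rewrite addr0 rmorphD !rmorphM.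
  by have := mulr_ge0 w0 (shr_ge0 x0); have := chr_ge1 x; nra.
- move=> n; have [[v w] /= [v1 w0] [-> ->]] := pos n.
  by rewrite shr0 chr0 mulr0 add0r mulr1 addr0 conjc_real.
Qed.

Definition cut N a : nat -> R -> C := fun n x => if (n < N)%N then a n x else 0.

Lemma cut_rprof N q q1 q2 : rprof q q1 q2 -> q N 0 = 0 -> q1 N 0 = 0 -> rprof (cut N q) (cut N q1) (cut N q2).
Proof.
move=> [w e f z] z0 z1; split.
- move=> n; rewrite /cut; case: (n < N)%N; [exact: w|split; exact/W1_cst/ltW].
- move=> n; rewrite /cut; have [nN|Nn|E] := ltngtP n.+1 N; [exact: e|by []|by rewrite e E].
- move=> n; rewrite /cut; have [nN|Nn|E] := ltngtP n.+1 N; [exact: f|by rewrite !mulr0|].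
  by rewrite f E z1.
- by rewrite /cut; case: ifP.
Qed.

Lemma cut_Hmin N q q1 q2 : rprof q q1 q2 -> q N 0 = 0 -> q1 N 0 = 0 ->
  Hmin s l (lift (cut N q), lc (-1) (lift (cut N q2)) 0 (lift (cut N q2))).
Proof.
move=> h z0 z1; have hc := cut_rprof h z0 z1; have [c0 _ c2] := rprof_eL2 l_gt0 hc.
have L0 : L2 l (lift (cut N q)).
  by apply: (fin_L2 (N := N)) => // e Ne x _; rewrite /lift /cut ltnNge Ne.
have L2' : L2 l (lift (cut N q2)).
  by apply: (fin_L2 (N := N)) => // e Ne x _; rewrite /lift /cut ltnNge Ne.
apply: sub_closure; first exact: H0_L2.
split; first exact: L0.
exists (lift (cut N q)), (lift (cut N q1)), (lift (cut N q2)); split.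
- exact: aeq_refl.
- exact: rprof_edgewise hc.
- by exists N => e Ne x _; rewrite /lift /cut ltnNge Ne.
- exact: rprof_kirchhoff hc.
- by split; [exact: L2_lc|rewrite lcN; exact: aeq_refl].
Qed.

Lemma radial_Hmin a a1 a2 : rprof a a1 a2 -> L2 l (lift a) -> L2 l (lift a2) ->
  (forall eps, 0 < eps -> exists N q q1 q2, [/\ rprof q q1 q2, q N 0 = 0 /\ q1 N 0 = 0,
    forall M, \sum_(0 <= n < M) mun n * nrm (l n) (fun x => a n x - cut N q n x) <= eps &
    forall M, \sum_(0 <= n < M) mun n * nrm (l n) (fun x => a2 n x - cut N q2 n x) <= eps]) ->
  Hmin s l (lift a, lc (-1) (lift a2) 0 (lift a2)).
Proof.
move=> ha La La2 approx; apply: closureK => /=; [exact: H0_L2|exact: La|exact: L2_lc|move=> eps e0].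
have [N [q [q1 [q2 [hq [z0 z1] b b2]]]]] := approx eps e0.
exists (lift (cut N q), lc (-1) (lift (cut N q2)) 0 (lift (cut N q2))); split.
- exact: cut_Hmin hq z0 z1.
- apply: sqn_le => M /=; apply: le_trans (b M); apply: ler_sum => n _.
  rewrite (_ : lc _ _ _ _ = lift (fun n x => a n x - cut N q n x)) ?lnrm_lift //.
  by apply: efun_ext => e x; rewrite /lc /lift mul1r mulN1r.
- apply: sqn_le => M /=; apply: le_trans (b2 M); apply: ler_sum => n _.
  rewrite (_ : lc _ _ _ _ = lift (fun n x => - (a2 n x - cut N q2 n x))) ?lnrm_lift; last first.
    by apply: efun_ext => e x; rewrite /lc /lift; ring.
  rewrite (_ : nrm _ _ = nrm (l n) (fun x => a2 n x - cut N q2 n x)) //.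
  by apply: eq_Rint => x _; rewrite normcN2.
Qed.

Lemma split_sum_le (F p q : nat -> R) N A B : (forall n, 0 <= q n) ->
  (forall n, (n < N)%N -> F n = p n) -> (forall n, (N <= n)%N -> F n = q n) -> (forall n, 0 <= p n) ->
  \sum_(0 <= n < N) p n <= A -> (forall M, (N <= M)%N -> \sum_(N <= n < M) q n <= B) ->
  forall M, \sum_(0 <= n < M) F n <= A + B.
Proof.
move=> q0 Fp Fq p0 hA hB M.
have FE m : (m <= N)%N -> \sum_(0 <= n < m) F n = \sum_(0 <= n < m) p n.
  by move=> mN; apply: eq_big_nat => n /andP[_ nm]; rewrite Fp // (leq_trans nm).
have B0 : 0 <= B by have := hB N (leqnn N); rewrite big_geq.
have [MN|NM] := leqP M N.
  rewrite FE //; apply: (@le_trans _ _ A); last by rewrite lerDl.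
  by apply: le_trans hA; rewrite [leRHS](big_cat_nat (leq0n M) MN) /= lerDl sumr_ge0.
rewrite (big_cat_nat (leq0n N) (ltnW NM)) /= FE //; apply: lerD => //.
apply: le_trans (hB M (ltnW NM)); rewrite le_eqVlt; apply/orP; left; apply/eqP.
by apply: eq_big_nat => n /andP[Nn _]; exact: Fq.
Qed.

End LayeredSolutions.

(** * Infinite volume *)

Section RadialReduction.
Context {R : realType}.
Variables (s : nat -> nat) (l : nat -> R).
Hypothesis l_gt0 : forall n, 0 < l n.
Hypothesis s_ge1 : forall n, (1 <= s n)%N.
Local Notation efun := (efun R s).
Local Notation lift := (@lift R s).
Implicit Types (p : efun * efun) (f : efun).

(** f is the sum of its radial average and a part with zero averages, which is already in the
    closure. *)
Lemma Hmin_of_radial p f f1 f2 : L2 l p.1 -> L2 l p.2 -> hrep l f f1 f2 ->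
  aeq l p.1 f -> aeq l p.2 (lc (-1) f2 0 f2) ->
  Hmin s l (lift (psym f), lc (-1) (lift (psym f2)) 0 (lift (psym f2))) -> Hmin s l p.
Proof.
move=> L1 L2' hf e1 e2 B; have [W K Lf Lf2] := hf.
have A := nonradial_Hmin l_gt0 s_ge1 hf.
have := Hmin_lc l_gt0 1 1 A B; set r := plc _ _ _ _ => Hr.
have r1 : r.1 = f by apply: efun_ext => e x; rewrite /r /plc /lc /=; ring.
have r2 : r.2 = lc (-1) f2 0 f2 by apply: efun_ext => e x; rewrite /r /plc /lc /=; ring.
apply: closureK; [exact: H0_L2|exact: L1|exact: L2'|move=> eps eps0]; exists r; split; [exact: Hr| |].
- by rewrite r1; have [_ ->] := aeq_sqn L1 (L2_eL2 Lf) e1; exact: ltW.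
- rewrite r2; have [_ ->] := aeq_sqn L2' (L2_eL2 (L2_lc (-1) 0 Lf2 Lf2)) e2; exact: ltW.
Qed.

End RadialReduction.

Section InfiniteVolume.
Context {R : realType}.
Variables (s : nat -> nat) (l : nat -> R).
Hypothesis l_gt0 : forall n, 0 < l n.
Hypothesis s_ge1 : forall n, (1 <= s n)%N.
Notation C := R[i].
Notation Re := complex.Re.
Notation Im := complex.Im.
Notation normc := ComplexField.Normc.normc.
Local Notation efun := (efun R s).
Local Notation mun := (@mun R s).
Local Notation rprof := (@rprof R s l).
Local Notation lift := (@lift R s).
Implicit Types (a b u q : nat -> R -> C) (N M : nat) (eps : R) (c z : C).

Lemma complex_am_gm (t : R) c z : 0 < t -> 2 * Re (conjc c * z) <= t * normc c ^+ 2 + normc z ^+ 2 / t.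
Proof.
move=> t0; rewrite -(ler_pM2l t0) mulrDr [t * (_ / t)]mulrC divfK ?gt_eqF //.
rewrite !normc2 !cE; case: c z => [a b] [d e] /=.
by have := sqr_ge0 (t * a - d); have := sqr_ge0 (t * b - e); nra.
Qed.

(** Absorption: half of [c2 * M] remains on the left, against 2 e from the quotient and e from
    [T]. *)
Lemma ratio_bound (M T X c2 e : R) : 0 < M -> T <= e -> X / M <= e ->
  2 * (c2 * M) <= M / 2 * c2 + X / (M / 2) + (T + c2 * M) -> c2 * M <= 6 * e.
Proof.
move=> M0 h1 h2; have -> : X / (M / 2) = 2 * (X / M) by field; lra.
by move: (X / M) h2 => Y h2; lra.
Qed.

Hypothesis vol_infty : forall B, exists M, B < \sum_(0 <= n < M) mun n * l n.

Lemma radial_Hmin_infinite a a1 a2 : rprof a a1 a2 -> L2 l (lift a) -> L2 l (lift a2) ->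
  Hmin s l (lift a, lc (-1) (lift a2) 0 (lift a2)).
Proof.
move=> ha La La2; have [u [u1 [y [y1 [hu hy ur u1r]]]]] := growing_solution l_gt0 s_ge1.
have mu0 n := ltW (@mun_gt0 R s s_ge1 n).
pose k n x := a n x - a2 n x.
have ck n : cL2 (l n) (k n).
  have [ca _ c2] := rprof_cL2 l_gt0 n ha.
  by apply: (eq_cL2 _ (cL2_lin 1 (-1) ca c2)) => x _; rewrite mul1r mulN1r.
have cu n : cL2 (l n) (u n) by have [] := rprof_cL2 l_gt0 n hu.
pose tau n := mun n * nrm (l n) (k n); pose m n := mun n * nrm (l n) (u n).
have tau0 n : 0 <= tau n by rewrite mulr_ge0 ?nrm_ge0.
have m0 n : 0 <= m n by rewrite mulr_ge0 ?nrm_ge0.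
have [B hB] : exists B, forall N, \sum_(0 <= n < N) tau n <= B.
  have /L2P[_ [B hB]] := L2_lc 1 (-1) La La2; exists B => N; apply: le_trans (hB N).
  apply: ler_sum => n _; rewrite (_ : lc _ _ _ _ = lift k) ?lnrm_lift //.
  by apply: efun_ext => e x; rewrite /lc /lift /k mul1r mulN1r.
(* By [rgreen], the products X N = (k, u) and V N = (u, u) over the first N layers are minus the
   weighted Wronskians of a and of y with u at S_N. *)
pose X N := \sum_(0 <= n < N) (mun n)%:C * ip (l n) (k n) (u n).
pose V N := \sum_(0 <= n < N) m n.
have XE N : - X N = (mun N)%:C * (a1 N 0 * conjc (u N 0) - a N 0 * conjc (u1 N 0)).
  rewrite -(rgreen l_gt0 N ha hu) /X -sumrN; apply: eq_bigr => n _; rewrite -mulrN; congr (_ * _).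
  have [ca _ c2] := rprof_cL2 l_gt0 n ha.
  rewrite (_ : ip _ (k n) _ = 1 * ip (l n) (a n) (u n) + -1 * ip (l n) (a2 n) (u n)); first by ring.
  by rewrite -(ip_lin 1 (-1) ca c2 (cu n)); apply: eq_cint => x _; rewrite /k mul1r mulN1r.
have VE N : - (V N)%:C = (mun N)%:C * (y1 N 0 * conjc (u N 0) - y N 0 * conjc (u1 N 0)).
  rewrite -(rgreen l_gt0 N hy hu) /V rmorph_sum -sumrN; apply: eq_bigr => n _.
  have [cy _ _] := rprof_cL2 l_gt0 n hy.
  rewrite (_ : ip _ (fun x => y n x - u n x) _ = 1 * ip (l n) (y n) (u n) + -1 * ip (l n) (u n) (u n)).
    by rewrite ipff // /m rmorphM /=; ring.
  by rewrite -(ip_lin 1 (-1) cy (cu n) (cu n)); apply: eq_cint => x _; rewrite mul1r mulN1r.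
apply: (radial_Hmin l_gt0 s_ge1 ha La La2) => eps eps0.
(* The error in (1 + H) a will be at most 7 units; recovering the error in a2 costs 2 * 7 + 2 * 7 =
   28. *)
have e0 : 0 < eps / 28 by lra.
have [N1 tail] := series_tail tau0 hB e0.
(* Since u >= 1, the volume bounds V N from below. It is made large compared with the contribution
   of the first N1 layers to X N, which is fixed. *)
have [N2 hN2] := vol_infty (normc (X N1) ^+ 2 / (eps / 28)).
pose N := maxn N1 N2.
have VN : normc (X N1) ^+ 2 / (eps / 28) < V N.
  apply: (lt_le_trans hN2); rewrite /V (big_cat_nat (leq0n N2) (leq_maxr N1 N2)) /=.
  apply: (@le_trans _ _ (\sum_(0 <= n < N2) m n)); last by rewrite lerDl sumr_ge0.
  apply: ler_sum => n _; apply: ler_wpM2l => //; rewrite -[leLHS]mul1r.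
  apply: (nrm_ge_bounded (ltW (l_gt0 n)) (cu n)) => x /andP[x0 _].
  have [r r1 ->] := ur n x x0; rewrite normc2 /= expr0n addr0.
  by rewrite expr_ge1 // (le_trans ler01).
have V0 : 0 < V N by apply: le_lt_trans VN; rewrite divr_ge0 ?sqr_ge0 ?ltW.
(* [c] and [d] are chosen such that [a - c y - d u] vanishes with its derivative at S_N. With this
   function cut off at S_N as approximant, 1 + H maps the error to [c u] on the layers before N. *)
pose c := X N / (V N)%:C.
have VC0 : (V N)%:C != 0 :> C by rewrite eq_complex /= gt_eqF.
have cE' : X N = c * (V N)%:C by rewrite mulfVK.
have [r r1 ur0] := ur N 0 (lexx 0).
have uN0 : u N 0 != 0 by rewrite ur0 eq_complex /= gt_eqF // (lt_le_trans ltr01).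
pose d := (a N 0 - c * y N 0) / u N 0.
have hq := rprof_lc l_gt0 1 (- d) (rprof_lc l_gt0 1 (- c) ha hy) hu.
have q0 : 1 * (1 * a N 0 + - c * y N 0) + - d * u N 0 = 0.
  by rewrite /d !mul1r !mulNr mulfVK // subrr.
(* The choice of [c] makes the Wronskian of a - c y with u vanish at S_N. As u is nonzero there,
   removing the value by [d u] removes the slope as well. *)
have q10 : 1 * (1 * a1 N 0 + - c * y1 N 0) + - d * u1 N 0 = 0.
  have h : (a1 N 0 - c * y1 N 0) * u N 0 = (a N 0 - c * y N 0) * u1 N 0.
    apply: (mulfI (@munC_neq0 R s s_ge1 N)).
    have := XE N; have := VE N; rewrite u1r ur0 conjc_real cE' => h1 h2.
    apply: subr0_eq; rewrite -mulrBr.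
    transitivity ((mun N)%:C * (a1 N 0 * r%:C - a N 0 * u1 N 0) - c * ((mun N)%:C * (y1 N 0 * r%:C - y N 0 * u1 N 0))).
      by ring.
    by rewrite -h1 -h2; ring.
  have dE : d * u N 0 = a N 0 - c * y N 0 by rewrite mulfVK.
  apply: (mulIf uN0); rewrite mul0r.
  transitivity ((a1 N 0 - c * y1 N 0) * u N 0 - d * u N 0 * u1 N 0); first by ring.
  by rewrite h dE subrr.
have [Lq Lq2] := Hmin_L2 (cut_Hmin l_gt0 s_ge1 hq q0 q10); rewrite /= in Lq.
pose q n x := 1 * (1 * a n x + - c * y n x) + - d * u n x.
pose q2 n x := 1 * (1 * a2 n x + - c * (y n x - u n x)) + - d * u n x.
have hg := rprof_lc l_gt0 1 (-1) ha (cut_rprof l_gt0 hq q0 q10).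
(* |c|^2 V N equals Re (conj c X N). Split at N1, its first part is small against V N and the second
   is bounded by the tail of k. *)
have cV : normc c ^+ 2 * V N <= 6 * (eps / 28).
  apply: (@ratio_bound _ (\sum_(N1 <= n < N) tau n) (normc (X N1) ^+ 2)); [exact: V0|exact/tail/leqnn| |].
    by rewrite ler_pdivrMr // -ler_pdivrMl // mulrC ltW.
  have XN : X N = X N1 + \sum_(N1 <= n < N) (mun n)%:C * ip (l n) (k n) (u n).
    by rewrite /X (big_cat_nat (leq0n N1) (leq_maxl N1 N2)).
  have cX : normc c ^+ 2 * V N = Re (conjc c * X N).
    by rewrite cE' mulrA (mulrC (conjc c)) mul_conjc -rmorphM.
  have -> : 2 * (normc c ^+ 2 * V N) = 2 * Re (conjc c * X N1) +
      2 * Re (conjc c * \sum_(N1 <= n < N) (mun n)%:C * ip (l n) (k n) (u n)).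
    by rewrite cX XN [X in Re X]mulrDr ReD mulrDr.
  apply: lerD; first exact: (complex_am_gm c (X N1) (divr_gt0 V0 (ltr0n R 2))).
  apply: (@le_trans _ _ (\sum_(N1 <= n < N) (tau n + normc c ^+ 2 * m n))).
    rewrite mulr_sumr Re_sum mulr_sumr; apply: ler_sum => n _.
    have -> : tau n + normc c ^+ 2 * m n = mun n * (nrm (l n) (k n) + normc c ^+ 2 * nrm (l n) (u n)).
      by rewrite /tau /m; ring.
    rewrite mulrCA ReCM mulrCA ler_wpM2l //; exact: ip_am_gm.
  rewrite big_split /= -mulr_sumr lerD2l; apply: ler_wpM2l; first exact: sqr_ge0.
  by rewrite /V [leRHS](big_cat_nat (leq0n N1) (leq_maxl N1 N2)) /= lerDr sumr_ge0.
pose g n x := 1 * a n x + -1 * cut N q n x; pose g2 n x := 1 * a2 n x + -1 * cut N q2 n x.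
have gk M : \sum_(0 <= n < M) mun n * nrm (l n) (fun x => g n x - g2 n x) <= 7 * (eps / 28).
  (* Before S_N the error in (1 + H) a is [c u], worth 6 units; beyond, it is the tail of k, worth
     one. *)
  have -> : 7 * (eps / 28) = 6 * (eps / 28) + eps / 28 by field.
  apply: (@split_sum_le _ _ (fun n => normc c ^+ 2 * m n) tau N) => //.
  - move=> n nN; rewrite /m mulrCA; congr (_ * _); rewrite -nrmZ //; apply: eq_nrm => x _.
    by rewrite /g /g2 /cut nN /q /q2; ring.
  - move=> n Nn; congr (_ * _); apply: eq_nrm => x _; rewrite /g /g2 /cut ltnNge Nn /k; ring.
  - by move=> n; rewrite mulr_ge0 ?sqr_ge0.
  - by rewrite -mulr_sumr.
  - by move=> M' NM; apply: tail; exact: leq_maxl.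
have Lg : L2 l (lift g) by exact: (L2_lc 1 (-1) La Lq).
have gb := radial_coercive l_gt0 s_ge1 vol_infty hg Lg gk.
exists N, q, (fun n x => 1 * (1 * a1 n x + - c * y1 n x) + - d * u1 n x), q2; split; [exact: hq|by split|move=> M|move=> M].
  apply: (@le_trans _ _ (7 * (eps / 28))); last lra.
  apply: le_trans (gb M); apply: ler_sum => n _; rewrite ler_wpM2l // le_eqVlt; apply/orP; left; apply/eqP.
  by apply: eq_nrm => x _; rewrite mul1r mulN1r.
have [cg _ cg2] := rprof_eL2 l_gt0 hg.
(* g2 = g - (g - g2), where g is controlled by coercivity and g - g2 directly. *)
apply: (@le_trans _ _ (2 * (7 * (eps / 28)) + 2 * (7 * (eps / 28)))); last lra.
apply: (le_trans _ (lerD (ler_wpM2l (ler0n R 2) (gb M)) (ler_wpM2l (ler0n R 2) (gk M)))).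
rewrite !mulr_sumr -big_split /=; apply: ler_sum => n _.
rewrite !(mulrCA 2) -mulrDr ler_wpM2l //.
have [c1 _ c2] := rprof_cL2 l_gt0 n hg.
have c3 : cL2 (l n) (fun x => g n x - g2 n x).
  have L (z w : C) : 1 * z + -1 * w = z - w by rewrite mul1r mulN1r.
  by apply: (eq_cL2 _ (cL2_lin 1 (-1) c1 c2)) => x _; exact: L.
have := nrm_lin 1 (-1) c1 c3.
rewrite normcN2 !ComplexField.Normc.normc1 expr1n !mulr1; apply: le_trans.
rewrite le_eqVlt; apply/orP; left; apply/eqP; apply: eq_nrm => x _; rewrite /g /g2; ring.
Qed.

Lemma Hmax_Hmin_infinite : @Hmax R s l `<=` Hmin s l.
Proof.
move=> p Hp; have [f [f1 [f2 [hf e1 e2]]]] := HmaxE l_gt0 Hp.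
have [L1 L2' _] := Hp; have [W K Lf Lf2] := hf.
have [_ _ Lp Lp2] := hrep_psym l_gt0 s_ge1 hf.
apply: (Hmin_of_radial l_gt0 s_ge1 L1 L2' hf e1 e2).
exact: (radial_Hmin_infinite (psym_rprof l_gt0 s_ge1 W K) Lp Lp2).
Qed.

Lemma Hmin_self_adjoint : self_adjoint l (Hmin s l).
Proof.
split; first exact: Hmin_dense.
rewrite adjoint_Hmin //; apply/seteqP; split; [exact: Hmax_Hmin_infinite|exact: Hmin_Hmax].
Qed.

End InfiniteVolume.

(** * Boundary values in finite volume *)

Section ComplexLimits.
Context {R : realType}.
Notation C := R[i].
Notation Re := complex.Re.
Notation Im := complex.Im.
Notation normc := ComplexField.Normc.normc.
Implicit Types (c z w : C) (x l : R) (u v : nat -> C).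

Lemma normc_ge0 z : 0 <= normc z. Proof. by case: z => a b; exact: sqrtr_ge0. Qed.

Lemma normcD z w : normc (z + w) <= normc z + normc w.
Proof. exact: le_normcD. Qed.

Lemma normcN z : normc (- z) = normc z.
Proof. exact: normcN. Qed.

Lemma normcB z w : normc (z - w) = normc (w - z).
Proof. by rewrite -normcN opprB. Qed.

Lemma normc_le_ReIm z : normc z <= `|Re z| + `|Im z|.
Proof.
rewrite -(@ler_pXn2r _ 2) ?nnegrE ?normc_ge0 ?addr_ge0 //.
rewrite normc2 -(real_normK (num_real (Re z))) -(real_normK (num_real (Im z))).
by have := mulr_ge0 (normr_ge0 (Re z)) (normr_ge0 (Im z)); nra.
Qed.

Lemma Re_le_normc z : `|Re z| <= normc z.
Proof.
by rewrite -(@ler_pXn2r _ 2) ?nnegrE ?normc_ge0 // normc2 real_normK ?num_real // lerDl sqr_ge0.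
Qed.

Lemma Im_le_normc z : `|Im z| <= normc z.
Proof.
by rewrite -(@ler_pXn2r _ 2) ?nnegrE ?normc_ge0 // normc2 real_normK ?num_real // lerDr sqr_ge0.
Qed.

Lemma normc_real (r : R) : 0 <= r -> normc r%:C = r.
Proof. by move=> r0; rewrite /= expr0n addr0 sqrtr_sqr ger0_norm. Qed.

Lemma ccv_mul u v z w : ccv u z -> ccv v w -> ccv (fun n => u n * v n) (z * w).
Proof.
move=> [u1 u2] [v1 v2]; split; rewrite !cE.
  under eq_fun do rewrite ReM; by apply: cvgB; apply: cvgM.
under eq_fun do rewrite ImM; by apply: cvgD; apply: cvgM.
Qed.

(** Young's inequality against the constant 1 gives a bound linear in nrm and l, which weighted by
    [mun] is summable for square integrable f in finite volume. *)
Lemma cint_norm_le x l (f : R -> C) : 0 <= x <= l -> cL2 l f -> normc (cint `[0, x] f) <= nrm l f + l.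
Proof.
move=> xl hf; have [x0 lx] := andP xl; have hx := cL2S lx hf.
have c1 : cL2 x (fun=> 1 : C) by exact: (W1_cL2 x0 (W1_cst 1 x0)).
have -> : cint `[0, x] f = ip x f (fun=> 1) by apply: eq_cint => y _; rewrite conjc1 mulr1.
have n1 : nrm x (fun=> 1 : C) <= 1 * x.
  by apply: nrm_le_bounded => // y _; rewrite ComplexField.Normc.normc1 expr1n.
have n2 := nrm_mono xl hf.
have h1 := ip_young ltr01 hx c1; have h2 := ip_young_Im ltr01 hx c1.
have := normc_le_ReIm (ip x f (fun=> 1)); rewrite invr1 !mul1r in h1 h2 n1; lra.
Qed.

End ComplexLimits.

Section FiniteVolume.
Context {R : realType}.
Variables (s : nat -> nat) (l : nat -> R).
Hypothesis l_gt0 : forall n, 0 < l n.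
Hypothesis s_ge1 : forall n, (1 <= s n)%N.
Notation C := R[i].
Notation Re := complex.Re.
Notation Im := complex.Im.
Notation normc := ComplexField.Normc.normc.
Local Notation efun := (efun R s).
Local Notation mun := (@mun R s).
Local Notation rprof := (@rprof R s l).
Local Notation lift := (@lift R s).
Implicit Types (a b u q z w : nat -> R -> C) (N M n : nat) (eps : R) (p : efun * efun) (f g : efun).

(** Convergence as t tends to the height, expressed layer by layer and uniformly within a layer. *)
Definition rlim z (zeta : C) : Prop := forall eps, 0 < eps ->
  exists N, forall n x, (N <= n)%N -> 0 <= x <= l n -> normc (z n x - zeta) <= eps.

Lemma rlim_ccv z (zeta : C) : rlim z zeta -> ccv (fun n => z n 0) zeta.
Proof.
move=> h; split; apply/cvgrPdist_le => eps e0; have [N hN] := h eps e0; near=> n;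
  have Nn : (N <= n)%N by [near: n; exact: nbhs_infty_ge];
  have := hN n 0 Nn; rewrite lexx (ltW (l_gt0 n)) normcB => /(_ isT); apply: le_trans.
- by have := Re_le_normc (zeta - z n 0); rewrite !cE.
- by have := Im_le_normc (zeta - z n 0); rewrite !cE.
Unshelve. all: by end_near. Qed.

(** Summable oscillations make the values at the spheres a Cauchy sequence and bound the deviation
    inside each layer. *)
Lemma rlim_exists z (tau : nat -> R) T : (forall n x, 0 <= x <= l n -> normc (z n x - z n 0) <= tau n) ->
  (forall n, z n (l n) = z n.+1 0) -> (forall N, \sum_(0 <= n < N) tau n <= T) -> exists zeta, rlim z zeta.
Proof.
move=> hz ez hT.
have t0 n : 0 <= tau n.
  by apply: le_trans (normc_ge0 (z n 0 - z n 0)) (hz n 0 _); rewrite lexx ltW.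
have step n : normc (z n.+1 0 - z n 0) <= tau n by rewrite -ez; apply: hz; rewrite lexx andbT ltW.
have [al hal] : exists al : R, Re (z n 0) @[n --> \oo] --> al.
  have /cvg_ex[al hal] : cvgn (series (fun n => Re (z n.+1 0 - z n 0))).
    by apply: (series_dominated_cvg (v := tau) _ hT) => n; exact: le_trans (Re_le_normc _) (step n).
  exists (Re (z 0%N 0) + al); rewrite (_ : (fun n => _) = (fun n => Re (z 0%N 0) + series (fun n => Re (z n.+1 0 - z n 0)) n)).
    by apply: cvgD => //; exact: cvg_cst.
  apply/funext => n; rewrite /series /=; elim: n => [|n IH]; first by rewrite big_geq ?addr0.
  by rewrite big_nat_recr //= addrA -IH !cE; ring.
have [be hbe] : exists be : R, Im (z n 0) @[n --> \oo] --> be.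
  have /cvg_ex[be hbe] : cvgn (series (fun n => Im (z n.+1 0 - z n 0))).
    by apply: (series_dominated_cvg (v := tau) _ hT) => n; exact: le_trans (Im_le_normc _) (step n).
  exists (Im (z 0%N 0) + be); rewrite (_ : (fun n => _) = (fun n => Im (z 0%N 0) + series (fun n => Im (z n.+1 0 - z n 0)) n)).
    by apply: cvgD => //; exact: cvg_cst.
  apply/funext => n; rewrite /series /=; elim: n => [|n IH]; first by rewrite big_geq ?addr0.
  by rewrite big_nat_recr //= addrA -IH !cE; ring.
exists (al +i* be) => eps e0; have e4 : 0 < eps / 4 by lra.
have [N1 tail] := series_tail t0 hT e4.
have /cvgrPdist_le /(_ _ e4) [N2 _ h2] := hal; have /cvgrPdist_le /(_ _ e4) [N3 _ h3] := hbe.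
exists (maxn N1 (maxn N2 N3)) => n x; rewrite !geq_max => /and3P[n1 n2 n3] hx.
have k1 := h2 n n2; have k2 := h3 n n3; rewrite /= in k1 k2.
have k3 := tail n n.+1 n1; rewrite big_nat1 in k3.
have k4 := hz n x hx.
have -> : z n x - (al +i* be) = (z n x - z n 0) + (z n 0 - (al +i* be)) by ring.
apply: le_trans (normcD _ _) _; have := normc_le_ReIm (z n 0 - (al +i* be)).
by rewrite !cE /= -!(distrC al) -!(distrC be); lra.
Qed.

Lemma rlim_lin (c d : C) z w (zeta xi : C) : rlim z zeta -> rlim w xi ->
  rlim (fun n x => c * z n x + d * w n x) (c * zeta + d * xi).
Proof.
move=> hz hw eps e0; pose K := normc c + normc d + 1.
have K0 : 0 < K by rewrite /K; have := normc_ge0 c; have := normc_ge0 d; lra.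
have e1 : 0 < eps / K by exact: divr_gt0.
have [N1 h1] := hz _ e1; have [N2 h2] := hw _ e1.
exists (maxn N1 N2) => n x; rewrite geq_max => /andP[n1 n2] hx.
have -> : c * z n x + d * w n x - (c * zeta + d * xi) = c * (z n x - zeta) + d * (w n x - xi) by ring.
apply: le_trans (normcD _ _) _; rewrite !ComplexField.Normc.normcM.
have := ler_wpM2l (normc_ge0 c) (h1 n x n1 hx); have := ler_wpM2l (normc_ge0 d) (h2 n x n2 hx).
have : (normc c + normc d) * (eps / K) <= eps.
  rewrite mulrCA ler_piMr ?(ltW e0) // ler_pdivrMr // mul1r /K; lra.
move: (normc (z n x - zeta)) (normc (w n x - xi)) => A B; lra.
Qed.

Lemma eq_rlim z w (zeta : C) : (forall n x, 0 <= x <= l n -> z n x = w n x) -> rlim z zeta -> rlim w zeta.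
Proof. by move=> E h eps e0; have [N hN] := h eps e0; exists N => n x Nn hx; rewrite -E //; exact: hN. Qed.

Lemma rlim_cst (c : C) : rlim (fun _ _ => c) c.
Proof. by move=> eps e0; exists 0%N => n x _ _; rewrite subrr ComplexField.Normc.normc0 ltW. Qed.

Definition bvals a a1 (al be : C) : Prop := rlim a al /\ rlim (fun n x => (mun n)%:C * a1 n x) be.

Lemma bvals_lin (c d : C) a a1 b b1 al be al' be' : bvals a a1 al be -> bvals b b1 al' be' ->
  bvals (fun n x => c * a n x + d * b n x) (fun n x => c * a1 n x + d * b1 n x) (c * al + d * al') (c * be + d * be').
Proof.
move=> [h1 h2] [k1 k2]; split; first exact: rlim_lin.
by apply: (eq_rlim _ (rlim_lin c d h2 k2)) => n x _; ring.
Qed.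

Variable V : R.
Hypothesis vol_fin : forall N, \sum_(0 <= n < N) mun n * l n <= V.

Lemma mun_ge1 n : 1 <= mun n.
Proof. by have : 1 <= (s n * s n.+1)%N%:R :> R by rewrite ler1n muln_gt0 !s_ge1. Qed.

Lemma sum_l N : \sum_(0 <= n < N) l n <= V.
Proof.
apply: le_trans (vol_fin N); apply: ler_sum => n _.
by rewrite ler_peMl ?mun_ge1 // ltW.
Qed.

(** The oscillation of [mun] times a1 on a layer is at most [tau n], summable because the volume is
    finite. So the weighted slope is bounded, hence also the slope since [mun] >= 1, and the
    oscillation of a is then at most a constant times l n. *)
Lemma bvals_exists a a1 a2 : rprof a a1 a2 -> L2 l (lift a2) -> exists al be, bvals a a1 al be.
Proof.
move=> ha /L2P[_ [S hS]]; have [w e f z] := ha.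
pose tau n := mun n * (nrm (l n) (a2 n) + l n).
have hT N : \sum_(0 <= n < N) tau n <= S + V.
  rewrite /tau (eq_bigr (fun n => lnrm l (lift a2) n + mun n * l n)) => [|n _]; last by rewrite lnrm_lift mulrDr.
  by rewrite big_split /=; apply: lerD.
have t0 n : 0 <= tau n by rewrite mulr_ge0 ?addr_ge0 ?nrm_ge0 // ltW // mun_gt0.
have m0 n : 0 <= mun n by rewrite ltW // mun_gt0.
have d1 n x : 0 <= x <= l n -> normc ((mun n)%:C * a1 n x - (mun n)%:C * a1 n 0) <= tau n.
  move=> hx; have [_ _ c2] := rprof_cL2 l_gt0 n ha; have [_ w2] := w n.
  rewrite -mulrBr (W1_eq_fst w2 hx) addrC addKr ComplexField.Normc.normcM normc_real //.
  by rewrite ler_wpM2l // cint_norm_le.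
have [be hbe] := rlim_exists (z := fun n x => (mun n)%:C * a1 n x) d1 f hT.
have b0 n : normc ((mun n)%:C * a1 n 0) <= \sum_(0 <= k < n) tau k.
  elim: n => [|n IH]; first by rewrite z mulr0 ComplexField.Normc.normc0 big_geq.
  rewrite -f big_nat_recr //=; have ln : 0 <= l n <= l n by rewrite lexx andbT ltW.
  apply: le_trans (lerD IH (d1 n (l n) ln)); rewrite (le_trans _ (normcD _ _)) //.
  by rewrite addrC subrK.
have T0 : 0 <= S + V by have := hT 0%N; rewrite big_geq.
have b1 n x : 0 <= x <= l n -> normc (a1 n x) <= S + V.
  move=> hx; apply: (@le_trans _ _ (normc ((mun n)%:C * a1 n x))).
    by rewrite ComplexField.Normc.normcM normc_real // ler_peMl ?normc_ge0 // mun_ge1.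
  have -> : (mun n)%:C * a1 n x = (mun n)%:C * a1 n 0 + ((mun n)%:C * a1 n x - (mun n)%:C * a1 n 0) by ring.
  apply: le_trans (normcD _ _) _; apply: le_trans (lerD (b0 n) (d1 n x hx)) _.
  by have := hT n.+1; rewrite big_nat_recr.
have d0 n x : 0 <= x <= l n -> normc (a n x - a n 0) <= ((S + V) ^+ 2 + 1) * l n.
  move=> hx; have [_ c1 _] := rprof_cL2 l_gt0 n ha; have [w1 _] := w n.
  rewrite (W1_eq_fst w1 hx) addrC addKr mulrDl mul1r.
  apply: le_trans (cint_norm_le hx c1) _; rewrite lerD2r; apply: nrm_le_bounded => //; first exact/ltW.
  by move=> y hy; rewrite ler_pXn2r ?nnegrE ?normc_ge0 //; exact: b1.
have hT' N : \sum_(0 <= n < N) ((S + V) ^+ 2 + 1) * l n <= ((S + V) ^+ 2 + 1) * V.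
  by rewrite -mulr_sumr ler_wpM2l ?sum_l // addr_ge0 ?sqr_ge0.
by have [al hal] := rlim_exists d0 e hT'; exists al, be.
Qed.

Lemma L2_bounded z (K : R) N : eL2 l (lift z) -> 0 <= K ->
  (forall n x, (N <= n)%N -> 0 <= x <= l n -> normc (z n x) <= K) -> L2 l (lift z).
Proof.
move=> cz K0 hz; apply/L2P; split; first exact: cz.
have bd n : (N <= n)%N -> lnrm l (lift z) n <= K ^+ 2 * (mun n * l n).
  move=> Nn; rewrite lnrm_lift mulrCA ler_wpM2l ?(ltW (@mun_gt0 R s s_ge1 n)) //.
  apply: nrm_le_bounded; [exact/ltW|exact: (cz (mkedge (Ordinal (s_ge1 n)) (Ordinal (s_ge1 n.+1))))|].
  by move=> x hx; rewrite ler_pXn2r ?nnegrE ?normc_ge0 //; exact: hz.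
exists (\sum_(0 <= n < N) lnrm l (lift z) n + K ^+ 2 * V) => M.
apply: (@split_sum_le _ _ (lnrm l (lift z)) (lnrm l (lift z)) N) => //; try by move=> n; exact: lnrm_ge0.
move=> M' NM; apply: (@le_trans _ _ (\sum_(N <= n < M') K ^+ 2 * (mun n * l n))).
  by rewrite [leLHS]big_nat_cond [leRHS]big_nat_cond; apply: ler_sum => n /andP[/andP[h _] _]; exact: bd.
rewrite -mulr_sumr ler_wpM2l ?sqr_ge0 //; apply: le_trans (vol_fin M').
rewrite [leRHS](big_cat_nat (leq0n N) NM) /= lerDr sumr_ge0 // => n _.
by rewrite mulr_ge0 ?ltW ?mun_gt0.
Qed.

Lemma rlim_L2 z (zeta : C) : eL2 l (lift z) -> rlim z zeta -> L2 l (lift z).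
Proof.
move=> cz hz; have [N hN] := hz 1 ltr01.
apply: (L2_bounded (K := normc zeta + 1) (N := N) cz); first by rewrite addr_ge0 ?normc_ge0.
move=> n x Nn hx; have -> : z n x = (z n x - zeta) + zeta by ring.
by apply: le_trans (normcD _ _) _; have := hN n x Nn hx; lra.
Qed.

Lemma rprof_one : rprof (fun _ _ => 1) (fun _ _ => 0) (fun _ _ => 0).
Proof. by split=> //; [move=> n; split; exact/W1_cst/ltW|move=> n; rewrite !mulr0]. Qed.

Lemma bvals_one : bvals (fun _ _ => 1) (fun _ _ => 0) 1 0.
Proof. by split; [exact: rlim_cst|apply: (eq_rlim _ (rlim_cst 0)) => n x _; rewrite mulr0]. Qed.

Lemma L2_cst (c : C) : L2 l (lift (fun _ _ => c)).
Proof. by apply: (rlim_L2 _ (rlim_cst c)) => e; exact: (W1_cL2 (ltW (elen_gt0 l_gt0 e)) (W1_cst _ (ltW (elen_gt0 l_gt0 e)))). Qed.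

(** H y = 1, so Green's formula against the constant 1 turns the flux through S_N into minus the
    enclosed volume, whose limit is not zero. Together with the constant 1 this function will
    produce all boundary values. *)
Lemma parabola : exists y y1 al be, [/\ rprof y y1 (fun _ _ => -1), bvals y y1 al be, be != 0 &
  forall N, (mun N)%:C * y1 N 0 = - (\sum_(0 <= n < N) mun n * l n)%:C].
Proof.
have l0 n : 0 <= l n by exact: ltW.
have W1' n : W2 (l n) (fun=> 1 : C) (fun=> 0) (fun=> 0) by split; exact: W1_cst.
have Wx n : W2 (l n) (fun x => x%:C) (fun=> 1 : C) (fun=> 0).
  by split; [|exact: W1_cst]; apply: (eq_W1 (l0 n) _ _ (W1_mon 0 (l0 n))) => x _; rewrite ?expr1 // expr0 mulr1.
have W2' n : W2 (l n) (fun x => - 2^-1 * x%:C ^+ 2) (fun x => - x%:C) (fun=> -1 : C).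
  split.
    apply: (eq_W1 (l0 n) _ _ (W1_lin (- 2^-1) 0 (l0 n) (W1_mon 1 (l0 n)) (W1_mon 1 (l0 n)))) => x _ //.
      by rewrite mul0r addr0.
    by rewrite mul0r addr0 expr1; field.
  apply: (eq_W1 (l0 n) _ _ (W1_lin (-1) 0 (l0 n) (Wx n).1 (Wx n).1)) => x _; by rewrite mul0r addr0 ?mulN1r // mulr1.
have D n : [/\ (1 : C) = 1, (0 : C) = 0, ((0 : R)%:C : C) = 0 & (1 : C) = 1] by [].
have D' n : - 2^-1 * (0 : R)%:C ^+ 2 = 0 :> C /\ - (0 : R)%:C = 0 :> C.
  by rewrite expr2 mul0r mulr0 oppr0.
have [A [B [_ _ h]]] := layered l_gt0 s_ge1 0 W1' Wx W2' D D'.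
set y := (fun n x => _) in h; set y1 := (fun n x => _ - _) in h.
have hy : rprof y y1 (fun _ _ => -1).
  by apply: (eq_rprof l_gt0 h) => n x _; rewrite !mulr0 !add0r.
have flux N : (mun N)%:C * y1 N 0 = - (\sum_(0 <= n < N) mun n * l n)%:C :> C.
  have G := rgreen l_gt0 N hy rprof_one; rewrite conjc1 mulr1 conjc0 mulr0 subr0 in G.
  rewrite -G rmorph_sum -sumrN; apply: eq_bigr => n _; rewrite rmorphM -mulrN; congr (_ * _).
  have ln : 0 <= l n <= l n by rewrite lexx andbT ltW.
  have c1 : cL2 (l n) (fun=> 1 : C) by exact: (W1_cL2 (l0 n) (W1_cst 1 (l0 n))).
  have := W1_eq_fst (Wx n).1 ln; rewrite add0r /= => ->; rewrite -(cintN (cL2_cintg c1)).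
  rewrite (_ : ip _ (y n) _ = 0) ?subr0; first by apply: eq_cint => x _; rewrite conjc1 mulr1.
  rewrite (_ : ip _ _ _ = cint `[0, l n] (fun x => 0 * 1)); last by apply: eq_cint => x _; rewrite conjc0 mulr0 mul0r.
  by rewrite (cintZ 0 (cL2_cintg c1)) mul0r.
have [al [be hb]] := bvals_exists hy (L2_cst (-1)).
exists y, y1, al, be.
split; [exact: hy|exact: hb| |exact: flux].
(* If the limit were 0, the flux would eventually be at most half the volume of layer 0 in modulus,
   whereas it always exceeds that of layer 0. *)
apply/eqP => b0; have m0 : 0 < mun 0 * l 0%N by rewrite mulr_gt0 ?mun_gt0.
have [_ /(_ _ (divr_gt0 m0 (ltr0n R 2)))[N hN]] := hb.
have := hN N.+1 0 (leqnSn N); rewrite lexx (ltW (l_gt0 _)) flux b0 subr0 normcN => /(_ isT).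
have le0 n : 0 <= mun n * l n by rewrite mulr_ge0 ?ltW ?mun_gt0.
rewrite normc_real; last exact: sumr_ge0.
rewrite big_nat_recl //=; have : 0 <= \sum_(0 <= i < N) mun i.+1 * l i.+1 by exact: sumr_ge0.
by lra.
Qed.

Lemma small_square (G e : R) : 0 <= G -> 0 < e -> exists2 d : R, 0 < d & d ^+ 2 * G <= e.
Proof.
move=> G0 e0; have K0 : 0 < G + 1 by lra.
have d0 : 0 < Num.min 1 (e / (G + 1)) by rewrite lt_min ltr01 divr_gt0.
exists (Num.min 1 (e / (G + 1))) => //; set d := Num.min _ _ in d0 *.
have h1 : d <= 1 by rewrite ge_min lexx.
have h2 : d * (G + 1) <= e by rewrite -ler_pdivlMr // ge_min lexx orbT.
nra.
Qed.

Lemma scale_bound (x S d P T : R) : 0 <= x -> 0 <= S -> x <= d * P -> S <= T ->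
  2 * x * S <= d * (2 * P * T).
Proof.
move=> x0 S0 h1 h2; have -> : d * (2 * P * T) = 2 * (d * P * T) by ring.
by rewrite -mulrA; apply: ler_wpM2l => //; exact: ler_pM.
Qed.

(** In finite volume y and the constant 1 are square integrable, so a correction c y + dd on the
    first N layers is small once its coefficients are. These are governed by the value and the
    weighted slope of a at S_N, both tending to 0. *)
Lemma radial_Hmin_zero a a1 a2 : rprof a a1 a2 -> L2 l (lift a) -> L2 l (lift a2) -> bvals a a1 0 0 ->
  Hmin s l (lift a, lc (-1) (lift a2) 0 (lift a2)).
Proof.
move=> ha La La2 [ba ba1]; have [y [y1 [aly [bey [hy [by0 by1] _ fy]]]]] := parabola.
have [cy _ _] := rprof_eL2 l_gt0 hy.
have /L2P[_ [Sy hSy]] := rlim_L2 cy by0.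
have /L2P[_ [Sa hSa]] := La; have /L2P[_ [Sa2 hSa2]] := La2.
have mu0 n := ltW (@mun_gt0 R s s_ge1 n).
have v0 : 0 < mun 0 * l 0%N by rewrite mulr_gt0 ?mun_gt0.
pose v := mun 0 * l 0%N; pose K := normc aly + 1.
have K0 : 0 <= K by rewrite addr_ge0 ?normc_ge0.
have Sy0 : 0 <= Sy by have := hSy 0%N; rewrite big_geq.
have V0 : 0 <= V by have := vol_fin 0%N; rewrite big_geq.
apply: (radial_Hmin l_gt0 s_ge1 ha La La2) => eps eps0.
have e2 : 0 < eps / 2 by lra.
(* In units of d^2, [G] bounds the squared norms of the correction and of its second derivative. *)
pose G := 2 * v^-1 ^+ 2 * Sy + 2 * (1 + v^-1 * K) ^+ 2 * V + v^-1 ^+ 2 * V.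
have g1 : 0 <= 2 * v^-1 ^+ 2 * Sy := mulr_ge0 (mulr_ge0 (ler0n R 2) (sqr_ge0 _)) Sy0.
have g2 : 0 <= 2 * (1 + v^-1 * K) ^+ 2 * V := mulr_ge0 (mulr_ge0 (ler0n R 2) (sqr_ge0 _)) V0.
have g3 : 0 <= v^-1 ^+ 2 * V := mulr_ge0 (sqr_ge0 _) V0.
have G0 : 0 <= G := addr_ge0 (addr_ge0 g1 g2) g3.
have [d d0 dG] := small_square G0 e2.
pose ta n := mun n * nrm (l n) (a n); pose ta2 n := mun n * nrm (l n) (a2 n).
have t0 n : 0 <= ta n by rewrite mulr_ge0 ?nrm_ge0.
have t20 n : 0 <= ta2 n by rewrite mulr_ge0 ?nrm_ge0.
have bt N : \sum_(0 <= n < N) ta n <= Sa.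
  by apply: le_trans (hSa N); apply: ler_sum => n _; rewrite lnrm_lift.
have bt2 N : \sum_(0 <= n < N) ta2 n <= Sa2.
  by apply: le_trans (hSa2 N); apply: ler_sum => n _; rewrite lnrm_lift.
have [N1 tail] := series_tail t0 bt e2; have [N2 tail2] := series_tail t20 bt2 e2.
have [N3 h3] := ba _ d0; have [N4 h4] := ba1 _ d0; have [N5 h5] := by0 _ ltr01.
(* A successor, so that the volume before S_N includes layer 0 and is at least [v]. *)
pose N := (maxn N1 (maxn N2 (maxn N3 (maxn N4 N5)))).+1.
have /and5P[n1 n2 n3 n4 n5] : [&& (N1 <= N)%N, (N2 <= N)%N, (N3 <= N)%N, (N4 <= N)%N & (N5 <= N)%N].
  have := leqnSn (maxn N1 (maxn N2 (maxn N3 (maxn N4 N5)))); rewrite -/N !geq_max.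
  by case/and5P => -> -> -> -> ->.
have z0 : 0 <= (0 : R) <= l N by rewrite lexx ltW.
have aN := h3 N 0 n3 z0; rewrite subr0 in aN.
have fN := h4 N 0 n4 z0; rewrite subr0 in fN.
have yN : normc (y N 0) <= K.
  have -> : y N 0 = (y N 0 - aly) + aly by ring.
  by apply: le_trans (normcD _ _) _; have := h5 N 0 n5 z0; rewrite /K; lra.
pose VN := \sum_(0 <= n < N) mun n * l n.
have vN : v <= VN.
  rewrite /VN /N big_nat_recl //= lerDl; apply: sumr_ge0 => n _.
  by rewrite mulr_ge0 ?ltW ?mun_gt0.
have VN0 : 0 < VN by apply: lt_le_trans vN.
(* With this [c] the slope of a - c y vanishes at S_N; the constant [dd] then removes the value. *)
pose c := - ((mun N)%:C * a1 N 0) / VN%:C.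
have VNC : VN%:C != 0 :> C by rewrite eq_complex /= gt_eqF.
have cn : normc c <= d * v^-1.
  rewrite /c ComplexField.Normc.normcM ComplexField.Normc.normcV normcN normc_real ?(ltW VN0) //.
  by apply: ler_pM; rewrite ?normc_ge0 ?invr_ge0 ?(ltW VN0) // lef_pV2.
pose dd := a N 0 - c * y N 0.
have dn : normc dd <= d * (1 + v^-1 * K).
  apply: le_trans (normcD _ _) _; rewrite normcN ComplexField.Normc.normcM mulrDr mulr1; apply: lerD => //.
  by rewrite mulrA; apply: ler_pM; rewrite ?normc_ge0.
have hq := rprof_lc l_gt0 1 (- dd) (rprof_lc l_gt0 1 (- c) ha hy) rprof_one.
have q0 : 1 * (1 * a N 0 + - c * y N 0) + - dd * 1 = 0 by rewrite /dd; ring.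
have q10 : 1 * (1 * a1 N 0 + - c * y1 N 0) + - dd * 0 = 0.
  apply: (mulfI (@munC_neq0 R s s_ge1 N)); rewrite mulr0.
  transitivity ((mun N)%:C * a1 N 0 - c * ((mun N)%:C * y1 N 0)); first by ring.
  by rewrite fy -/VN mulrN opprK /c mulfVK // subrr mulr0.
have cyn n : cL2 (l n) (y n) by have [] := rprof_cL2 l_gt0 n hy.
have c1n n : cL2 (l n) (fun=> 1 : C) by have [] := rprof_cL2 l_gt0 n rprof_one.
have n1V n : mun n * nrm (l n) (fun=> 1 : C) <= mun n * l n.
  rewrite ler_wpM2l // -[leRHS]mul1r; apply: nrm_le_bounded => //; first exact/ltW.
  by move=> x _; rewrite ComplexField.Normc.normc1 expr1n.
have sq1 : normc c ^+ 2 <= d ^+ 2 * v^-1 ^+ 2.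
  by rewrite -exprMn ler_pXn2r ?nnegrE ?normc_ge0 // mulr_ge0 ?invr_ge0 ?ltW.
have sq2 : normc dd ^+ 2 <= d ^+ 2 * (1 + v^-1 * K) ^+ 2.
  rewrite -exprMn ler_pXn2r ?nnegrE ?normc_ge0 // mulr_ge0 ?(ltW d0) //.
  by rewrite addr_ge0 // mulr_ge0 ?invr_ge0 ?(ltW v0).
have d20 := sqr_ge0 d; have w20 := sqr_ge0 v^-1.
exists N, (fun n x => 1 * (1 * a n x + - c * y n x) + - dd * 1), (fun n x => 1 * (1 * a1 n x + - c * y1 n x) + - dd * 0),
  (fun n x => 1 * (1 * a2 n x + - c * (-1)) + - dd * 0).
split; [exact: hq|by split|move=> M|move=> M].
- apply: (@le_trans _ _ (d ^+ 2 * (2 * v^-1 ^+ 2 * Sy + 2 * (1 + v^-1 * K) ^+ 2 * V) + eps / 2)).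
    apply: (@split_sum_le _ _ (fun n => mun n * nrm (l n) (fun x => c * y n x + dd * 1)) ta N) => //.
    + by move=> n nN; congr (_ * _); apply: eq_nrm => x _; rewrite /cut nN; ring.
    + by move=> n Nn; congr (_ * _); apply: eq_nrm => x _; rewrite /cut ltnNge Nn subr0.
    + by move=> n; rewrite mulr_ge0 ?nrm_ge0.
    + apply: (@le_trans _ _ (\sum_(0 <= n < N) (2 * normc c ^+ 2 * lnrm l (lift y) n + 2 * normc dd ^+ 2 * (mun n * l n)))).
        apply: ler_sum => n _; rewrite lnrm_lift.
        apply: (@le_trans _ _ (mun n * (2 * normc c ^+ 2 * nrm (l n) (y n) + 2 * normc dd ^+ 2 * nrm (l n) (fun=> 1 : C)))).
          by rewrite ler_wpM2l //; exact: nrm_lin.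
        rewrite mulrDr; apply: lerD; first by rewrite mulrCA.
        rewrite mulrCA; apply: ler_wpM2l; [exact: (mulr_ge0 (ler0n R 2) (sqr_ge0 _))|exact: n1V].
      rewrite big_split /= -!mulr_sumr mulrDr; apply: lerD.
        apply: (scale_bound (sqr_ge0 _) _ sq1 (hSy N)).
        by apply: sumr_ge0 => n _; exact: lnrm_ge0.
      apply: (scale_bound (sqr_ge0 _) _ sq2 (vol_fin N)).
      by apply: sumr_ge0 => n _; rewrite mulr_ge0 ?ltW ?mun_gt0.
    by move=> M' NM; apply: tail; exact: n1.
  have := mulr_ge0 (sqr_ge0 d) g3.
  by move: dG; rewrite /G; lra.
- apply: (@le_trans _ _ (d ^+ 2 * (v^-1 ^+ 2 * V) + eps / 2)).
    apply: (@split_sum_le _ _ (fun n => mun n * nrm (l n) (fun x => - c * 1)) ta2 N) => //.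
    + by move=> n nN; congr (_ * _); apply: eq_nrm => x _; rewrite /cut nN; ring.
    + by move=> n Nn; congr (_ * _); apply: eq_nrm => x _; rewrite /cut ltnNge Nn subr0.
    + by move=> n; rewrite mulr_ge0 ?nrm_ge0.
    + apply: (@le_trans _ _ (\sum_(0 <= n < N) (normc c ^+ 2 * (mun n * l n)))).
        apply: ler_sum => n _; rewrite nrmZ // normcN mulrCA ler_wpM2l ?sqr_ge0 //.
      rewrite -mulr_sumr mulrA; apply: ler_pM => //; first exact: sqr_ge0.
      by apply: sumr_ge0 => n _; rewrite mulr_ge0 ?ltW ?mun_gt0.
    by move=> M' NM; apply: tail2; exact: n2.
  have := mulr_ge0 (sqr_ge0 d) (addr_ge0 g1 g2).
  by move: dG; rewrite /G; lra.
Qed.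

End FiniteVolume.

(** * The boundary form and its nondegeneracy *)

Section BoundaryForm.
Context {R : realType}.
Variables (s : nat -> nat) (l : nat -> R).
Hypothesis l_gt0 : forall n, 0 < l n.
Hypothesis s_ge1 : forall n, (1 <= s n)%N.
Notation C := R[i].
Notation Re := complex.Re.
Notation Im := complex.Im.
Notation normc := ComplexField.Normc.normc.
Local Notation efun := (efun R s).
Local Notation mun := (@mun R s).
Local Notation rprof := (@rprof R s l).
Local Notation lift := (@lift R s).
Local Notation Hmax := (@Hmax R s l).
Local Notation bvals := (@bvals R s l).
Implicit Types (a b : nat -> R -> C) (N n : nat) (p q r : efun * efun) (f g : efun) (al be c d : C).

(** The boundary form of the maximal operator: skew-Hermitian there, and zero as soon as one
    argument lies in [Hmin]. *)
Definition omega p q : C := inner l p.2 q.1 - inner l p.1 q.2.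

Lemma Hmax_L2 p : Hmax p -> L2 l p.1 /\ L2 l p.2.
Proof. by case. Qed.

Lemma omega_plc c d p q r : Hmax p -> Hmax q -> Hmax r -> omega (plc c p d q) r = c * omega p r + d * omega q r.
Proof.
move=> /Hmax_L2[p1 p2] /Hmax_L2[q1 q2] /Hmax_L2[r1 r2].
by rewrite /omega /= !inner_lcl //; move: (inner _ _ _) (inner _ _ _) (inner _ _ _) (inner _ _ _) => A B D E; ring.
Qed.

Lemma omega_conj p q : Hmax p -> Hmax q -> omega q p = - conjc (omega p q).
Proof.
move=> /Hmax_L2[p1 p2] /Hmax_L2[q1 q2].
by rewrite /omega (innerC p1 q2) (innerC p2 q1) conjcD conjcN opprD opprK addrC.
Qed.

Lemma omega_Hmin p q : Hmin s l p -> Hmax q -> omega p q = 0.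
Proof.
by move=> hp; rewrite -(adjoint_Hmin l_gt0 s_ge1) => -[_ _ h]; rewrite /omega h // subrr.
Qed.

Lemma omega_aeq p p' q : Hmax p -> Hmax p' -> Hmax q -> aeq l p.1 p'.1 -> aeq l p.2 p'.2 -> omega p q = omega p' q.
Proof.
move=> /Hmax_L2[p1 p2] /Hmax_L2[p1' p2'] /Hmax_L2[q1 q2] e1 e2.
by rewrite /omega (inner_aeql p2 p2' q1 e2) (inner_aeql p1 p1' q2 e1).
Qed.

Lemma linp_lift a b n : linp l (lift a) (lift b) n = (mun n)%:C * ip (l n) (a n) (b n).
Proof.
by rewrite /linp /lift /= !sumr_const !card_ord -mulrnA munC -natrM mulnC [RHS]mulr_natl.
Qed.

Lemma eq_bvals a a1 b b1 al be : (forall n x, 0 <= x <= l n -> a n x = b n x) ->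
  (forall n x, 0 <= x <= l n -> a1 n x = b1 n x) -> bvals a a1 al be -> bvals b b1 al be.
Proof.
move=> e e1 [h h1]; split; first exact: eq_rlim e h.
by apply: (eq_rlim _ h1) => n x hx; rewrite e1.
Qed.

Definition rpair a (a2 : nat -> R -> C) : efun * efun := (lift a, lc (-1) (lift a2) 0 (lift a2)).

Lemma rpair_Hmax a a1 a2 : rprof a a1 a2 -> L2 l (lift a) -> L2 l (lift a2) -> Hmax (rpair a a2).
Proof. by move=> h h1 h2; by apply: Hmax_hrep (hrep_lift _ h h1 h2). Qed.

(** The limit of [rgreen] as N grows. *)
Lemma omega_rpair a a1 a2 b b1 b2 al be al' be' : rprof a a1 a2 -> rprof b b1 b2 ->
  L2 l (lift a) -> L2 l (lift a2) -> L2 l (lift b) -> L2 l (lift b2) ->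
  bvals a a1 al be -> bvals b b1 al' be' -> omega (rpair a a2) (rpair b b2) = al * conjc be' - be * conjc al'.
Proof.
move=> ha hb La La2 Lb Lb2 [va va1] [vb vb1].
rewrite /omega /rpair /= inner_scale // inner_scaler // conjcN1.
have h1 := ccv_lin (-1) 1 (inner_ccv La2 Lb) (inner_ccv La Lb2).
have h2 := ccv_lin 1 (-1) (ccv_mul (rlim_ccv l_gt0 va) (ccv_conj (rlim_ccv l_gt0 vb1)))
  (ccv_mul (rlim_ccv l_gt0 va1) (ccv_conj (rlim_ccv l_gt0 vb))).
transitivity (-1 * inner l (lift a2) (lift b) + 1 * inner l (lift a) (lift b2)); first by ring.
rewrite (_ : al * conjc be' - be * conjc al' = 1 * (al * conjc be') + -1 * (be * conjc al')); last by ring.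
apply: (ccv_uniq h1); apply: (ccv_near (N := 0) _ h2) => N _ /=.
rewrite !inner_uptoE; have G := rgreen l_gt0 N ha hb.
rewrite (eq_bigr (fun n => (mun n)%:C * ip (l n) (a2 n) (b n))) => [|n _]; last exact: linp_lift.
rewrite [X in _ = _ + 1 * X](eq_bigr (fun n => (mun n)%:C * ip (l n) (a n) (b2 n))) => [|n _]; last exact: linp_lift.
rewrite (eq_bigr (fun n => (mun n)%:C * ip (l n) (a2 n) (b n) - (mun n)%:C * ip (l n) (a n) (b2 n))) in G; last by move=> n _; rewrite mulrBr.
rewrite sumrB in G; move: G; move: (\sum_(0 <= _ < _) _) (\sum_(0 <= _ < _) _) => S T G.
rewrite mul1r mulN1r -[RHS]opprK opprD mulN1r opprK mul1r G conjcM conjc_real; ring.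
Qed.

(** Boundary values of some representative; that they depend on p alone is [BV_unique]. *)
Definition BV p al be : Prop := Hmax p /\ exists f f1 f2, [/\ hrep l f f1 f2, aeq l p.1 f,
  aeq l p.2 (lc (-1) f2 0 f2) & bvals (psym f) (psym f1) al be].

Lemma BV_rpair a a1 a2 al be : rprof a a1 a2 -> L2 l (lift a) -> L2 l (lift a2) -> bvals a a1 al be ->
  BV (rpair a a2) al be.
Proof.
move=> h h1 h2 v; split; first exact: rpair_Hmax h h1 h2.
exists (lift a), (lift a1), (lift a2); split; [exact: hrep_lift|exact: aeq_refl|exact: aeq_refl|].
by apply: (eq_bvals _ _ v) => n x _; rewrite psym_lift.
Qed.

Lemma BV_plc c d p q al be al' be' : BV p al be -> BV q al' be' ->
  BV (plc c p d q) (c * al + d * al') (c * be + d * be').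
Proof.
move=> [Hp [f [f1 [f2 [hf e1 e2 v]]]]] [Hq [g [g1 [g2 [hg k1 k2 w]]]]].
have h := hrep_lc l_gt0 c d hf hg.
have E2 : lc c (lc (-1) f2 0 f2) d (lc (-1) g2 0 g2) = lc (-1) (lc c f2 d g2) 0 (lc c f2 d g2).
  by apply: efun_ext => e x; rewrite /lc; ring.
have A1 : aeq l (plc c p d q).1 (lc c f d g) by exact: aeq_lc.
have A2 : aeq l (plc c p d q).2 (lc (-1) (lc c f2 d g2) 0 (lc c f2 d g2)) by rewrite -E2; exact: aeq_lc.
split.
  have [p1 p2] := Hmax_L2 Hp; have [q1 q2] := Hmax_L2 Hq.
  split; [exact: L2_lc|exact: L2_lc|].
  have [W K _ _] := h; exists (lc c f d g), (lc c f1 d g1), (lc c f2 d g2); split; [exact: W|exact: K|exact: A1|].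
  by rewrite lcN.
exists (lc c f d g), (lc c f1 d g1), (lc c f2 d g2); split; [exact: h|exact: A1|exact: A2|].
by apply: (eq_bvals _ _ (bvals_lin c d v w)) => n x _; rewrite psym_lc.
Qed.

(** Parts with zero averages lie in [Hmin], which the boundary form annihilates, so both arguments
    may be replaced by their radial parts. *)
Lemma BV_omega p q al be al' be' : BV p al be -> BV q al' be' -> omega p q = al * conjc be' - be * conjc al'.
Proof.
move=> [Hp [f [f1 [f2 [hf e1 e2 v]]]]] [Hq [g [g1 [g2 [hg k1 k2 w]]]]].
have HP := Hmax_hrep hf; have HQ := Hmax_hrep hg.
have [Wf Kf _ _] := hf; have [Wg Kg _ _] := hg.
have [_ _ Lf Lf2] := hrep_psym l_gt0 s_ge1 hf; have [_ _ Lg Lg2] := hrep_psym l_gt0 s_ge1 hg.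
have rf := psym_rprof l_gt0 s_ge1 Wf Kf; have rg := psym_rprof l_gt0 s_ge1 Wg Kg.
have Hf := rpair_Hmax rf Lf Lf2; have Hg := rpair_Hmax rg Lg Lg2.
rewrite -(omega_rpair rf rg Lf Lf2 Lg Lg2 v w).
have red u u1 u2 r : hrep l u u1 u2 -> Hmax (rpair (psym u) (psym u2)) -> Hmax r ->
    omega (u, lc (-1) u2 0 u2) r = omega (rpair (psym u) (psym u2)) r.
  move=> hu Hu Hr; have A := nonradial_Hmin l_gt0 s_ge1 hu.
  transitivity (omega (plc 1 (lc 1 u (-1) (lift (psym u)), lc (-1) (lc 1 u2 (-1) (lift (psym u2))) 0 (lc 1 u2 (-1) (lift (psym u2))))
    1 (rpair (psym u) (psym u2))) r).
    by congr (omega _ r); congr pair; apply: efun_ext => e x; rewrite /plc /rpair /lc /=; ring.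
  rewrite (omega_plc 1 1 (Hmin_Hmax l_gt0 s_ge1 A) Hu Hr) (omega_Hmin A Hr) mulr0 add0r mul1r //.
(* Replacement works in the first slot; [omega_conj] swaps the slots to reach the second. *)
rewrite (omega_aeq Hp HP Hq e1 e2) (red _ _ _ _ hf Hf Hq) (omega_conj Hq Hf).
by rewrite (omega_aeq Hq HQ Hf k1 k2) (red _ _ _ _ hg Hg Hf) -(omega_conj Hg Hf).
Qed.

Variable V : R.
Hypothesis vol_fin : forall N, \sum_(0 <= n < N) mun n * l n <= V.

Lemma BV_exists p : Hmax p -> exists al be, BV p al be.
Proof.
move=> Hp; have [f [f1 [f2 [hf e1 e2]]]] := HmaxE l_gt0 Hp; have [Wf Kf _ _] := hf.
have [_ _ Lf Lf2] := hrep_psym l_gt0 s_ge1 hf.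
have [al [be v]] := bvals_exists l_gt0 s_ge1 vol_fin (psym_rprof l_gt0 s_ge1 Wf Kf) Lf2.
by exists al, be; split; [exact: Hp|exists f, f1, f2; split].
Qed.

(** The constant 1 has values (1, 0), and the parabola has a nonzero second value. *)
Lemma BV_surjective al be : exists p, BV p al be.
Proof.
have [y [y1 [aly [bey [hy vy b0 _]]]]] := parabola l_gt0 s_ge1 vol_fin.
have [cy _ _] := rprof_eL2 l_gt0 hy; have Ly := rlim_L2 l_gt0 s_ge1 vol_fin cy vy.1.
have B1 := BV_rpair (rprof_one s l_gt0) (L2_cst l_gt0 s_ge1 vol_fin 1) (L2_cst l_gt0 s_ge1 vol_fin 0) (bvals_one s l).
have By := BV_rpair hy Ly (L2_cst l_gt0 s_ge1 vol_fin (-1)) vy.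
have := BV_plc (al - be / bey * aly) (be / bey) B1 By.
by rewrite mulr1 subrK mulr0 add0r mulfVK // => h; eexists; exact: h.
Qed.

(** Pairing with elements of values (0, 1) and (1, 0) reads off the two coordinates. *)
Lemma BV_unique p al be al' be' : BV p al be -> BV p al' be' -> al = al' /\ be = be'.
Proof.
move=> h h'; have [e1 k1] := BV_surjective 1 0; have [e2 k2] := BV_surjective 0 1; split.
  by have := BV_omega h k2; rewrite (BV_omega h' k2) conjc1 conjc0 !mulr1 !mulr0 !subr0.
have := BV_omega h k1; rewrite (BV_omega h' k1) conjc1 conjc0 !mulr1 !mulr0 !sub0r.
by move/oppr_inj.
Qed.

(** One direction is the cut-off argument. Conversely an element of [Hmin] pairs to zero with
    everything, and the form is nondegenerate. *)
Lemma BV0_Hmin p : BV p 0 0 <-> Hmin s l p.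
Proof.
split=> [[Hp [f [f1 [f2 [hf e1 e2 v]]]]]|hp].
  have [p1 p2] := Hmax_L2 Hp; have [Wf Kf _ _] := hf.
  have [_ _ Lf Lf2] := hrep_psym l_gt0 s_ge1 hf.
  apply: (Hmin_of_radial l_gt0 s_ge1 p1 p2 hf e1 e2).
  exact: (radial_Hmin_zero l_gt0 s_ge1 vol_fin (psym_rprof l_gt0 s_ge1 Wf Kf) Lf Lf2 v).
have [al [be h]] := BV_exists (Hmin_Hmax l_gt0 s_ge1 hp).
have [e1 k1] := BV_surjective 1 0; have [e2 k2] := BV_surjective 0 1.
have := BV_omega h k2; rewrite (omega_Hmin hp k2.1) conjc1 conjc0 mulr1 mulr0 subr0 => a0.
have := BV_omega h k1; rewrite (omega_Hmin hp k1.1) conjc1 conjc0 mulr1 mulr0 sub0r => /esym/eqP; rewrite oppr_eq0 => /eqP b0.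
by rewrite -a0 b0 in h.
Qed.

End BoundaryForm.
Section Differentiability.
Context {R : realType}.
Notation C := R[i].
Notation Re := complex.Re.
Notation Im := complex.Im.
Implicit Types (x l r : R).

Lemma near_oo (a b x : R) : a < x < b -> \forall y \near x, a < y < b.
Proof.
by move=> h; have : x \in `]a, b[ by []; move/near_in_itvoo; apply: filterS => y; rewrite in_itv.
Qed.

Lemma rW1_is_derive l (f f1 f2 : R -> R) x : rW1 l f f1 -> rW1 l f1 f2 -> 0 < x < l -> is_derive x 1 f (f1 x).
Proof.
move=> w1 w2 /andP[x0 xl]; have l0 : 0 <= l by exact/ltW/(lt_trans x0).
have c1 : {for x, continuous f1}.
  by apply: (within_continuous_continuous (lt_trans x0 xl) (rW1_cont l0 w2)); rewrite in_itv /= x0.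
have [d e] := @continuous_FTC1_closed R f1 0 x l xl (rL2_intg w1.1) x0 c1.
have D : is_derive x 1 (fun y => \int[lebesgue_measure]_(t in `[0, y]) f1 t) (f1 x).
  by apply: DeriveDef; [exact: d|rewrite -derive1E; exact: e].
have D2 := is_deriveD (is_derive_cst (f 0) x 1) D; rewrite add0r in D2.
apply: near_eq_is_derive D2; near=> y; rewrite /= [RHS]w1.2 //.
have /andP[y0 yl] : 0 < y < l by near: y; apply: near_oo; rewrite x0.
by rewrite (ltW y0) ltW.
Unshelve. all: by end_near. Qed.

(** The profile agrees with f only inside the layer, which suffices because derivatives are
    local. *)
Lemma W2_cderive l (f f1 f2 g : R -> C) r x : W2 l f f1 f2 -> 0 < x < l ->
  (forall y, 0 < y < l -> g (r + y) = f y) -> cderive g (r + x) = f1 x.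
Proof.
move=> [/W1P[a1 b1] /W1P[a2 b2]] hx E; have [x0 xl] := andP hx.
have key (u u1 u2 v : R -> R) : rW1 l u u1 -> rW1 l u1 u2 -> (forall y, 0 < y < l -> v (r + y) = u y) ->
    derive1 v (r + x) = u1 x.
  move=> w1 w2 e; have D := rW1_is_derive w1 w2 hx.
  have D2 : is_derive (r + x) 1 (fun y => u (y - r)) (u1 x).
    by apply: is_derive_shift; rewrite addrC addKr.
  suff : is_derive (r + x) 1 v (u1 x) by move=> D3; rewrite derive1E derive_val.
  apply: near_eq_is_derive D2; near=> y; rewrite /= -e; first by rewrite subrKC.
  rewrite subr_gt0 ltrBlDl; near: y; apply: near_oo.
  by rewrite ltrDl x0 ltrD2l.
rewrite /cderive (key _ _ _ _ a1 a2) => [|y hy]; last by rewrite E.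
rewrite (key _ _ _ _ b1 b2) => [|y hy]; last by rewrite E.
by case: (f1 x).
Unshelve. all: by end_near. Qed.

End Differentiability.

(** * Boundary values as limits of the radial profile at the height *)

Section BoundaryValues.
Context {R : realType}.
Variables (s : nat -> nat) (l : nat -> R).
Hypothesis l_gt0 : forall n, 0 < l n.
Hypothesis s_ge1 : forall n, (1 <= s n)%N.
Notation C := R[i].
Notation Re := complex.Re.
Notation Im := complex.Im.
Notation normc := ComplexField.Normc.normc.
Local Notation efun := (efun R s).
Local Notation mun := (@mun R s).
Local Notation Hmax := (@Hmax R s l).
Local Notation BV := (@BV R s l).
Implicit Types (N n m : nat) (t x : R) (p : efun * efun) (f g : efun) (al be : C).

Lemma t_S n : t_ l n.+1 = t_ l n + l n.
Proof. by rewrite /t_ big_nat_recr. Qed.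

Lemma t_le m n : (m <= n)%N -> t_ l m <= t_ l n.
Proof.
move=> mn; rewrite /t_ [leRHS](big_cat_nat (leq0n m) mn) /= lerDl; apply: sumr_ge0 => k _; exact: ltW.
Qed.

Lemma level_uniq t m n : t_ l m <= t < t_ l m.+1 -> t_ l n <= t < t_ l n.+1 -> m = n.
Proof.
move=> /andP[a1 a2] /andP[b1 b2]; apply/eqP; rewrite eqn_leq; apply/andP; split; rewrite leqNgt; apply/negP => h.
  by have := t_le h; rewrite leNgt (le_lt_trans a1 b2).
by have := t_le h; rewrite leNgt (le_lt_trans b1 a2).
Qed.

Lemma levelE t n : t_ l n <= t < t_ l n.+1 -> level l t = n.
Proof.
move=> h; apply: (level_uniq _ h); rewrite /level.
exact: (@getPex _ [set n | t_ l n <= t < t_ l n.+1] (ex_intro _ n h)).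
Qed.

Lemma radialE f n x : 0 <= x < l n -> radial l f (t_ l n + x) = psym f n x.
Proof.
move=> /andP[x0 xl]; have h : t_ l n <= t_ l n + x < t_ l n.+1 by rewrite lerDl x0 t_S ltrD2l.
rewrite /radial /mu (levelE h) addrC addKr.
rewrite -(psymE s_ge1) mulrA -rmorphM mulVf ?mul1r //.
exact: (lt0r_neq0 (@mun_gt0 R s s_ge1 n)).
Qed.

Lemma edgewise_eq f f1 f2 g g1 g2 : edgewise_W2 l f f1 f2 -> edgewise_W2 l g g1 g2 -> aeq l f g ->
  forall e x, 0 <= x <= elen l e -> f e x = g e x.
Proof.
move=> Wf Wg E e x hx; have l0 := elen_gt0 l_gt0 e.
have W := W1_lin 1 (-1) (ltW l0) (Wf e).1 (Wg e).1.
have := W1_ae_eq0 l0 W _ hx; rewrite mul1r mulN1r => h.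
apply: subr0_eq; apply: h.
have := E e; apply: filterS; first exact: (ae_filter_ringOfSetsType lebesgue_measure).
by move=> y hy y1; rewrite mul1r mulN1r hy // subrr.
Qed.

Variable V : R.
Hypothesis vol_fin : forall N, \sum_(0 <= n < N) mun n * l n <= V.

Lemma t_cvg : t_ l n @[n --> \oo] --> height l.
Proof.
apply/nondecreasing_is_cvgn; first by move=> m n; exact: t_le.
exists V => _ [n _ <-]; exact: (sum_l l_gt0 s_ge1 vol_fin).
Qed.

Lemma t_lt_height n : t_ l n < height l.
Proof.
apply: (@lt_le_trans _ _ (t_ l n.+1)); first by rewrite t_S ltrDl.
apply: nondecreasing_cvgn_le; [by move=> m k; exact: t_le|apply/cvg_ex; exists (height l); exact: t_cvg].
Qed.

Lemma level_exists t N : t_ l N <= t < height l -> exists n x, [/\ (N <= n)%N, 0 <= x < l n & t = t_ l n + x].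
Proof.
move=> /andP[Nt th]; have := t_cvg => /cvgrPdist_lt /(_ (height l - t)).
rewrite subr_gt0 => /(_ th)[M _ hM].
have tM : exists M, t < t_ l M.
  exists M; have := hM M (leqnn M); rewrite /= => /(le_lt_trans (ler_norm _)); lra.
case: (ex_minnP tM) => n hn mn.
have n0 : (N < n)%N by rewrite ltnNge; apply/negP => /t_le; rewrite leNgt (le_lt_trans Nt hn).
case: n n0 hn mn => // n; rewrite ltnS => Nn hn mn.
have h : t_ l n <= t by rewrite leNgt; apply/negP => /mn; rewrite ltnn.
exists n, (t - t_ l n); split; [exact: Nn| |by rewrite subrKC].
by rewrite subr_ge0 h ltrBlDl -t_S.
Qed.

(** With [near_height_ex] it translates left neighbourhoods of [height] into tails of layers, and so
    the limits in [boundary_values] into [rlim]. *)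
Lemma near_height N (P : R -> Prop) : (forall n x, (N <= n)%N -> 0 <= x < l n -> P (t_ l n + x)) ->
  \forall t \near (height l)^'-, P t.
Proof.
move=> h; near=> t; have [|n [x [Nn hx ->]]] := @level_exists t N; last exact: h.
apply/andP; split; first by apply/ltW; near: t; exact/nbhs_left_gt/t_lt_height.
by near: t; exact: nbhs_left_lt.
Unshelve. all: by end_near. Qed.

Lemma near_height_ex (P : R -> Prop) : (\forall t \near (height l)^'-, P t) ->
  exists N, forall n x, (N <= n)%N -> 0 <= x < l n -> P (t_ l n + x).
Proof.
rewrite near_withinE => /nbhs_ballP[e /= e0 he].
have := t_cvg => /cvgrPdist_lt /(_ e e0)[N _ hN]; exists N => n x Nn /andP[x0 xl].
have th : t_ l n + x < height l by apply: lt_trans (t_lt_height n.+1); rewrite t_S ltrD2l.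
apply: he => //; rewrite /ball /= ger0_norm ?subr_ge0 ?ltW //.
have := hN N (leqnn N); rewrite /= => /(le_lt_trans (ler_norm _)); have := t_le Nn; lra.
Qed.

Lemma not_range n x : 0 < x < l n -> (~` range (t_ l)) (t_ l n + x).
Proof.
move=> /andP[x0 xl] [m _ e].
have h1 : t_ l m <= t_ l n + x < t_ l m.+1 by rewrite -e lexx t_S ltrDl l_gt0.
have h2 : t_ l n <= t_ l n + x < t_ l n.+1 by rewrite lerDl ltW // t_S ltrD2l.
by move: e; rewrite (level_uniq h1 h2) => e; move: x0; rewrite -(ltrD2l (t_ l n)) addr0 -e ltxx.
Qed.

Lemma normc_small_eq (z w : C) : (forall eps, 0 < eps -> exists v, normc (v - z) <= eps /\ normc (v - w) <= eps) -> z = w.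
Proof.
move=> h; apply/eqP; rewrite -subr_eq0; apply/eqP; apply: ComplexField.Normc.eq0_normc.
apply/eqP; rewrite eq_le normc_ge0 andbT; apply/ler_addgt0Pr => e e0; rewrite add0r.
have e2 : 0 < e / 2 by lra.
have [v [h1 h2]] := h _ e2.
have -> : z - w = (v - w) - (v - z) by ring.
by apply: le_trans (normcD _ _) _; rewrite normcN; lra.
Qed.

(* Representatives in H^2 of every edge agree pointwise on closed edges, so the profile does not depend
   on the choice of [g]. *)
Lemma radial_rep f f1 f2 g g1 g2 n x : edgewise_W2 l f f1 f2 -> edgewise_W2 l g g1 g2 -> aeq l g f ->
  (0 <= x < l n -> radial l g (t_ l n + x) = psym f n x) /\
  (0 < x < l n -> cderive (radial l g) (t_ l n + x) = psym f1 n x).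
Proof.
move=> Wf Wg E.
have Q y : 0 <= y <= l n -> psym g n y = psym f n y.
  move=> hy; rewrite /psym /avg; congr (_ * _); apply: eq_bigr => i _; congr (_ * _).
  by apply: eq_bigr => j _; exact: (edgewise_eq Wg Wf E).
have rad y : 0 <= y < l n -> radial l g (t_ l n + y) = psym f n y.
  by move=> /andP[y0 yl]; rewrite radialE ?y0 // Q // y0 ltW.
split; first exact: rad.
move=> hx; have l0 := ltW (l_gt0 n).
have W : W2 (l n) (psym f n) (psym f1 n) (psym f2 n).
  by split; apply: W1_avg => // i; apply: W1_avg => // j; have [] := Wf (mkedge i j).
by apply: (W2_cderive W hx) => y /andP[y0 yl]; rewrite rad // ltW.
Qed.

Lemma mu_level n x : 0 <= x < l n -> mu s l (t_ l n + x) = mun n.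
Proof.
move=> /andP[x0 xl]; rewrite /mu (@levelE _ n) // lerDl x0 t_S ltrD2l //.
Qed.

Lemma BV_boundary p al be : BV p al be -> boundary_values l p.1 al be.
Proof.
move=> [_ [f [f1 [f2 [[W _ _ _] e _ [v v1]]]]]]; exists f, f1, f2; split; [exact: e|exact: W| |].
- apply/cvgrPdist_le => eps e0; have [N hN] := v eps e0; apply: (@near_height N) => n x Nn hx.
  have [x0 xl] := andP hx; have [r _] := radial_rep n x W W (@aeq_refl _ _ _ f).
  by rewrite sub0r normrN ger0_norm ?normc_ge0 // r // hN // x0 ltW.
- apply/cvgrPdist_le => eps e0; have [N hN] := v1 eps e0; rewrite near_withinE.
  apply: (@near_height N) => n x Nn hx nr; have [x0 xl] := andP hx.
  have x0' : 0 < x.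
    by rewrite lt_neqAle x0 andbT; apply/eqP => z; apply: nr; exists n => //; rewrite -z addr0.
  have [_ r] := radial_rep n x W W (@aeq_refl _ _ _ f).
  by rewrite sub0r normrN ger0_norm ?normc_ge0 // mu_level // r ?x0' // hN // x0 ltW.
Qed.

(** The given limits are compared with the values from [BV_exists] at midpoints of layers, which
    avoid the points t_ n excluded from the derivative limit. *)
Lemma boundary_BV p al be : Hmax p -> boundary_values l p.1 al be -> BV p al be.
Proof.
move=> Hp [g [g1 [g2 [e W h1 h2]]]].
have [a [b B]] := BV_exists l_gt0 s_ge1 vol_fin Hp.
have [_ [f [f1 [f2 [[Wf _ _ _] k _ [v v1]]]]]] := B.
have E : aeq l g f := aeq_trans (aeq_sym e) k.
have hx n : 0 < l n / 2 < l n by have := l_gt0 n; lra.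
have hx' n : 0 <= l n / 2 < l n by have := l_gt0 n; lra.
have hx2 n : 0 <= l n / 2 <= l n by have := l_gt0 n; lra.
have ab : a = al.
  apply: normc_small_eq => eps e0; have [N hN] := v eps e0.
  have /cvgrPdist_le /(_ eps e0) /near_height_ex[N' hN'] := h1.
  pose n := maxn N N'; exists (psym f n (l n / 2)); split; first by apply: hN => //; exact: leq_maxl.
  have := hN' n (l n / 2) (leq_maxr N N') (hx' n).
  by rewrite sub0r normrN ger0_norm ?normc_ge0 // ((radial_rep n (l n / 2) Wf W E).1 (hx' n)).
have bb : b = be.
  apply: normc_small_eq => eps e0; have [N hN] := v1 eps e0.
  have /cvgrPdist_le /(_ eps e0) := h2; rewrite near_withinE => /near_height_ex[N' hN'].
  pose n := maxn N N'; exists ((mun n)%:C * psym f1 n (l n / 2)); split; first by apply: hN => //; exact: leq_maxl.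
  have := hN' n (l n / 2) (leq_maxr N N') (hx' n) (not_range (hx n)).
  by rewrite sub0r normrN ger0_norm ?normc_ge0 // mu_level // ((radial_rep n (l n / 2) Wf W E).2 (hx n)).
by rewrite -ab -bb.
Qed.

End BoundaryValues.

(** * Self-adjoint extensions and deficiency indices *)

Section LagrangianLines.
Context {R : realType}.
Notation C := R[i].
Notation Re := complex.Re.
Notation Im := complex.Im.
Notation normc := ComplexField.Normc.normc.
Implicit Types (c t theta : R) (al be : C).

(* The boundary values of a self-adjoint extension form a Lagrangian line of the symplectic form
   [al * conjc be' - be * conjc al'], and such a line has a real direction. *)
Lemma line_param c t al be : c ^+ 2 + t ^+ 2 = 1 -> c%:C * al + t%:C * be = 0 ->
  exists w, al = t%:C * w /\ be = - (c%:C * w).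
Proof.
move=> h e; exists (t%:C * al - c%:C * be).
have h' : c%:C ^+ 2 + t%:C ^+ 2 = 1 :> C by rewrite -!rmorphXn -rmorphD h.
split; apply/eqP; rewrite -subr_eq0; apply/eqP.
- transitivity ((1 - (c%:C ^+ 2 + t%:C ^+ 2)) * al + c%:C * (c%:C * al + t%:C * be)); first by ring.
  by rewrite h' e; ring.
- transitivity ((1 - (c%:C ^+ 2 + t%:C ^+ 2)) * be + t%:C * (c%:C * al + t%:C * be)); first by ring.
  by rewrite h' e; ring.
Qed.

Lemma line_isotropic c t al be al' be' : c ^+ 2 + t ^+ 2 = 1 -> c%:C * al + t%:C * be = 0 ->
  c%:C * al' + t%:C * be' = 0 -> al * conjc be' - be * conjc al' = 0.
Proof.
move=> h e e'; have [w [-> ->]] := line_param h e; have [w' [-> ->]] := line_param h e'.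
by rewrite conjcN !conjcM !conjc_real; ring.
Qed.

Lemma line_maximal c t al be al' be' : c ^+ 2 + t ^+ 2 = 1 -> (al, be) != (0, 0) ->
  c%:C * al + t%:C * be = 0 -> al * conjc be' - be * conjc al' = 0 -> c%:C * al' + t%:C * be' = 0.
Proof.
move=> h nz e; have [w [ea eb]] := line_param h e.
have w0 : w != 0 by apply: contraNneq nz => w0; rewrite ea eb w0 !mulr0 oppr0.
rewrite ea eb => k; have {}k : conjc (t%:C * be' + c%:C * al') = 0.
  by apply: (mulfI w0); rewrite mulr0 -[RHS]k conjcD !conjcM !conjc_real; ring.
by rewrite addrC -[LHS]conjccK k conjc0.
Qed.

(** Isotropy makes al conj be real, so for be != 0 one has al = r be with r real, and the angle must
    have tangent -r. [atan] lies in (-pi/2, pi/2); a negative angle is shifted by pi, which only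
    changes the sign of the equation. *)
Lemma line_angle al be : al * conjc be - be * conjc al = 0 ->
  exists theta, 0 <= theta < pi /\ (cos theta)%:C * al + (sin theta)%:C * be = 0.
Proof.
move=> h; have pi0 := pi_gt0 R.
have [->|b0] := eqVneq be 0.
  exists (pi / 2); split; first lra.
  by rewrite cos_pihalf mul0r mulr0 addr0.
have n0 : 0 < normc be ^+ 2.
  by rewrite lt_def sqr_ge0 andbT; apply: contraNneq b0 => /normc2_eq0 ->.
pose r : R := Re (al * conjc be) / normc be ^+ 2.
have im0 : Im (al * conjc be) = 0.
  have := congr1 (@complex.Im R) h; rewrite !cE /=; lra.
have nC : (normc be ^+ 2)%:C != 0 :> C by rewrite eq_complex /= gt_eqF.
have aE : al * conjc be = (r * normc be ^+ 2)%:C.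
  by apply: complexP; rewrite ?im0 //= /r mulfVK // gt_eqF.
have alE : al = r%:C * be.
  apply: (mulIf nC); transitivity (be * (al * conjc be)); first by rewrite -mul_conjc; ring.
  by rewrite aE rmorphM /=; ring.
pose t := atan (- r); have t1 := atan_gtNpi2 (- r); have t2 := atan_ltpi2 (- r); rewrite -/t in t1 t2.
have ct : 0 < cos t by apply: cos_gt0_pihalf; rewrite t1.
have st : sin t = - r * cos t by rewrite -{1}(atanK (- r)) -/t /tan mulfVK // gt_eqF.
have K (x y : R) : y%:C * (x%:C * be) + (- x * y)%:C * be = 0 by rewrite rmorphM rmorphN /=; ring.
have [t0|t0] := leP 0 t.
  exists t; split; first lra.
  by rewrite st alE; exact: K.
exists (t + pi); split; first lra.
by rewrite cosDpi sinDpi st alE -mulrN; exact: K.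
Qed.

(** Both equations together give sin (theta - theta') = 0, while the difference is smaller than pi
    in modulus. *)
Lemma line_angle_unique theta theta' al be : (al, be) != (0, 0) -> 0 <= theta < pi -> 0 <= theta' < pi ->
  (cos theta)%:C * al + (sin theta)%:C * be = 0 -> (cos theta')%:C * al + (sin theta')%:C * be = 0 -> theta = theta'.
Proof.
move=> nz h h' e e'.
have [w [ea eb]] := line_param (cos2Dsin2 theta) e.
have w0 : w != 0 by apply: contraNneq nz => w0; rewrite ea eb w0 !mulr0 oppr0.
have S : sin (theta - theta') = 0.
  have : (sin theta * cos theta' - cos theta * sin theta')%:C = 0 :> C.
    apply: (mulIf w0); rewrite mul0r -[RHS]e' ea eb rmorphB !rmorphM /=; ring.
  by rewrite sinB => /(congr1 (@complex.Re R)).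
apply/eqP; rewrite eq_le; apply/andP; split; rewrite leNgt; apply/negP => lt.
- have : 0 < sin (theta - theta') by apply: sin_gt0_pi; lra.
  by rewrite S ltxx.
- have : 0 < sin (theta' - theta) by apply: sin_gt0_pi; lra.
  by rewrite -opprB sinN S oppr0 ltxx.
Qed.

End LagrangianLines.

Section Extensions.
Context {R : realType}.
Variables (s : nat -> nat) (l : nat -> R).
Hypothesis l_gt0 : forall n, 0 < l n.
Hypothesis s_ge1 : forall n, (1 <= s n)%N.
Notation C := R[i].
Local Notation efun := (efun R s).
Local Notation mun := (@mun R s).
Local Notation Hmax := (@Hmax R s l).
Local Notation BV := (@BV R s l).
Implicit Types (theta : R) (p q : efun * efun) (al be : C) (A : set (efun * efun)).
Variable V : R.
Hypothesis vol_fin : forall N, \sum_(0 <= n < N) mun n * l n <= V.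

Lemma Htheta_BV theta p : Htheta s l theta p <->
  exists al be, BV p al be /\ (cos theta)%:C * al + (sin theta)%:C * be = 0.
Proof.
rewrite /Htheta /= adjoint_Hmin //; split=> [[Hp [a [b [h e]]]]|[al [be [h e]]]].
  by exists a, b; split; [exact: (boundary_BV l_gt0 s_ge1 vol_fin Hp h)|exact: e].
by split; [exact: h.1|exists al, be; split; [exact: (BV_boundary l_gt0 s_ge1 vol_fin h)|exact: e]].
Qed.

Lemma Hmin_Htheta theta : Hmin s l `<=` Htheta s l theta.
Proof.
move=> p /(BV0_Hmin l_gt0 s_ge1 vol_fin p) h; apply/Htheta_BV; exists 0, 0; split; first exact: h.
by rewrite !mulr0 addr0.
Qed.

Lemma adjoint_sub A p : Hmin s l `<=` A -> adjoint l A p -> Hmax p.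
Proof.
move=> sub [p1 p2 h]; rewrite -(adjoint_Hmin l_gt0 s_ge1); split; [exact: p1|exact: p2|].
by move=> q Hq; apply: h; exact: sub.
Qed.

Lemma omega_adjoint A p q : adjoint l A p -> A q -> omega l q p = 0.
Proof. by move=> [_ _ h] Aq; rewrite /omega h // subrr. Qed.

(** A line with real direction is its own annihilator for the boundary form. *)
Lemma Htheta_self_adjoint theta : self_adjoint l (Htheta s l theta).
Proof.
split; first by apply: dense_sub (Hmin_dense l_gt0); exact: Hmin_Htheta.
have cs := cos2Dsin2 theta.
apply/seteqP; split => q Hq.
  have Mq := adjoint_sub (@Hmin_Htheta theta) Hq.
  have [al [be h]] := BV_exists l_gt0 s_ge1 vol_fin Mq.
  (* (sin theta, - cos theta) spans the line, and pairing with it recovers the boundary condition up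
     to conjugation. *)
  have [p k] := BV_surjective l_gt0 s_ge1 vol_fin (sin theta)%:C (- (cos theta)%:C).
  have Hp : Htheta s l theta p.
    by apply/Htheta_BV; exists (sin theta)%:C, (- (cos theta)%:C); split; [exact: k|ring].
  apply/Htheta_BV; exists al, be; split; first exact: h.
  have := omega_adjoint Hq Hp; rewrite (BV_omega l_gt0 s_ge1 k h) => e.
  rewrite -[LHS]conjccK -[RHS]conjc0 -e conjcD !conjcM !conjc_real; congr (conjc _); ring.
have /Htheta_BV[al [be [h e]]] := Hq; have [L1 L2'] := Hmax_L2 h.1.
split; [exact: L1|exact: L2'|move=> p /Htheta_BV[al' [be' [h' e']]]].
apply/eqP; rewrite -subr_eq0; apply/eqP.
by have := BV_omega l_gt0 s_ge1 h' h; rewrite (line_isotropic cs e' e).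
Qed.

Lemma Hmin_not_self_adjoint : adjoint l (Hmin s l) != Hmin s l.
Proof.
apply/eqP => E; have [p h] := BV_surjective l_gt0 s_ge1 vol_fin 1 0.
have : Hmin s l p by rewrite -E (adjoint_Hmin l_gt0 s_ge1); exact: h.1.
move/(BV0_Hmin l_gt0 s_ge1 vol_fin) => h0.
have [/eqP] := BV_unique l_gt0 s_ge1 vol_fin h h0; by rewrite oner_eq0.
Qed.

(** As [Hmin] is not self-adjoint, A contains an element with nonzero boundary values; symmetry
    makes them isotropic, which fixes the angle. *)
Lemma self_adjoint_extension A : self_adjoint l A -> Hmin s l `<=` A ->
  exists! theta : R, 0 <= theta < pi /\ A = Htheta s l theta.
Proof.
move=> [_ sA] sub.
have AH p : A p -> Hmax p by rewrite -{1}sA; exact: adjoint_sub.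
have A0 p q : A p -> A q -> omega l p q = 0 by move=> Ap; rewrite -{1}sA => Aq; exact: omega_adjoint Aq Ap.
have [p [al [be [Ap h nz]]]] : exists p al be, [/\ A p, BV p al be & (al, be) != (0, 0)].
  apply: contrapT => no; have E : A = Hmin s l.
    apply/seteqP; split => // p Ap; have [al [be h]] := BV_exists l_gt0 s_ge1 vol_fin (AH p Ap).
    apply/(BV0_Hmin l_gt0 s_ge1 vol_fin); have [[e1 e2]|nz] := eqVneq (al, be) (0, 0); first by rewrite e1 e2 in h.
    by exfalso; apply: no; exists p, al, be.
  by have /eqP := Hmin_not_self_adjoint; rewrite -E; apply.
have [theta [th e]] := line_angle (etrans (esym (BV_omega l_gt0 s_ge1 h h)) (A0 p p Ap Ap)).
have AT : A `<=` Htheta s l theta.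
  move=> q Aq; have [al' [be' h']] := BV_exists l_gt0 s_ge1 vol_fin (AH q Aq).
  apply/Htheta_BV; exists al', be'; split; first exact: h'.
  by apply: (line_maximal (cos2Dsin2 theta) nz e); rewrite -(BV_omega l_gt0 s_ge1 h h'); exact: A0.
exists theta; split.
  split; first exact: th.
  apply/seteqP; split; first exact: AT.
  (* Taking adjoints reverses the inclusion of A in [Htheta]. *)
  move=> q; rewrite -{1}(Htheta_self_adjoint theta).2 -sA => -[q1 q2 k].
  by split; [exact: q1|exact: q2|move=> r Ar; apply: k; exact: AT].
move=> theta' [th' E']; have := Ap; rewrite E' => /Htheta_BV[al' [be' [h' e']]].
have [ea eb] := BV_unique l_gt0 s_ge1 vol_fin h h'; rewrite -ea -eb in e'.
exact: (line_angle_unique nz th th' e e').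
Qed.

End Extensions.

(** * Solutions with a complex spectral parameter *)

Section ExponentialSolutions.
Context {R : realType}.
Notation C := R[i].
Notation Re := complex.Re.
Notation Im := complex.Im.
Notation normc := ComplexField.Normc.normc.
Implicit Types (k : C) (l x : R).

(** cosh (k x) and, in the next definition, sinh (k x) / k: the solutions of w'' = k^2 w with data
    (1, 0) and (0, 1) at 0. *)
Definition cch k x : C := 2^-1 * cexpx k x + 2^-1 * cexpx (- k) x.
Definition csh k x : C := (2 * k)^-1 * cexpx k x + - (2 * k)^-1 * cexpx (- k) x.

Lemma W1_csh k l : k != 0 -> 0 <= l -> W1 l (csh k) (cch k).
Proof.
move=> k0 l0; apply: (eq_W1 l0 _ _ (W1_lin (2 * k)^-1 (- (2 * k)^-1) l0 (W1_cexpx k l0) (W1_cexpx (- k) l0))) => x _ //.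
by rewrite /cch; field.
Qed.

Lemma W1_cch k l : k != 0 -> 0 <= l -> W1 l (cch k) (fun x => k ^+ 2 * csh k x).
Proof.
move=> k0 l0; apply: (eq_W1 l0 _ _ (W1_lin 2^-1 2^-1 l0 (W1_cexpx k l0) (W1_cexpx (- k) l0))) => x _ //.
by rewrite /csh; field.
Qed.

Lemma cch0 k : cch k 0 = 1. Proof. by rewrite /cch !cexpx0; field. Qed.
Lemma csh0 k : k != 0 -> csh k 0 = 0. Proof. by move=> k0; rewrite /csh !cexpx0; field. Qed.

Lemma normc_cexpx k x : `|Re k| <= 1 -> 0 <= x -> normc (cexpx k x) <= expR x.
Proof.
move=> hk x0; rewrite -(@ler_pXn2r _ 2) ?nnegrE ?normc_ge0 ?expR_ge0 // cexpx_norm.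
rewrite ler_pXn2r ?nnegrE ?expR_ge0 // ler_expR; have := ler_norm (Re k); nra.
Qed.

Lemma normc_cch k x : `|Re k| <= 1 -> 0 <= x -> normc (cch k x) <= expR x.
Proof.
move=> hk x0; have hk' : `|Re (- k)| <= 1 by rewrite ReN normrN.
rewrite /cch -mulrDr ComplexField.Normc.normcM.
have -> : normc (2^-1 : C) = 2^-1 :> R.
  by rewrite ComplexField.Normc.normcV natC normc_real // ler0n.
have := normcD (cexpx k x) (cexpx (- k) x); have := normc_cexpx hk x0; have := normc_cexpx hk' x0; lra.
Qed.

(** Integrating [cch] makes the bound proportional to l, as the product of the growth factors over
    all layers requires. *)
Lemma normc_csh k x l : k != 0 -> `|Re k| <= 1 -> 0 <= x <= l -> normc (csh k x) <= (expR l ^+ 2 + 1) * l.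
Proof.
move=> k0 hk hx; have [x0 xl] := andP hx; have l0 := le_trans x0 xl.
have W := W1_csh k0 l0; have c1 := W1_cL2' W.
rewrite (W1_eq_fst W hx) csh0 // add0r; apply: le_trans (cint_norm_le hx c1) _.
rewrite mulrDl mul1r lerD2r; apply: nrm_le_bounded => // y /andP[y0 yl].
rewrite ler_pXn2r ?nnegrE ?normc_ge0 ?expR_ge0 //; apply: le_trans (normc_cch hk y0) _.
by rewrite ler_expR.
Qed.

End ExponentialSolutions.

(** * The deficiency spaces in finite volume *)

Section Deficiency.
Context {R : realType}.
Variables (s : nat -> nat) (l : nat -> R).
Hypothesis l_gt0 : forall n, 0 < l n.
Hypothesis s_ge1 : forall n, (1 <= s n)%N.
Notation C := R[i].
Notation Re := complex.Re.
Notation Im := complex.Im.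
Notation normc := ComplexField.Normc.normc.
Local Notation efun := (efun R s).
Local Notation mun := (@mun R s).
Local Notation rprof := (@rprof R s l).
Local Notation lift := (@lift R s).
Local Notation Hmax := (@Hmax R s l).
Local Notation BV := (@BV R s l).
Implicit Types (p q : efun * efun) (f : efun) (al be z k : C).
Variable V : R.
Hypothesis vol_fin : forall N, \sum_(0 <= n < N) mun n * l n <= V.

(** One step of the Gronwall estimate: [A] and [F] stand for |value| and weighted |slope| at the
    inner end of a layer, [c] and [d] for those at the outer end. As m >= 1, the growth rate is
    controlled by m x, the volume of the layer, which is summable. *)
Lemma growth_step (m x a b c d A F K : R) : 1 <= m -> 0 <= x -> 0 <= A -> 0 <= F -> 0 <= K ->
  a <= expR x -> b <= K * x -> 0 <= b ->
  c <= A * a + F / m * b -> d <= m * (A * b) + F * a ->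
  c + d <= expR ((1 + K) * (m * x)) * (A + F).
Proof.
move=> m1 x0 A0 F0 K0 ha hb b0 hc hd.
have h1 : F / m * b <= F * (m * (K * x)).
  apply: ler_pM => //; first by rewrite divr_ge0 // (le_trans _ m1).
    by rewrite ler_pdivrMr ?(lt_le_trans ltr01) // ler_peMr.
  by apply: le_trans hb _; rewrite ler_peMl // mulr_ge0.
have h2 : m * (A * b) <= A * (m * (K * x)).
  by rewrite mulrCA ler_wpM2l // ler_wpM2l ?(le_trans ler01) //.
have h3 : a <= expR (m * x) by apply: le_trans ha _; rewrite ler_expR ler_peMl.
have h4 := ler_wpM2l A0 h3; have h5 := ler_wpM2l F0 h3.
have y0 : 0 <= m * (K * x) by rewrite !mulr_ge0 // (le_trans ler01).
have e1 : 1 <= expR (m * x) by rewrite -expR0 ler_expR mulr_ge0 // (le_trans ler01).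
have e2 := expR_ge1Dx (m * (K * x)).
have -> : expR ((1 + K) * (m * x)) = expR (m * x) * expR (m * (K * x)).
  by rewrite -expRD; congr expR; ring.
have AF : 0 <= A + F by rewrite addr_ge0.
have h6 : expR (m * x) + m * (K * x) <= expR (m * x) * expR (m * (K * x)).
  have := ler_wpM2l (le_trans ler01 e1) e2; have := ler_wpM2r y0 e1; lra.
have := ler_wpM2r AF h6; lra.
Qed.

Lemma eigen_solution k : k != 0 -> `|Re k| <= 1 -> normc (k ^+ 2) <= 1 ->
  exists u u1, [/\ rprof u u1 (fun n x => k ^+ 2 * u n x), u 0%N 0 = 1 & L2 l (lift u)].
Proof.
move=> k0 hk hk2; have l0 n : 0 <= l n by exact: ltW.
have Wc n : W2 (l n) (cch k) (fun x => k ^+ 2 * csh k x) (fun x => k ^+ 2 * cch k x).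
  split; first exact: W1_cch.
  have W := W1_csh k0 (l0 n); apply: (eq_W1 (l0 n) _ _ (W1_lin (k ^+ 2) 0 (l0 n) W W)) => x _; by rewrite mul0r addr0.
have Ws n : W2 (l n) (csh k) (cch k) (fun x => k ^+ 2 * csh k x) by split; [exact: W1_csh|exact: W1_cch].
have W0 n : W2 (l n) (fun=> 0 : C) (fun=> 0) (fun=> 0) by split; exact: W1_cst.
have D : [/\ cch k 0 = 1, k ^+ 2 * csh k 0 = 0, csh k 0 = 0 & cch k 0 = 1].
  by rewrite cch0 csh0 // mulr0.
have [A [B [A0 B0 h]]] := layered l_gt0 s_ge1 1 Wc Ws W0 (fun=> D) (fun=> conj erefl erefl).
set u := (fun n x => _) in h; set u1 := (fun n x => _) in h.
have hu : rprof u u1 (fun n x => k ^+ 2 * u n x) by apply: (eq_rprof l_gt0 h) => n x _; rewrite /u; ring.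
have uA n : u n 0 = A n by rewrite /u cch0 csh0 // mulr1 mulr0 !addr0.
have uB n : u1 n 0 = B n by rewrite /u1 cch0 csh0 // mulr1 !mulr0 add0r addr0.
exists u, u1; split; [exact: hu|by rewrite uA|].
have V0 : 0 <= V by have := vol_fin 0%N; rewrite big_geq.
have lV n : l n <= V.
  apply: le_trans (sum_l l_gt0 s_ge1 vol_fin n.+1); rewrite big_nat_recr //= lerDr.
  by apply: sumr_ge0 => j _; exact: l0.
(* [K] serves all layers because every l n is at most V. *)
pose K := expR V ^+ 2 + 1.
have K0 : 0 <= K by rewrite addr_ge0 ?sqr_ge0.
have m1 := @mun_ge1 R s s_ge1; have m0 n : 0 <= mun n by apply: le_trans (m1 n).
have hS n x : 0 <= x <= l n -> normc (csh k x) <= K * l n.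
  move=> hx; apply: le_trans (normc_csh k0 hk hx) _; rewrite ler_wpM2r // lerD2r.
  by rewrite ler_pXn2r ?nnegrE ?expR_ge0 // ler_expR.
have nM := @ComplexField.Normc.normcM R.
(* The slope is weighted by [mun] because this product passes continuously through a sphere. *)
pose E n := normc (A n) + mun n * normc (B n).
have [_ eu fu _] := hu.
have step n : E n.+1 <= expR ((1 + K) * (mun n * l n)) * E n.
  have hx : 0 <= l n <= l n by rewrite lexx l0.
  apply: (growth_step (m1 n) (l0 n) (normc_ge0 _) _ K0 (normc_cch hk (l0 n)) (hS n _ hx) (normc_ge0 _)).
  - exact: (mulr_ge0 (m0 n) (normc_ge0 _)).
  - rewrite -uA -eu /u addr0; apply: le_trans (normcD _ _) _; rewrite !nM (mulrC (mun n)) mulfK //.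
    by rewrite gt_eqF // (lt_le_trans ltr01 (m1 n)).
  - have := congr1 (@ComplexField.Normc.normc R) (fu n); rewrite !nM !normc_real // uB => <-.
    rewrite /u1 addr0 -mulrA -mulrDr; apply: (ler_wpM2l (m0 n)).
    apply: le_trans (normcD _ _) _; rewrite !nM; apply: lerD => //.
    apply: (ler_wpM2l (normc_ge0 _)); rewrite -[leRHS]mul1r; apply: (ler_wpM2r (normc_ge0 _)).
    by rewrite -nM -expr2.
have bound n : E n <= expR ((1 + K) * \sum_(0 <= j < n) mun j * l j).
  elim: n => [|n IH].
    by rewrite big_geq // mulr0 expR0 /E A0 B0 ComplexField.Normc.normc1 ComplexField.Normc.normc0 mulr0 addr0.
  rewrite big_nat_recr //= mulrDr expRD mulrC; apply: le_trans (step n) _.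
  by apply: (ler_wpM2l (expR_ge0 _)).
pose G := expR ((1 + K) * V).
have EG n : E n <= G.
  apply: le_trans (bound n) _; rewrite ler_expR; apply: (ler_wpM2l _ (vol_fin n)); exact: addr_ge0.
have [cu _ _] := rprof_eL2 l_gt0 hu.
apply: (@L2_bounded R s l l_gt0 s_ge1 V vol_fin u (G * (expR V + K * V)) 0 cu) => [|n x _ hx].
  by rewrite mulr_ge0 ?expR_ge0 // addr_ge0 ?expR_ge0 ?mulr_ge0.
have [x0 xl] := andP hx.
rewrite /u addr0; apply: le_trans (normcD _ _) _; rewrite !nM mulrDr; apply: lerD.
  apply: ler_pM; rewrite ?normc_ge0 //.
    by apply: le_trans (EG n); rewrite lerDl; exact: (mulr_ge0 (m0 n) (normc_ge0 _)).
  by apply: le_trans (normc_cch hk x0) _; rewrite ler_expR; exact: le_trans xl (lV n).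
apply: ler_pM; rewrite ?normc_ge0 //.
  apply: le_trans (EG n); apply: (@le_trans _ _ (mun n * normc (B n))); first by rewrite ler_peMl ?normc_ge0.
  by rewrite lerDr normc_ge0.
by apply: le_trans (hS n x hx) _; rewrite ler_wpM2l.
Qed.

(** On an eigenfunction the boundary form is (z - conj z) times the squared norm, whereas it
    vanishes when al = 0. *)
Lemma BV_eigen z f al be : Hmax (f, fun e x => z * f e x) -> BV (f, fun e x => z * f e x) al be -> z - conjc z != 0 ->
  al = 0 -> aeq l f (fun _ _ => 0).
Proof.
move=> Hf h zr a0; have [L1 L2'] := Hmax_L2 Hf; rewrite /= in L1 L2'.
have E : (fun e x => z * f e x) = lc z f 0 f by apply: efun_ext => e x; rewrite /lc mul0r addr0.
have := BV_omega l_gt0 s_ge1 h h; rewrite a0 conjc0 mul0r mulr0 subrr /omega /= E inner_scale // inner_scaler //.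
rewrite -mulrBl inner_self // => /eqP; rewrite mulf_eq0 (negbTE zr) /= => /eqP e.
by apply: (sqn0_aeq L1); have := congr1 (@complex.Re R) e.
Qed.

(** By [BV_eigen] the radial solution has a nonzero first boundary value. Subtracting a multiple of
    it removes that of any eigenfunction, and what is left is zero by [BV_eigen] again. *)
Lemma has_dim_ker_shift z k : k ^+ 2 = - z -> k != 0 -> `|Re k| <= 1 -> normc z <= 1 -> z - conjc z != 0 ->
  has_dim l (ker_shift (adjoint l (Hmin s l)) z) 1.
Proof.
move=> kz k0 hk nz zr.
have [u [u1 [hu u0 Lu]]] : exists u u1, [/\ rprof u u1 (fun n x => k ^+ 2 * u n x), u 0%N 0 = 1 & L2 l (lift u)].
  by apply: eigen_solution => //; rewrite kz normcN.
have Lu2 : L2 l (lift (fun n x => k ^+ 2 * u n x)).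
  rewrite (_ : lift _ = lc (k ^+ 2) (lift u) 0 (lift u)); first exact: L2_lc.
  by apply: efun_ext => e x; rewrite /lc /lift mul0r addr0.
have Eu : (fun e x => z * lift u e x) = lc (-1) (lift (fun n x => k ^+ 2 * u n x)) 0 (lift (fun n x => k ^+ 2 * u n x)).
  by apply: efun_ext => e x; rewrite /lc /lift kz; ring.
have Hu : Hmax (lift u, fun e x => z * lift u e x) by rewrite Eu; exact: (rpair_Hmax s_ge1 hu Lu Lu2).
have uz c : aeq l (fun e x => c * lift u e x) (fun _ _ => 0) -> c = 0.
  move=> h; pose e0 : edge s := mkedge (Ordinal (s_ge1 0)) (Ordinal (s_ge1 1)).
  have l0 := elen_gt0 l_gt0 e0; have W := (rprof_edgewise hu e0).1.
  have W' := W1_lin c 0 (ltW l0) W W.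
  have := W1_ae_eq0 l0 W' _ (_ : 0 <= 0 <= elen l e0); rewrite lexx ltW // mul0r addr0 /lift /= u0 mulr1; apply => //.
  have := h e0; apply: filterS; first exact: (ae_filter_ringOfSetsType lebesgue_measure).
  by move=> x hx h'; rewrite mul0r addr0 hx.
exists (fun=> lift u); rewrite /ker_shift /= adjoint_Hmin //; split.
- by move=> _; exact: Hu.
- move=> c h i; rewrite (ord1 i); apply: uz; move: h; congr (aeq l _ _).
  by apply: efun_ext => e x; rewrite big_ord1.
- move=> f Hf; have [au [bu hbu]] := BV_exists l_gt0 s_ge1 vol_fin Hu.
  have [af [bf hbf]] := BV_exists l_gt0 s_ge1 vol_fin Hf.
  have au0 : au != 0.
    apply/eqP => a0; have h := BV_eigen Hu hbu zr a0.
    have : (1 : C) = 0 by apply: uz; move: h; congr (aeq l _ _); apply: efun_ext => e x; rewrite mul1r.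
    by move/eqP; rewrite oner_eq0.
  pose g := lc 1 f (- (af / au)) (lift u).
  have h := BV_plc l_gt0 s_ge1 1 (- (af / au)) hbf hbu.
  have Eg : plc 1 (f, fun e x => z * f e x) (- (af / au)) (lift u, fun e x => z * lift u e x) = (g, fun e x => z * g e x).
    by congr pair; apply: efun_ext => e x; rewrite /g /plc /lc /=; ring.
  rewrite Eg in h.
  have g0 : aeq l g (fun _ _ => 0) by apply: (BV_eigen h.1 h zr); rewrite mul1r mulNr mulfVK // subrr.
  exists (fun=> af / au) => e; have := g0 e; apply: filterS; first exact: (ae_filter_ringOfSetsType lebesgue_measure).
  move=> x hx h'; rewrite big_ord1; apply: subr0_eq; rewrite -(hx h') /g /lc; ring.
Qed.

Lemma Hmin_deficiency : deficiency_indices l (Hmin s l) 1 1.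
Proof.
pose r : R := Num.sqrt (2^-1).
have r2 : r ^+ 2 = 2^-1 by rewrite sqr_sqrtr // invr_ge0.
have r0 : 0 <= r by exact: sqrtr_ge0.
have r1 : r <= 1 by nra.
have rn0 : r != 0 by apply/eqP => e; move: r2; rewrite e expr0n /=; lra.
(* With r^2 = 1/2 and t = 1 or -1, k = r (1 - i t) satisfies k^2 = - i t. *)
have key (t : R) : t ^+ 2 = 1 -> has_dim l (ker_shift (adjoint l (Hmin s l)) (0 +i* t)) 1.
  move=> t2; apply: (@has_dim_ker_shift _ (r +i* (- t * r))).
  - have r2' : r * r = 2^-1 by rewrite -expr2.
    have t2' : t * t = 1 by rewrite -expr2.
    apply: complexP; rewrite expr2 /=.
      transitivity (r * r * (1 - t * t)); first by ring.
      by rewrite t2' subrr mulr0 oppr0.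
    transitivity (- t * (r * r) * 2); first by ring.
    by rewrite r2' mulfVK.
  - by rewrite eq_complex /= negb_and rn0.
  - by rewrite /= ger0_norm.
  - by rewrite -(@ler_pXn2r _ 2) ?nnegrE ?normc_ge0 // normc2 /= t2 expr0n add0r expr1n.
  - rewrite eq_complex /= negb_and; apply/orP; right; apply/eqP => e.
    have t0 : t = 0 by lra.
    by move: t2; rewrite t0 expr0n /=; lra.
by split; apply: key; rewrite ?sqrrN expr1n.
Qed.

End Deficiency.
Section Volume.
Context {R : realType}.
Variables (s : nat -> nat) (l : nat -> R).
Hypothesis l_gt0 : forall n, 0 < l n.
Local Notation mun := (@mun R s).

Lemma vol_series : vol s l = (\sum_(0 <= n <oo) (mun n * l n)%:E)%E.
Proof.
rewrite /vol esum_edge => [|e]; last by rewrite lee_fin ltW ?elen_gt0.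
apply: eq_eseriesr => n _; rewrite /elen /=.
by rewrite !sumEFin !sumr_const !card_ord -mulrnA mulnC -[_ *+ _]mulr_natl.
Qed.

Lemma vol_infinite : vol s l = +oo%E -> forall B, exists M, B < \sum_(0 <= n < M) mun n * l n.
Proof.
move=> h B; apply: contrapT => no.
have : (vol s l <= B%:E)%E.
  rewrite vol_series; apply: nneseries_le => [n|N]; first by rewrite mulr_ge0 ?ler0n ?ltW.
  by rewrite leNgt; apply/negP => lt; apply: no; exists N.
by rewrite h.
Qed.

Lemma vol_finite : (vol s l < +oo)%E -> exists V, forall N, \sum_(0 <= n < N) mun n * l n <= V.
Proof.
rewrite vol_series => h; have p n : 0 <= mun n * l n by rewrite mulr_ge0 ?ler0n ?ltW.
exists (fine (\sum_(0 <= n <oo) (mun n * l n)%:E)%E) => N; rewrite -lee_fin fineK.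
  exact: nneseries_ge.
rewrite ge0_fin_numE //; apply: nneseries_ge0 => n _ _; rewrite lee_fin; exact: p.
Qed.

End Volume.

Theorem theorem4p1 (R : realType) (s : nat -> nat) (l : nat -> R)
    (s0 : s 0%N = 1%N) (s_ge1 : forall n, (1 <= s n)%N)
    (l_gt0 : forall n, 0 < l n) :
  [/\ vol s l = (\sum_(0 <= n <oo) ((s n * s n.+1)%N%:R * l n)%:E)%E,
      self_adjoint l (Hmin s l) <-> vol s l = +oo%E &
      (vol s l < +oo)%E ->
      [/\ deficiency_indices l (Hmin s l) 1 1,
          forall p, adjoint l (Hmin s l) p ->
            exists a b, boundary_values l p.1 a b,
          forall theta : R, 0 <= theta < pi ->
            self_adjoint l (Htheta s l theta) /\
            Hmin s l `<=` Htheta s l theta &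
          forall A : set (efun R s * efun R s),
            self_adjoint l A -> Hmin s l `<=` A ->
            exists! theta : R, 0 <= theta < pi /\ A = Htheta s l theta]].
Proof.
split; first exact: vol_series.
- split=> [[_ sa]|h]; last exact: (Hmin_self_adjoint l_gt0 s_ge1 (vol_infinite l_gt0 h)).
  apply/eqP; rewrite -leye_eq leNgt; apply/negP => /(vol_finite l_gt0)[V hV].
  by have /eqP := Hmin_not_self_adjoint l_gt0 s_ge1 hV; apply.
- move=> /(vol_finite l_gt0)[V hV]; split.
  + exact: (Hmin_deficiency l_gt0 s_ge1 hV).
  + move=> p; rewrite adjoint_Hmin // => Hp; have [a [b h]] := BV_exists l_gt0 s_ge1 hV Hp.
    by exists a, b; exact: (BV_boundary l_gt0 s_ge1 hV h).
  + move=> theta _; split; first exact: (Htheta_self_adjoint l_gt0 s_ge1 hV theta).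
    exact: (Hmin_Htheta l_gt0 s_ge1 hV).
  + move=> A; exact: (self_adjoint_extension l_gt0 s_ge1 hV).
Qed.
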